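(* Let $H$ be a finite dimensional Hopf algebra over a field $k$ of characteristic zero, and regard $H$ as a quantum commutative left module algebra over its Drinfeld double $D(H)$ as described in the context. Then, as algebras, $H\#D(H)\cong\mathcal H(H^{cop})\otimes H$, where $\mathcal H(H^{cop})$ is the Heisenberg double of $H^{cop}$. Moreover, the tensor categories ${}_{H\#D(H)}\mathcal M$ and ${}_{H^{cop}}\mathcal M$ are equivalent.
   Context: $S$ is the antipode of $H$; Sweedler notation is used. The Drinfeld double $D(H)$ is $(H^{*})^{cop}\otimes H$ as a coalgebra, elements written $p\bowtie h$ ($p\in H^*$, $h\in H$), with product $(p\bowtie h)(q\bowtie g)=p\,(h_{(1)}\rightharpoonup q\leftharpoonup S^{-1}(h_{(3)}))\bowtie h_{(2)}g$, where $\langle h\rightharpoonup q\leftharpoonup g,l\rangle=\langle q,glh\rangle$. It is quasi-triangular with $R=\sum_i(\varepsilon\bowtie x_i)\otimes(p_i\bowtie1_H)$, where $\{x_i\},\{p_i\}$ are dual bases of $H$ and $H^*$. $H$ is a left $D(H)$-module algebra via $(\varepsilon\bowtie h)\cdot l=h_{(1)}lS(h_{(2)})$ and $(p\bowtie1_H)\cdot l=l\leftharpoonup S^{-1}(p)$, where $l\leftharpoonup q=\langle q,l_{(1)}\rangle l_{(2)}$ and $S^{-1}(p)=p\circ S^{-1}$. It is quantum commutative, meaning $ab=(R^2\cdot b)(R^1\cdot a)$ for $a,b\in H$, where $R=R^1\otimes R^2$. For a module algebra $A$ over a Hopf algebra $K$, $A\#K$ is $A\otimes K$ with product $(a\#h)(b\#g)=a(h_{(1)}\cdot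 b)\#h_{(2)}g$. For a finite dimensional Hopf algebra $K$, the Heisenberg double is $\mathcal H(K)=K\#K^*$ with $K^*$ acting on $K$ by $p\cdot k=k_{(1)}\langle p,k_{(2)}\rangle$. $H^{cop}$ is $H$ with opposite coproduct. ${}_L\mathcal M$ denotes the category of finite dimensional left $L$-modules. Monoidal structure on ${}_{A\#K}\mathcal M$ for $(K,R)$ quasi-triangular and $A$ quantum commutative (here $A=H$, $K=D(H)$): each left $A\#K$-module $M$ is an $A$-$A$-bimodule with $a\cdot m=(a\#1)m$, $m\cdot a=((R^2\cdot a)\#R^1)m$, and the tensor product is $M\otimes_AN$ with action $(a\#h)(m\otimes n)=(a\#h_{(1)})m\otimes(1_A\#h_{(2)})n$; the unit object is $A$. ${}_{H^{cop}}\mathcal M$ has its usual monoidal structure. *)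

(* Defs.v *)
From HB Require Import structures.
From mathcomp Require Import all_boot all_order all_algebra all_field.

Set Implicit Arguments.
Unset Strict Implicit.
Unset Printing Implicit Defensive.

Import GRing.Theory.
Local Open Scope ring_scope.

(* Conventions.
   - Derived structures (duals, doubles, smash products, module categories, ...)
     are given by their operations only; the records [..._data] carry no axiom
     and a predicate [is_...] states the axioms.
   - Every operation on a tensor product is given on pure tensors and extended
     with [lift], and [\sw_(a, b <- t) E] means "E summed over a decomposition
     of t into pure tensors a (x) b", so that [\sw_(a, b <- comul h) E] is
     Sweedler notation; it is meaningful when E is bilinear in a and b. *)

(* Tensor products and quotients of finite dimensional vector spaces. *)

Section LinearAlgebra.
Variable k : fieldType.
Implicit Types U V W : vectType k.

Definition bas U (i : 'I_(\dim {:U})) : U := (vbasis {:U})`_i.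

Definition dbas U (i : 'I_(\dim {:U})) : 'Hom(U, k^o) :=
  linfun (coord (vbasis {:U}) i : U -> k^o).

Definition tens U V : vectType k := 'M[k]_(\dim {:U}, \dim {:V}).

Definition tensor U V (u : U) (v : V) : tens U V :=
  \matrix_(i, j) (coord (vbasis {:U}) i u * coord (vbasis {:V}) j v).

Definition lift U V (W : lmodType k) (f : U -> V -> W) (t : tens U V) : W :=
  \sum_i \sum_j (t : 'M_(_, _)) i j *: f (bas i) (bas j).

Definition bilin U V (W : lmodType k) (f : U -> V -> W) : Prop :=
  (forall u, linear (f u)) /\ (forall v, linear (f^~ v)).

Lemma tensor_bilin U V : bilin (@tensor U V).
Proof.
split=> [u a x y|v a x y]; apply/matrixP=> i j; rewrite !mxE linearP /=.
  by rewrite mulrDr mulrCA.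
by rewrite mulrDl mulrA.
Qed.

Lemma lift_linear U V (W : lmodType k) (f : U -> V -> W) : linear (lift f).
Proof.
move=> a s t; rewrite /lift scaler_sumr -big_split /=; apply: eq_bigr => i _.
rewrite scaler_sumr -big_split /=; apply: eq_bigr => j _.
by rewrite !mxE scalerDl scalerA.
Qed.

Lemma lift_tensor U V (W : lmodType k) (f : U -> V -> W) u v :
  bilin f -> lift f (tensor u v) = f u v.
Proof.
case=> fr fl.
pose fR x := GRing.isLinear.Build _ _ _ _ (f x) (fr x).
pose FR x : {linear V -> W} := HB.pack (f x) (fR x).
pose fL y := GRing.isLinear.Build _ _ _ _ (f^~ y) (fl y).
pose FL y : {linear U -> W} := HB.pack (f^~ y) (fL y).
rewrite {2}(coord_vbasis (memvf u)) -[RHS]/(FL v _) linear_sum.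
apply: eq_bigr => i _; rewrite linearZ /= {2}(coord_vbasis (memvf v)).
rewrite -[f _ _]/(FR (bas i) _) linear_sum scaler_sumr.
by apply: eq_bigr => j _; rewrite linearZ /= mxE scalerA.
Qed.

Definition tmap U U' V V' (f : 'Hom(U, U')) (g : 'Hom(V, V')) :
    'Hom(tens U V, tens U' V') :=
  linfun (lift (fun u v => tensor (f u) (g v))).

(* V / W, realized on the complement W^C of W in V. *)
Definition quo V (W : {vspace V}) : vectType k := subvs_of (W^C)%VS.

Definition quo_pi V (W : {vspace V}) (v : V) : quo W :=
  vsproj (W^C)%VS (v - projv W v).

Definition quo_repr V (W : {vspace V}) (x : quo W) : V := vsval x.

Lemma quo_pi_linear V (W : {vspace V}) : linear (@quo_pi V W).
Proof.
move=> a u v; rewrite /quo_pi -(linearP (vsproj (W^C)%VS)) (linearP (projv W)).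
by rewrite scalerBr opprD addrACA.
Qed.

Lemma quo_reprK V (W : {vspace V}) : cancel (@quo_repr V W) (@quo_pi V W).
Proof.
move=> x; rewrite /quo_pi /quo_repr.
have -> : projv W (vsval x) = 0.
  by apply/eqP; rewrite -memv_ker lker_proj subvsP.
by rewrite subr0 vsvalK.
Qed.

Lemma quo_pi_eq0 V (W : {vspace V}) v : (quo_pi W v == 0) = (v \in W).
Proof.
have vW := memv_projC W v; apply/eqP/idP => [/(congr1 (@quo_repr V W))|Wv].
  rewrite /quo_pi /quo_repr (vsprojK vW) linear0 => /eqP; rewrite subr_eq0.
  by move=> /eqP->; apply: memv_proj.
by rewrite /quo_pi projv_id // subrr linear0.
Qed.

End LinearAlgebra.

Notation "u *t v" := (tensor u v) (at level 40, left associativity).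
Notation "\sw_ ( a , b <- t ) E" := (lift (fun a b => E) t)
  (at level 41, E at level 41, a name, b name, t at level 200,
   format "\sw_ ( a ,  b  <-  t )  E").

Record hopf_structure (k : fieldType) (H : falgType k) := HopfStructure {
  comul : 'Hom(H, tens H H);
  counit : 'Hom(H, k^o);
  antipode : 'End(H);
  comulA : forall h,
    \sw_(a, b <- comul h) \sw_(a1, a2 <- comul a) (a1 *t (a2 *t b))
      = \sw_(a, b <- comul h) \sw_(b1, b2 <- comul b) (a *t (b1 *t b2));
  counit_comull : forall h, \sw_(a, b <- comul h) (counit a *: b) = h;
  counit_comulr : forall h, \sw_(a, b <- comul h) (counit b *: a) = h;
  comul1 : comul 1 = 1 *t 1;
  comulM : forall g h, comul (g * h)
    = \sw_(g1, g2 <- comul g) \sw_(h1, h2 <- comul h) ((g1 * h1) *t (g2 * h2));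
  counit1 : counit 1 = 1;
  counitM : forall g h, counit (g * h) = counit g * counit h;
  antipodel : forall h, \sw_(a, b <- comul h) (antipode a * b) = counit h *: 1;
  antipoder : forall h, \sw_(a, b <- comul h) (a * antipode b) = counit h *: 1
}.

Section Algebras.
Variable k : fieldType.

Record alg_data := AlgData {
  acar :> vectType k;
  amul : acar -> acar -> acar;
  aone : acar
}.

Record is_algebra (A : alg_data) : Prop := IsAlgebra {
  amul_bilin : bilin (@amul A);
  amulA : associative (@amul A);
  amul1l : left_id (aone A) (@amul A);
  amul1r : right_id (aone A) (@amul A)
}.

Definition alg_iso (A B : alg_data) : Prop :=
  exists f : 'Hom(A, B),
    [/\ bijective f, f (aone A) = aone B &
        forall x y, f (amul x y) = amul (f x) (f y)].

Record bialg_data := BialgData {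
  balg :> alg_data;
  bcomul : balg -> tens balg balg;
  bcounit : balg -> k
}.

Definition falg_data (H : falgType k) : alg_data :=
  @AlgData H (fun x y => x * y) 1.

Definition tens_alg (A B : alg_data) : alg_data :=
  @AlgData (tens A B)
    (fun s t => \sw_(a, b <- s) \sw_(c, d <- t) (amul a c *t amul b d))
    (aone A *t aone B).

Definition smash (A : alg_data) (K : bialg_data) (act : K -> A -> A) : alg_data :=
  @AlgData (tens A K)
    (fun s t => \sw_(a, h <- s) \sw_(b, g <- t)
       \sw_(h1, h2 <- bcomul h) (amul a (act h1 b) *t amul h2 g))
    (aone A *t aone K).

(* The comultiplication of the dual is determined by <p, xy> = <p1, x> <p2, y>. *)
Definition dual (K : bialg_data) : bialg_data :=
  @BialgData
    (@AlgData 'Hom(K, k^o)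
       (fun p q => linfun (fun x => \sw_(x1, x2 <- bcomul x) (p x1 * q x2) : k^o))
       (linfun (fun x => bcounit x : k^o)))
    (fun p => \sum_i \sum_j p (amul (bas i) (bas j)) *: (dbas i *t dbas j))
    (fun p => p (aone K)).

(* p . x = x1 <p, x2> *)
Definition heis_act (K : bialg_data) (p : 'Hom(K, k^o)) (x : K) : K :=
  \sw_(x1, x2 <- bcomul x) (p x2 *: x1).

Definition heisenberg (K : bialg_data) : alg_data :=
  @smash K (dual K) (@heis_act K).

End Algebras.

Section Double.
Variables (k : fieldType) (H : falgType k) (HH : hopf_structure H).
Local Notation D := (comul HH).
Local Notation eps := (counit HH).
Local Notation S := (antipode HH).
(* The antipode of a finite dimensional Hopf algebra is bijective, and then
   (S^-1)%VF is its inverse. *)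
Local Notation S' := ((antipode HH)^-1)%VF.
Local Notation Hd := 'Hom(H, k^o).

Definition hopf_bialg : bialg_data k := @BialgData k (falg_data H) D eps.

Definition cop_bialg : bialg_data k :=
  @BialgData k (falg_data H) (fun h => \sw_(a, b <- D h) (b *t a)) eps.

(* <h -> q <- g, l> = <q, g l h> *)
Definition coreg2 (h : H) (q : Hd) (g : H) : Hd :=
  linfun (fun l => q (g * l * h)).

Definition double_mul (x y : tens Hd H) : tens Hd H :=
  \sw_(p, h <- x) \sw_(q, g <- y)
    \sw_(h1, h' <- D h) \sw_(h2, h3 <- D h')
      (@amul _ (dual hopf_bialg) p (coreg2 h1 q (S' h3)) *t (h2 * g)).

Definition drinfeld_double : bialg_data k :=
  @BialgData k
    (@AlgData k (tens Hd H) double_mul (eps *t 1))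
    (fun x => \sw_(p, h <- x)
       \sw_(p1, p2 <- @bcomul _ (dual hopf_bialg) p) \sw_(h1, h2 <- D h)
         ((p2 *t h1) *t (p1 *t h2)))
    (fun x => \sw_(p, h <- x) ((p : Hd) 1 * eps h : k^o)).

Definition double_R : tens drinfeld_double drinfeld_double :=
  \sum_i ((eps *t bas i) *t (dbas i *t 1)).

(* l <- q = <q, l1> l2 *)
Definition hit_r (l : H) (q : Hd) : H := \sw_(l1, l2 <- D l) (q l1 *: l2).

(* p >< h = (p >< 1)(eps >< h) acts by l |-> (h1 l S(h2)) <- S^-1(p). *)
Definition double_act (x : drinfeld_double) (l : falg_data H) : falg_data H :=
  \sw_(p, h <- x)
    hit_r (\sw_(h1, h2 <- D h) (h1 * (l : H) * S h2)) (p \o S')%VF.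

Definition smash_double : alg_data k := smash double_act.

End Double.

(* In a [premonoidal] the tensor operations are defined on pre-objects and
   pre-morphisms; the objects and the morphisms of the category at hand are
   those satisfying [isob] and [ishom]. *)

Section MonoidalCategories.
Variable k : fieldType.

Record premonoidal := Premonoidal {
  ob : Type;
  isob : ob -> Prop;
  hom : ob -> ob -> lmodType k;
  ishom : forall X Y, hom X Y -> Prop;
  idm : forall X, hom X X;
  comp : forall X Y Z, hom Y Z -> hom X Y -> hom X Z;
  tob : ob -> ob -> ob;
  tmor : forall X X' Y Y', hom X X' -> hom Y Y' -> hom (tob X Y) (tob X' Y');
  uob : ob;
  assoc : forall X Y Z, hom (tob (tob X Y) Z) (tob X (tob Y Z));
  lunit : forall X, hom (tob uob X) X;
  runit : forall X, hom (tob X uob) X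
}.

Section MonoidalLaws.
Variable C : premonoidal.

Definition arrow (X Y : ob C) (f : hom X Y) : Prop :=
  [/\ isob X, isob Y & ishom f].

Definition isom (X Y : ob C) (f : hom X Y) : Prop :=
  arrow f /\ exists g : hom Y X,
    [/\ arrow g, comp g f = idm X & comp f g = idm Y].

Record is_lin_category : Prop := IsLinCategory {
  arrow_lin : forall (X Y : ob C) (a : k) (f g : hom X Y),
    arrow f -> arrow g -> arrow (a *: f + g);
  arrow0 : forall X Y : ob C, isob X -> isob Y -> arrow (0 : hom X Y);
  arrow_id : forall X : ob C, isob X -> arrow (idm X);
  arrow_comp : forall (X Y Z : ob C) (g : hom Y Z) (f : hom X Y),
    arrow g -> arrow f -> arrow (comp g f);
  compA : forall (X Y Z T : ob C) (h : hom Z T) (g : hom Y Z) (f : hom X Y),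
    arrow h -> arrow g -> arrow f -> comp h (comp g f) = comp (comp h g) f;
  comp_idl : forall (X Y : ob C) (f : hom X Y), arrow f -> comp (idm Y) f = f;
  comp_idr : forall (X Y : ob C) (f : hom X Y), arrow f -> comp f (idm X) = f;
  comp_linl : forall (X Y Z : ob C) a (g g' : hom Y Z) (f : hom X Y),
    arrow g -> arrow g' -> arrow f ->
    comp (a *: g + g') f = a *: comp g f + comp g' f;
  comp_linr : forall (X Y Z : ob C) a (g : hom Y Z) (f f' : hom X Y),
    arrow g -> arrow f -> arrow f' ->
    comp g (a *: f + f') = a *: comp g f + comp g f'
}.

Record is_monoidal : Prop := IsMonoidal {
  mon_cat : is_lin_category;
  tob_isob : forall X Y : ob C, isob X -> isob Y -> isob (tob X Y);
  uob_isob : isob (uob C);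
  tmor_arrow : forall (X X' Y Y' : ob C) (f : hom X X') (g : hom Y Y'),
    arrow f -> arrow g -> arrow (tmor f g);
  tmor_id : forall X Y : ob C, isob X -> isob Y ->
    tmor (idm X) (idm Y) = idm (tob X Y);
  tmor_comp : forall (X X' X'' Y Y' Y'' : ob C) (f : hom X X') (f' : hom X' X'')
      (g : hom Y Y') (g' : hom Y' Y''),
    arrow f -> arrow f' -> arrow g -> arrow g' ->
    tmor (comp f' f) (comp g' g) = comp (tmor f' g') (tmor f g);
  tmor_linl : forall (X X' Y Y' : ob C) a (f f' : hom X X') (g : hom Y Y'),
    arrow f -> arrow f' -> arrow g ->
    tmor (a *: f + f') g = a *: tmor f g + tmor f' g;
  tmor_linr : forall (X X' Y Y' : ob C) a (f : hom X X') (g g' : hom Y Y'),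
    arrow f -> arrow g -> arrow g' ->
    tmor f (a *: g + g') = a *: tmor f g + tmor f g';
  assoc_isom : forall X Y Z : ob C,
    isob X -> isob Y -> isob Z -> isom (assoc X Y Z);
  lunit_isom : forall X : ob C, isob X -> isom (lunit X);
  runit_isom : forall X : ob C, isob X -> isom (runit X);
  assoc_nat : forall (X X' Y Y' Z Z' : ob C)
      (f : hom X X') (g : hom Y Y') (h : hom Z Z'),
    arrow f -> arrow g -> arrow h ->
    comp (assoc X' Y' Z') (tmor (tmor f g) h)
      = comp (tmor f (tmor g h)) (assoc X Y Z);
  lunit_nat : forall (X X' : ob C) (f : hom X X'), arrow f ->
    comp (lunit X') (tmor (idm (uob C)) f) = comp f (lunit X);
  runit_nat : forall (X X' : ob C) (f : hom X X'), arrow f ->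
    comp (runit X') (tmor f (idm (uob C))) = comp f (runit X);
  pentagon : forall X Y Z T : ob C, isob X -> isob Y -> isob Z -> isob T ->
    comp (tmor (idm X) (assoc Y Z T))
         (comp (assoc X (tob Y Z) T) (tmor (assoc X Y Z) (idm T)))
      = comp (assoc X Y (tob Z T)) (assoc (tob X Y) Z T);
  triangle : forall X Y : ob C, isob X -> isob Y ->
    comp (tmor (idm X) (lunit Y)) (assoc X (uob C) Y) = tmor (runit X) (idm Y)
}.

End MonoidalLaws.

Record prefunctor (C D : premonoidal) := Prefunctor {
  fob :> ob C -> ob D;
  fmor : forall X Y, hom X Y -> hom (fob X) (fob Y)
}.

Record is_lin_functor (C D : premonoidal) (F : prefunctor C D) : Prop :=
  IsLinFunctor {
  fob_isob : forall X, isob X -> isob (F X);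
  fmor_arrow : forall (X Y : ob C) (f : hom X Y), arrow f -> arrow (fmor F f);
  fmor_id : forall X, isob X -> fmor F (idm X) = idm (F X);
  fmor_comp : forall (X Y Z : ob C) (g : hom Y Z) (f : hom X Y),
    arrow g -> arrow f -> fmor F (comp g f) = comp (fmor F g) (fmor F f);
  fmor_lin : forall (X Y : ob C) a (f g : hom X Y), arrow f -> arrow g ->
    fmor F (a *: f + g) = a *: fmor F f + fmor F g
}.

Definition id_functor (C : premonoidal) : prefunctor C C :=
  @Prefunctor C C id (fun _ _ f => f).

Definition comp_functor (C D E : premonoidal)
    (G : prefunctor D E) (F : prefunctor C D) : prefunctor C E :=
  @Prefunctor C E (G \o F) (fun _ _ f => fmor G (fmor F f)).

Definition nat_isomorphic (C D : premonoidal) (F G : prefunctor C D) : Prop :=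
  exists eta : forall X, hom (F X) (G X),
    (forall X, isob X -> isom (eta X)) /\
    (forall (X Y : ob C) (f : hom X Y), arrow f ->
       comp (eta Y) (fmor F f) = comp (fmor G f) (eta X)).

Definition is_equivalence (C D : premonoidal) (F : prefunctor C D) : Prop :=
  is_lin_functor F /\
  exists G : prefunctor D C,
    [/\ is_lin_functor G,
        nat_isomorphic (comp_functor G F) (id_functor C) &
        nat_isomorphic (comp_functor F G) (id_functor D)].

Record is_monoidal_functor (C D : premonoidal) (F : prefunctor C D)
    (J : forall X Y, hom (tob (F X) (F Y)) (F (tob X Y)))
    (J0 : hom (uob D) (F (uob C))) : Prop := IsMonoidalFunctor {
  monf_functor : is_lin_functor F;
  monf_isom : forall X Y, isob X -> isob Y -> isom (J X Y);
  monf_isom0 : isom J0;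
  monf_nat : forall (X X' Y Y' : ob C) (f : hom X X') (g : hom Y Y'),
    arrow f -> arrow g ->
    comp (J X' Y') (tmor (fmor F f) (fmor F g))
      = comp (fmor F (tmor f g)) (J X Y);
  monf_assoc : forall X Y Z, isob X -> isob Y -> isob Z ->
    comp (fmor F (assoc X Y Z)) (comp (J (tob X Y) Z) (tmor (J X Y) (idm (F Z))))
      = comp (J X (tob Y Z))
             (comp (tmor (idm (F X)) (J Y Z)) (assoc (F X) (F Y) (F Z)));
  monf_lunit : forall X, isob X ->
    comp (fmor F (lunit X)) (comp (J (uob C) X) (tmor J0 (idm (F X))))
      = lunit (F X);
  monf_runit : forall X, isob X ->
    comp (fmor F (runit X)) (comp (J X (uob C)) (tmor (idm (F X)) J0))
      = runit (F X)
}.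

Definition monoidally_equivalent (C D : premonoidal) : Prop :=
  exists (F : prefunctor C D) J J0,
    @is_monoidal_functor C D F J J0 /\ is_equivalence F.

End MonoidalCategories.

Section Modules.
Variable k : fieldType.

Record mod_data (L : alg_data k) := ModData {
  mcar :> vectType k;
  mact : L -> mcar -> mcar
}.

Record is_module (L : alg_data k) (M : mod_data L) : Prop := IsModule {
  mact_bilin : bilin (@mact L M);
  mact1 : forall m : M, mact (aone L) m = m;
  mactM : forall (x y : L) (m : M), mact (amul x y) m = mact x (mact y m)
}.

Definition is_modhom (L : alg_data k) (M N : mod_data L) (f : 'Hom(M, N)) : Prop :=
  forall (x : L) (m : M), f (mact x m) = mact x (f m).

Section BialgebraModules.
Variable K : bialg_data k.
Implicit Types M N P : mod_data K.

Definition bmod_tens M N : mod_data K :=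
  @ModData K (tens M N)
    (fun x t => \sw_(x1, x2 <- bcomul x) \sw_(m, n <- t)
       (mact x1 m *t mact x2 n)).

Definition bmod_unit : mod_data K := @ModData K k^o (fun x c => bcounit x * c).

Definition bmod_assoc M N P :
    'Hom(bmod_tens (bmod_tens M N) P, bmod_tens M (bmod_tens N P)) :=
  linfun (fun t : tens (tens M N) P =>
    \sw_(s, p <- t) \sw_(m, n <- s) (m *t (n *t p))).

Definition bmod_lunit M : 'Hom(bmod_tens bmod_unit M, M) :=
  linfun (lift (fun (c : k^o) (m : M) => (c : k) *: m)).

Definition bmod_runit M : 'Hom(bmod_tens M bmod_unit, M) :=
  linfun (lift (fun (m : M) (c : k^o) => (c : k) *: m)).

Definition bialg_modules : premonoidal k :=
  @Premonoidal k (mod_data K) (@is_module K)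
    (fun M N => 'Hom(M, N)) (@is_modhom K)
    (fun M => \1%VF) (fun _ _ _ g f => (g \o f)%VF)
    bmod_tens (fun _ _ _ _ f g => tmap f g) bmod_unit
    bmod_assoc bmod_lunit bmod_runit.

End BialgebraModules.

Section SmashModules.
Variables (A : alg_data k) (K : bialg_data k) (act : K -> A -> A).
Variable R : tens K K.
Local Notation AK := (smash act).
Implicit Types M N P : mod_data AK.

Definition lact M (a : A) (m : M) : M := mact (a *t aone K : AK) m.

(* m . a = ((R2 . a) # R1) m *)
Definition ract M (m : M) (a : A) : M :=
  \sw_(r1, r2 <- R) mact (act r2 a *t r1 : AK) m.

(* The span of the (m . a) (x) n - m (x) (a . n). *)
Definition bal_rel M N : {vspace tens M N} :=
  (\sum_i \sum_j \sum_l
     <[ract (bas i) (bas j) *t bas l - bas i *t lact (bas j) (bas l)]>)%VS.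

Definition smod_tensor M N (m : M) (n : N) : quo (bal_rel M N) :=
  quo_pi (bal_rel M N) (m *t n).

Definition smod_tens M N : mod_data AK :=
  @ModData AK (quo (bal_rel M N))
    (fun x t => \sw_(a, h <- x) \sw_(h1, h2 <- bcomul h)
       \sw_(m, n <- quo_repr t)
         smod_tensor (mact (a *t h1 : AK) m) (mact (aone A *t h2 : AK) n)).

Definition smod_tmap M M' N N' (f : 'Hom(M, M')) (g : 'Hom(N, N')) :
    'Hom(smod_tens M N, smod_tens M' N') :=
  linfun (fun t : quo (bal_rel M N) =>
    \sw_(m, n <- quo_repr t) smod_tensor (f m) (g n)).

Definition smod_unit : mod_data AK :=
  @ModData AK A (fun x b => \sw_(a, h <- x) amul a (act h b)).

Definition smod_assoc M N P :
    'Hom(smod_tens (smod_tens M N) P, smod_tens M (smod_tens N P)) :=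
  linfun (fun t : quo (bal_rel (smod_tens M N) P) =>
    \sw_(s, p <- quo_repr t) \sw_(m, n <- quo_repr (s : quo (bal_rel M N)))
      smod_tensor m (smod_tensor n p : smod_tens N P)).

Definition smod_lunit M : 'Hom(smod_tens smod_unit M, M) :=
  linfun (fun t : quo (bal_rel smod_unit M) =>
    \sw_(a, m <- quo_repr t) lact a m).

Definition smod_runit M : 'Hom(smod_tens M smod_unit, M) :=
  linfun (fun t : quo (bal_rel M smod_unit) =>
    \sw_(m, a <- quo_repr t) ract m a).

Definition smash_modules : premonoidal k :=
  @Premonoidal k (mod_data AK) (@is_module AK)
    (fun M N => 'Hom(M, N)) (@is_modhom AK)
    (fun M => \1%VF) (fun _ _ _ g f => (g \o f)%VF)
    smod_tens smod_tmap smod_unit smod_assoc smod_lunit smod_runit.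

End SmashModules.

End Modules.

(* Main.v *)
From HB Require Import structures.
From mathcomp Require Import all_boot all_order all_algebra all_field.
Require Import Defs.
Set Implicit Arguments.
Unset Strict Implicit.
Unset Printing Implicit Defensive.
Import GRing.Theory.
Local Open Scope ring_scope.

(** Write L for H # D(H) and h = h_1 (x) h_2 for the coproduct of H.

    The proof replaces L-modules by a simpler notion.  A Hopf bimodule is an
    H-H-bimodule M with a left coaction m |-> m_{-1} (x) m_0 such that
    (a m b)_{-1} (x) (a m b)_0 = a_1 m_{-1} b_1 (x) a_2 m_0 b_2.  On such an M
    the element a # (p >< h) acts by
    [smash_act] :  m |-> a . p(S^-1(n_{-1})) n_0   with   n = h_1 m S(h_2),
    and this is an action of L ([smash_actM]).  Conversely H # 1 and the
    elements given by R act on any L-module as left and right multiplications,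
    and H^* gives the coaction, so that L-modules and Hopf bimodules are the
    same thing ([mod_bimod], [mod_act_bimod]).  Under this dictionary the
    tensor product over H has a (m (x) n) b = a m (x) n b and coaction
    m_{-1} n_{-1} (x) m_0 (x) n_0 ([smod_act]), and the unit is H with its
    regular structure ([unit_act]).

    Algebras.  Every H-module V gives a Hopf bimodule H (x) V with
    (l (x) v) a = l a_1 (x) S^-1(a_2) v ([free_bimod]).  For V = H the algebra
    L acts on H (x) H, and so does Heisenberg(H^cop) (x) H, by
    ((a # q) (x) h)(l (x) v) = q(l_1) a l_2 (x) h v.  The second action is
    faithful ([heis_act_HH_inj]).  The operators l (x) v |-> l (x) h v of the
    second action come from elements of L as well: multiplying on the right by
    S(h_1) and then on the first factor only by h_2 leaves l (x) h v
    ([smash_act_central]).  Hence the second algebra maps injectively to L,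
    compatibly with the two actions, and the two dimensions are both equal to
    (dim H)^3, so that the map is bijective and the action of L is faithful
    too.  The algebra axioms, the multiplicativity of the map, and all
    relations in L used to pass from modules to Hopf bimodules are then checked
    in this representation.

    Categories.  For a Hopf bimodule M let E(m) = S(m_{-1}) m_0, the projection
    on the coinvariants of M.  The coinvariants form an H-module by
    h * v = E(v S(h)).  By the fundamental theorem of Hopf modules
    m = m_{-1} E(m_0), the functors M |-> E(M) and V |-> H (x) V are
    quasi-inverse equivalences ([coinv_functor_equivalence]).  The formula
    E(m (x) n) = E(m n_{-1}) (x) E(n_0) of [coinv_proj_tprod] shows that the
    coinvariants of a tensor product over H are the tensor product of the
    coinvariants, and that h acts there by h_2 (x) h_1, because S reverses the
    coproduct: this is the monoidal structure of H^cop-modules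
    ([coinv_tens_hom], [coinv_functor_monoidal]).

    Everything rests on the bijectivity of the antipode of a finite dimensional
    Hopf algebra ([antipode_inj]), proved from Fitting's decomposition of a
    power of S^2. *)

(** * Linear maps *)

Section Lin.
Variable k : fieldType.
(** The head symbol [lin] keys the goals of the tactic [lin] below, which proves linearity of a function by
    following the shape of its body. *)
Definition lin (U V : lmodType k) (f : U -> V) : Prop := linear f.

Section Gen.
Variables U V W X : lmodType k.

Lemma linD (f : U -> V) : lin f -> {morph f : x y / x + y}.
Proof. by move=> lf x y; rewrite -[x]scale1r lf !scale1r. Qed.
Lemma lin0 (f : U -> V) : lin f -> f 0 = 0.
Proof. by move=> lf; apply: (addrI (f 0)); rewrite -linD // !addr0. Qed.
Lemma linZ (f : U -> V) a x : lin f -> f (a *: x) = a *: f x.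
Proof. by move=> lf; rewrite -[a *: x]addr0 lf lin0 // addr0. Qed.
Lemma lin_bigsum (f : U -> V) (I : finType) (F : I -> U) :
  lin f -> f (\sum_i F i) = \sum_i f (F i).
Proof. by move=> lf; apply: (big_morph f (linD lf) (lin0 lf)). Qed.

Lemma lin_id : lin (fun x : U => x). Proof. by []. Qed.
Lemma lin_scaler (c : k) (g : U -> V) : lin g -> lin (fun x => c *: g x).
Proof. by move=> lg a x y; rewrite lg scalerDr !scalerA mulrC. Qed.
Lemma lin_scalel (g : U -> k^o) (v : V) : lin g -> lin (fun x => g x *: v).
Proof. by move=> lg a x y; rewrite lg scalerDl scalerA. Qed.
Lemma lin_add (f g : U -> V) : lin f -> lin g -> lin (fun x => f x + g x).
Proof. by move=> lf lg a x y; rewrite lf lg scalerDr addrACA. Qed.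
Lemma lin_opp (f : U -> V) : lin f -> lin (fun x => - f x).
Proof. by move=> lf a x y; rewrite lf opprD scalerN. Qed.
Lemma lin_sum (I : finType) (F : I -> U -> V) :
  (forall i, lin (F i)) -> lin (fun x => \sum_i F i x).
Proof.
move=> lF a x y; rewrite scaler_sumr -big_split /=.
by apply: eq_bigr => i _; rewrite lF.
Qed.
Lemma lin_app (f : V -> W) (g : U -> V) : lin f -> lin g -> lin (fun x => f (g x)).
Proof. by move=> lf lg a x y; rewrite lg lf. Qed.
End Gen.

Section Bil.
Variables (U X : lmodType k) (V W : vectType k).
Lemma lin_bil_r (f : V -> W -> X) v (g : U -> W) :
  bilin f -> lin g -> lin (fun x => f v (g x)).
Proof. by case=> fr _ lg a x y; rewrite lg fr. Qed.
Lemma lin_bil_l (f : V -> W -> X) v (g : U -> V) :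
  bilin f -> lin g -> lin (fun x => f (g x) v).
Proof. by case=> _ fl lg a x y; rewrite lg fl. Qed.
End Bil.

Lemma lin_mulkr (U : lmodType k) (g : U -> k^o) (c : k) :
  lin g -> lin (fun x => g x * c : k^o).
Proof. by move=> lg a x y; rewrite lg mulrDl -scalerAl. Qed.
Lemma lin_mulkl (U : lmodType k) (g : U -> k^o) (c : k) :
  lin g -> lin (fun x => c * g x : k^o).
Proof. by move=> lg a x y; rewrite lg mulrDr mulrCA. Qed.

Section Vect.
Variables (T : lmodType k) (U V : vectType k) (W : lmodType k).

Lemma lin_lfun (R : vectType k) (f : 'Hom(U, R)) (g : T -> U) :
  lin g -> lin (fun x => f (g x)).
Proof. by move=> lg a x y; rewrite lg linearP. Qed.
Lemma lin_lfunl (R : vectType k) (g : T -> 'Hom(U, R)) (u : U) :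
  lin g -> lin (fun x => g x u).
Proof. by move=> lg a x y; rewrite lg add_lfunE scale_lfunE. Qed.
Lemma lin_lift (E : U -> V -> W) (t : T -> tens U V) :
  lin t -> lin (fun x => lift E (t x)).
Proof. by move=> lt a x y; rewrite lt lift_linear. Qed.
Lemma lin_liftb (E : T -> U -> V -> W) (t : tens U V) :
  (forall a b, lin (fun x => E x a b)) -> lin (fun x => lift (E x) t).
Proof.
move=> lE a x y; rewrite /lift scaler_sumr -big_split /=; apply: eq_bigr => i _.
rewrite scaler_sumr -big_split /=; apply: eq_bigr => j _.
by rewrite lE scalerDr !scalerA mulrC.
Qed.
Lemma lin_linfun (R : vectType k) (E : T -> U -> R) :
  (forall x, lin (E x)) -> (forall u, lin (fun x => E x u)) ->
  lin (fun x => linfun (E x)).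
Proof.
move=> lE lE' a x y; apply/lfunP => u; rewrite add_lfunE scale_lfunE.
pose m z := GRing.isLinear.Build _ _ _ _ (E z) (lE z).
pose M z : {linear U -> R} := HB.pack (E z) (m z).
by rewrite -![linfun (E _)]/(linfun (M _)) !lfunE /= lE'.
Qed.
End Vect.

Lemma linfunE (U V : vectType k) (f : U -> V) : lin f -> linfun f =1 f.
Proof.
move=> lf u; pose m := GRing.isLinear.Build _ _ _ _ f lf.
pose M : {linear U -> V} := HB.pack f m.
by rewrite -[linfun f]/(linfun M) lfunE.
Qed.

Lemma scale_bilin (V : vectType k) : bilin (fun (c : k^o) (v : V) => c *: v).
Proof.
by split=> [c|v]; [apply: lin_scaler; exact: lin_id|apply: (@lin_scalel k^o V id v); exact: lin_id].
Qed.
Lemma comp_bilin (U V W : vectType k) : bilin (@comp_lfun k U V W).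
Proof.
split=> [f|g] a x y; first by rewrite comp_lfunDr comp_lfunZr.
by rewrite comp_lfunDl comp_lfunZl.
Qed.
Lemma bilinI (U V : vectType k) (W : lmodType k) (f : U -> V -> W) :
  (forall u, lin (f u)) -> (forall v, lin (fun u => f u v)) -> bilin f.
Proof. by []. Qed.
Lemma mul_bilin (A : falgType k) : bilin (@GRing.mul A).
Proof.
split=> [x|y] a u v; first by rewrite mulrDr scalerAr.
by rewrite mulrDl scalerAl.
Qed.
End Lin.

Create HintDb bil.
Create HintDb linear_fun.
#[export] Hint Resolve tensor_bilin scale_bilin comp_bilin mul_bilin : bil.

Ltac lin_hyp := match goal with h : context [@lin] |- _ => solve [apply: h] end.
Ltac lin_app_ne f g :=
  lazymatch g with (fun y => y) => first [solve [eauto 2 with linear_fun nocore] | exact: (linearP f)] | _ => apply: (@lin_app _ _ _ _ f g) end.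
(** In [f (a x) (b x)] the variable may occur in either argument, so the two are matched as functions of x
    and the constant one is recognized by its shape.  Multiplication is treated apart, since in
    the ground field it is not the product of an algebra over that field. *)
Ltac lin_apps :=
  first [lin_hyp
  | match goal with
    | |- lin (fun x => ?h (@?a x) (@?b x)) =>
      lazymatch a with
      | (fun _ => ?a0) =>
        lazymatch h with
        | @GRing.mul _ => first [apply: (@lin_mulkl _ _ b a0) | apply: (@lin_bil_r _ _ _ _ _ h a0 b)]
        | _ => first [apply: (@lin_bil_r _ _ _ _ _ h a0 b) | lin_app_ne (h a0) b]
        end
      | _ =>
        lazymatch b with
        | (fun _ => ?b0) =>
          lazymatch h with
          | @GRing.mul _ => first [apply: (@lin_mulkr _ _ a b0) | apply: (@lin_bil_l _ _ _ _ _ h b0 a)]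
          | _ => apply: (@lin_bil_l _ _ _ _ _ h b0 a)
          end
        end
      end
    end
  | match goal with |- lin (fun x => ?f (@?g x)) => lin_app_ne f g end].
Ltac lin_step := cbv beta;
  lazymatch goal with
  | |- bilin _ => first [solve [eauto 2 with bil nocore] | apply: bilinI; intro]
  | |- linear _ => first [exact: linearP | match goal with |- @GRing.linear_for _ _ _ _ ?f => change (lin f) end]
  | |- lin (fun x => x) => exact: lin_id
  | |- lin (fun x => fun_of_lfun (@?f x) (@?g x)) =>
    lazymatch f with
    | (fun _ => ?f0) => apply: (@lin_lfun _ _ _ _ f0 g)
    | _ => lazymatch g with (fun _ => ?v) => apply: (@lin_lfunl _ _ _ _ f v) end
    end
  | |- lin (fun x => lift (@?E x) (@?t x)) =>
    lazymatch t with
    | (fun _ => ?t0) => apply: (@lin_liftb _ _ _ _ _ E t0); intros ? ?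
    | _ => lazymatch E with (fun _ => ?E0) => apply: (@lin_lift _ _ _ _ _ E0 t) end
    end
  | |- lin (fun x => linfun (@?E x)) => apply: (@lin_linfun _ _ _ _ E); intro
  | |- lin (fun x => (@?c x) *: (@?g x)) =>
    lazymatch c with
    | (fun _ => ?c0) => apply: (@lin_scaler _ _ _ c0 g)
    | _ => lazymatch g with (fun _ => ?v) => apply: (@lin_scalel _ _ _ c v) end
    end
  | |- lin (fun x => (@?f x) + (@?g x)) => apply: (@lin_add _ _ _ f g)
  | |- lin (fun x => - (@?f x)) => apply: (@lin_opp _ _ _ f)
  | |- lin (fun x => bigop _ _ _) => apply: lin_sum; intro
  | |- lin (fun x => _ _) => lin_apps
  | |- lin ?f => first [lin_hyp | solve [eauto 2 with linear_fun nocore] | exact: linearP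
      | lazymatch f with fun _ => _ => fail | _ => change (lin (fun x => f x)) end]
  end.
Ltac lin := repeat lin_step.

(** * Tensor products *)

Section Tens.
Variable k : fieldType.
Implicit Types U V W : vectType k.

Lemma eq_lift U V (W : lmodType k) (f g : U -> V -> W) t :
  (forall a b, f a b = g a b) -> lift f t = lift g t.
Proof. by move=> e; apply: eq_bigr => i _; apply: eq_bigr => j _; rewrite e. Qed.

Lemma lin_of_lift U V (W X : lmodType k) (F : W -> X) (f : U -> V -> W) t :
  lin F -> F (lift f t) = lift (fun a b => F (f a b)) t.
Proof.
move=> lF; rewrite lin_bigsum //; apply: eq_bigr => i _; rewrite lin_bigsum //.
by apply: eq_bigr => j _; rewrite linZ.
Qed.

Lemma lift_lift U V U' V' (W : lmodType k) (f : U -> V -> W)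
    (g : U' -> V' -> tens U V) t :
  lift f (lift g t) = lift (fun a b => lift f (g a b)) t.
Proof. by apply: (lin_of_lift (F := lift f)); apply: lift_linear. Qed.

(** Together with coassociativity, this is all the reordering of Sweedler sums that the computations
    below need. *)
Lemma lift_exch U V U' V' (W : lmodType k) (f : U -> V -> U' -> V' -> W) s t :
  \sw_(a, b <- s) \sw_(c, d <- t) f a b c d
    = \sw_(c, d <- t) \sw_(a, b <- s) f a b c d.
Proof.
transitivity (\sum_i \sum_j \sum_c \sum_d
    ((s : 'M_(_, _)) i j * (t : 'M_(_, _)) c d) *: f (bas i) (bas j) (bas c) (bas d)).
  apply: eq_bigr => i _; apply: eq_bigr => j _; rewrite scaler_sumr.
  apply: eq_bigr => c _; rewrite scaler_sumr; apply: eq_bigr => d _.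
  by rewrite scalerA.
under eq_bigr => i _ do rewrite exchange_big; rewrite exchange_big /=.
apply: eq_bigr => c _.
under eq_bigr => i _ do rewrite exchange_big; rewrite exchange_big /=.
apply: eq_bigr => d _; rewrite scaler_sumr; apply: eq_bigr => i _.
rewrite scaler_sumr; apply: eq_bigr => j _.
by rewrite scalerA mulrC.
Qed.

Lemma scale_lift U V (W : lmodType k) (c : k) (f : U -> V -> W) t :
  c *: lift f t = \sw_(a, b <- t) (c *: f a b).
Proof. exact: (lin_of_lift (F := fun w => c *: w)) (lin_scaler _ (@lin_id _ _)). Qed.

Lemma lfun_lift U V W (X : vectType k) (F : 'Hom(W, X)) (f : U -> V -> W) t :
  F (lift f t) = \sw_(a, b <- t) F (f a b).
Proof. by rewrite lin_of_lift //; exact: linearP. Qed.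

Lemma lift_sum U V (W : lmodType k) (I : finType) (F : I -> U -> V -> W) t :
  \sw_(a, b <- t) (\sum_i F i a b) = \sum_i lift (F i) t.
Proof.
rewrite /lift [RHS]exchange_big; apply: eq_bigr => i _.
by rewrite [RHS]exchange_big; apply: eq_bigr => j _; rewrite scaler_sumr.
Qed.

Lemma coord_bas U (i j : 'I_(\dim {:U})) : coord (vbasis {:U}) i (bas j) = (j == i)%:R.
Proof. by rewrite coord_free ?(basis_free (vbasisP _)). Qed.

Lemma lift_id U V (t : tens U V) : \sw_(a, b <- t) (a *t b) = t.
Proof.
rewrite [RHS](matrix_sum_delta t); apply: eq_bigr => i _; apply: eq_bigr => j _.
congr (_ *: _); apply/matrixP=> a b; rewrite !mxE !coord_bas -natrM mulnb.
by rewrite [i == a]eq_sym [j == b]eq_sym.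
Qed.

Lemma tens_ext U V (W : lmodType k) (f g : tens U V -> W) : lin f -> lin g ->
  (forall u v, f (u *t v) = g (u *t v)) -> f =1 g.
Proof.
move=> lf lg e t; rewrite -[t]lift_id !lin_of_lift //; exact: eq_lift.
Qed.

Definition trilin U V W (X : lmodType k) (f : U -> V -> W -> X) : Prop :=
  [/\ forall a b, lin (f a b), forall a c, lin (fun b => f a b c) &
      forall b c, lin (fun a => f a b c)].

Lemma lift_assocP U V W (X : lmodType k) (f : U -> V -> W -> X) u v w :
  trilin f -> \sw_(a, t <- u *t (v *t w)) \sw_(b, c <- t) f a b c = f u v w.
Proof.
case=> f1 f2 f3; rewrite lift_tensor; first by rewrite lift_tensor //; lin.
by lin.
Qed.
End Tens.

Ltac solve_lin := lazymatch goal with |- trilin _ => split; intros ? ?; lin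
   | |- _ => lin end.
Tactic Notation "lin_rewrite" uconstr(l) := rewrite l; last by solve_lin.
(** [pull_sw F] moves the linear function F under the Sweedler sum to which it is applied, and [pull_scale F] moves it
    past a scalar. *)
Tactic Notation "pull_sw" open_constr(F) :=
  let E := fresh in have E := lin_of_lift (F := F); cbv beta in E; (rewrite E; last by solve_lin); clear E.
Tactic Notation "pull_scale" open_constr(F) :=
  let E := fresh in have E := linZ (f := F); cbv beta in E; (rewrite E; last by solve_lin); clear E.
(** Instantiating a Sweedler identity at an explicit multilinear expression leaves beta-redexes that
    must be reduced before the left hand side can be found in the goal; multilinearity is then checked by
    [solve_lin]. *)
Tactic Notation "sw_rewrite" open_constr(l) :=
  let E := fresh in have E := l; cbv beta in E; (rewrite E; last by solve_lin); clear E.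
Tactic Notation "sw_rewrite" "<-" open_constr(l) :=
  let E := fresh in have E := l; cbv beta in E; (rewrite -E; last by solve_lin); clear E.

(** * The Hopf algebra axioms inside multilinear expressions *)

Section HopfBasics.
Variables (k : fieldType) (H : falgType k) (HH : hopf_structure H).
Local Notation D := (comul HH).
Local Notation eps := (counit HH).
Local Notation S := (antipode HH).
Variable W : lmodType k.

(** Coassociativity in the form used in all computations: both sides are images of the two
    iterated coproducts under the linear map that f induces on a triple tensor product. *)
Lemma comulA_sw h (f : H -> H -> H -> W) : trilin f ->
  \sw_(a, b <- D h) \sw_(a1, a2 <- D a) f a1 a2 b
    = \sw_(a, b <- D h) \sw_(b1, b2 <- D b) f a b1 b2.
Proof.
move=> tf; pose F t := \sw_(a, t' <- t) \sw_(b, c <- t') f a b c.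
have lF : lin F by rewrite /F; lin.
have FE u v w : F (u *t (v *t w)) = f u v w by apply: lift_assocP.
have := congr1 F (comulA HH h).
rewrite !(lin_of_lift _ _ lF).
under eq_lift => a b do rewrite (lin_of_lift _ _ lF).
under [RHS]eq_lift => a b do rewrite (lin_of_lift _ _ lF).
under eq_lift => a b do under eq_lift => a1 a2 do rewrite FE.
by move=> ->; apply: eq_lift => a b; apply: eq_lift => ? ?; rewrite FE.
Qed.

Lemma counit_l h (f : H -> W) : lin f -> \sw_(a, b <- D h) (eps a *: f b) = f h.
Proof.
move=> lf; rewrite -{2}(counit_comull HH h) lin_of_lift //.
by apply: eq_lift => a b; rewrite linZ.
Qed.
Lemma counit_r h (f : H -> W) : lin f -> \sw_(a, b <- D h) (eps b *: f a) = f h.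
Proof.
move=> lf; rewrite -{2}(counit_comulr HH h) lin_of_lift //.
by apply: eq_lift => a b; rewrite linZ.
Qed.
Lemma antipode_l h (f : H -> W) : lin f ->
  \sw_(a, b <- D h) f (S a * b) = eps h *: f 1.
Proof. by move=> lf; rewrite -linZ // -(antipodel HH) lin_of_lift. Qed.
Lemma antipode_r h (f : H -> W) : lin f ->
  \sw_(a, b <- D h) f (a * S b) = eps h *: f 1.
Proof. by move=> lf; rewrite -linZ // -(antipoder HH) lin_of_lift. Qed.
Lemma comulM_sw g h (f : H -> H -> W) : bilin f ->
  lift f (D (g * h)) = \sw_(g1, g2 <- D g) \sw_(h1, h2 <- D h) f (g1 * h1) (g2 * h2).
Proof.
move=> bf; rewrite comulM lift_lift; apply: eq_lift => a b; rewrite lift_lift.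
by apply: eq_lift => c d; rewrite lift_tensor.
Qed.
Lemma comul1_sw (f : H -> H -> W) : bilin f -> lift f (D 1) = f 1 1.
Proof. by move=> bf; rewrite comul1 lift_tensor. Qed.
End HopfBasics.

(** * The antipode and its bijectivity *)

Section Antipode.
Variables (k : fieldType) (H : falgType k) (HH : hopf_structure H).
Local Notation D := (comul HH).
Local Notation eps := (counit HH).
Local Notation S := (antipode HH).

Section Cancel.
Variable W : lmodType k.
Implicit Type f : H -> H -> W.

Lemma antipode_l_head h f : bilin f ->
  \sw_(a, b <- D h) \sw_(c, d <- D b) f (S a * c) d = f 1 h.
Proof.
move=> bf; rewrite -(@comulA_sw _ _ HH W h (fun a c d => f (S a * c) d)); last by solve_lin.
under eq_lift => a b do lin_rewrite (@antipode_l _ _ HH _ a (fun x => f x b)).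
by rewrite (@counit_l _ _ HH _ h (f 1)) //; lin.
Qed.
Lemma antipode_r_head h f : bilin f ->
  \sw_(a, b <- D h) \sw_(c, d <- D b) f (a * S c) d = f 1 h.
Proof.
move=> bf; rewrite -(@comulA_sw _ _ HH W h (fun a c d => f (a * S c) d)); last by solve_lin.
under eq_lift => a b do lin_rewrite (@antipode_r _ _ HH _ a (fun x => f x b)).
by rewrite (@counit_l _ _ HH _ h (f 1)) //; lin.
Qed.
Lemma antipode_l_tail h f : bilin f ->
  \sw_(a, b <- D h) \sw_(c, d <- D b) f a (S c * d) = f h 1.
Proof.
move=> bf; under eq_lift => a b do (lin_rewrite antipode_l).
by rewrite (@counit_r _ _ HH _ h (f^~ 1)) //; lin.
Qed.
Lemma antipode_r_tail h f : bilin f ->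
  \sw_(a, b <- D h) \sw_(c, d <- D b) f a (c * S d) = f h 1.
Proof.
move=> bf; under eq_lift => a b do (lin_rewrite antipode_r).
by rewrite (@counit_r _ _ HH _ h (f^~ 1)) //; lin.
Qed.
End Cancel.

Lemma antipode1 : S 1 = 1.
Proof.
have := antipodel HH 1; rewrite comul1 lift_tensor; last by lin.
by rewrite mulr1 counit1 scale1r.
Qed.

Lemma counit_antipode h : eps (S h) = eps h.
Proof.
have := congr1 eps (antipodel HH h); rewrite linearZ /= counit1.
rewrite lin_of_lift; last by lin.
under eq_lift => a b do rewrite counitM.
rewrite [_ *: 1]mulr1 => <-.
rewrite -{1}(counit_comulr HH h) lin_of_lift; last by lin.
rewrite lin_of_lift; last by lin.
by apply: eq_lift => a b; rewrite !linearZ mulrC.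
Qed.

(** In S(x_1 y_1) (x_2 y_2) (S(y_3) S(x_3)) either the first two factors cancel or the last two do:
    both sides are the convolution inverse of the product. *)
Lemma antipodeM (x y : H) : S (x * y) = S y * S x.
Proof.
pose F := \sw_(a, b <- D x) \sw_(c, d <- D b) \sw_(a', b' <- D y)
  \sw_(c', d' <- D b') (S (a * a') * (c * c') * (S d' * S d)).
transitivity F; rewrite /F.
  symmetry; transitivity (\sw_(a, b <- D x) \sw_(c, d <- D b) (S (a * y) * (c * S d))).
    apply: eq_lift => a b; apply: eq_lift => c d.
    under eq_lift => a' b' do under eq_lift => c' d' do
      (rewrite (_ : _ * _ * _ = S (a * a') * c * (c' * S d') * S d); last by rewrite !mulrA).
    by sw_rewrite (@antipode_r_tail _ y (fun a' t => S (a * a') * c * t * S d)); rewrite mulr1 mulrA.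
  by sw_rewrite (@antipode_r_tail _ x (fun a t => S (a * y) * t)); rewrite mulr1.
transitivity (\sw_(a, b <- D x) \sw_(c, d <- D y) \sw_(a1, a2 <- D a) \sw_(c1, c2 <- D c)
   (S (a1 * c1) * (a2 * c2) * (S d * S b))).
  rewrite -(@comulA_sw _ _ HH _ x (fun a c d => \sw_(a', b' <- D y)
     \sw_(c', d' <- D b') (S (a * a') * (c * c') * (S d' * S d)))); last by solve_lin.
  apply: eq_lift => a b; under eq_lift => a1 a2 do
    sw_rewrite <- (@comulA_sw _ _ HH _ y (fun a' c' d' => (S (a1 * a') * (a2 * c') * (S d' * S b)))).
  by rewrite lift_exch; apply: eq_lift => c d; rewrite lift_exch.
under eq_lift => a b do under eq_lift => c d do
  (sw_rewrite <- (@comulM_sw _ _ HH _ a c (fun u v => S u * v * (S d * S b)));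
   sw_rewrite (@antipode_l _ _ HH _ (a * c) (fun u => u * (S d * S b))); rewrite counitM mul1r -scalerA).
under eq_lift => a b do under eq_lift => c d do rewrite scalerA mulrC -scalerA.
under eq_lift => a b do sw_rewrite (@counit_l _ _ HH _ y (fun d => eps a *: (S d * S b))).
by sw_rewrite (@counit_l _ _ HH _ x (fun b => S y * S b)).
Qed.

(** The same argument in the convolution algebra of maps from H to H (x) H: in
    Delta(S h_1) Delta(h_2) (S h_4 (x) S h_3) either the first two factors cancel or the last two do. *)
Lemma comul_antipode (W : lmodType k) h (f : H -> H -> W) : bilin f ->
  lift f (D (S h)) = \sw_(a, b <- D h) f (S b) (S a).
Proof.
move=> bf.
pose F := \sw_(a, r <- D h) \sw_(b, s <- D r) \sw_(c, d <- D s)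
  \sw_(u, v <- D (S a)) \sw_(p, q <- D b) f (u * p * S d) (v * q * S c).
transitivity F; rewrite /F; last first.
  pose g x s' := \sw_(c, d <- D s') \sw_(u, v <- D x) f (u * S d) (v * S c).
  transitivity (\sw_(a, r <- D h) \sw_(b, s <- D r) g (S a * b) s).
    apply: eq_lift => a r; apply: eq_lift => b s; apply: eq_lift => c d.
    by rewrite comulM_sw //; lin.
  rewrite antipode_l_head; last by rewrite /g; lin.
  apply: eq_lift => c d; rewrite comul1_sw; last by lin.
  by rewrite !mul1r.
symmetry.
transitivity (\sw_(a, r <- D h) \sw_(u, v <- D (S a)) (eps r *: f u v)).
  apply: eq_lift => a r.
  under eq_lift => b s do rewrite lift_exch.
  rewrite lift_exch; apply: eq_lift => u v.
  under eq_lift => b s do rewrite lift_exch.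
  sw_rewrite (@comulA_sw _ _ HH _ r (fun p q s => \sw_(c, d <- D s) f (u * p * S d) (v * q * S c))).
  transitivity (\sw_(p, s <- D r) (eps (1 : H) *: f (u * (p * S s)) v)).
    apply: eq_lift => p s.
    under eq_lift => q t do under eq_lift => c d do
      rewrite -(mulrA u) -(mulrA v).
    by sw_rewrite (@antipode_r_head _ s (fun x d => f (u * (p * S d)) (v * x)));
       rewrite mulr1 counit1 scale1r.
  under eq_lift => p s do rewrite counit1 scale1r.
  by sw_rewrite (@antipode_r _ _ HH _ r (fun x => f (u * x) v)); rewrite mulr1.
under eq_lift => a r do rewrite -scale_lift.
by sw_rewrite (@counit_r _ _ HH _ h (fun a => lift f (D (S a)))).
Qed.

Definition antipode_iter n x := iter n S x.
(** Powers of S are multiplicative up to the order of the factors; a scalar commutes with everything, so the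
    parity of n does not matter here. *)
Lemma antipode_iter_scalar n y (c : k) x : antipode_iter n y = c *: 1 ->
  antipode_iter n (x * y) = c *: antipode_iter n x /\ antipode_iter n (y * x) = c *: antipode_iter n x.
Proof.
elim: n x y => [|n IH] x y /=; first by move=> ->; rewrite -scalerAl mul1r -scalerAr mulr1.
rewrite /antipode_iter -!iterS !iterSr => e.
by have [e1 e2] := IH (S x) (S y) e; rewrite !antipodeM; split.
Qed.

Lemma antipode_iter1 n : antipode_iter n 1 = 1.
Proof. by elim: n => //= n ->; rewrite antipode1. Qed.
Lemma lin_antipode_iter n : lin (antipode_iter n).
Proof. elim: n => [|n IH]; [exact: lin_id|exact: (@lin_lfun _ _ _ _ S (antipode_iter n))]. Qed.

Lemma antipode_iterM n x y : antipode_iter n.*2 (x * y) = antipode_iter n.*2 x * antipode_iter n.*2 y.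
Proof. by elim: n => //= n ->; rewrite !antipodeM. Qed.

Lemma comul_antipode_iter (W : lmodType k) n x (f : H -> H -> W) : bilin f ->
  lift f (D (antipode_iter n.*2 x)) = \sw_(a, b <- D x) f (antipode_iter n.*2 a) (antipode_iter n.*2 b).
Proof.
elim: n f => // n IH f bf; rewrite doubleS /= !comul_antipode //; last by lin.
by rewrite (IH (fun a b => f (S (S a)) (S (S b)))) //; lin.
Qed.

(** Fitting: the ranks of the powers of s stabilize, so some power f = s^{n+1} has the same image and the
    same kernel as f^2, and then f factors through f^2 on both sides. *)
Lemma fitting_group_inverse (V : vectType k) (s : 'End(V)) : exists n,
  exists u w : 'End(V), (forall x, iter n.+1 s x = iter n.+1 s (iter n.+1 s (u x))) /\
    (forall x, iter n.+1 s x = w (iter n.+1 s (iter n.+1 s x))).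
Proof.
pose p n := linfun (iter n s).
have pE n : p n =1 iter n s.
  apply: linfunE; elim: n => [|n IH]; [exact: lin_id|exact: (@lin_lfun _ _ _ _ s (iter n s))].
pose d n := \dim (limg (p n.+1)).
(* d n is the rank of s^{n+1}, and d (n + n.+1) is that of its square. *)
have [n dn] : exists n, d n = d (n + n.+1)%N.
  suff: forall m n, (d n <= m)%N -> exists n, d n = d (n + n.+1)%N by move/(_ (d 0) 0 (leqnn _)).
  elim=> [|m IH] n dn.
    exists n; apply/eqP; rewrite eqn_leq {1}/d.
    have le : (d (n + n.+1) <= d n)%N.
      rewrite /d; apply: dimvS; apply/subvP=> _ /memv_imgP[x _ ->].
      by rewrite pE -addSn iterD -!pE memv_img // memvf.
    by rewrite le andbT (leq_trans dn).
  have le : (d (n + n.+1) <= d n)%N.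
    rewrite /d; apply: dimvS; apply/subvP=> _ /memv_imgP[x _ ->].
    by rewrite pE -addSn iterD -!pE memv_img // memvf.
  move: le; rewrite leq_eqVlt => /orP[/eqP e|lt]; first by exists n.
  by apply: (IH (n + n.+1)%N); rewrite -ltnS (leq_trans lt).
pose f := p n.+1; pose ff := (f \o f)%VF.
have ffE x : ff x = iter n.+1 s (iter n.+1 s x) by rewrite comp_lfunE !pE.
have dff : \dim (limg ff) = \dim (limg f).
  rewrite -[RHS]/(d n) dn /d; congr (\dim (_ @: _)); apply/lfunP=> x.
  by rewrite ffE pE -iterD.
have sub : (limg ff <= limg f)%VS by rewrite limg_comp; apply: limgS; apply: subvf.
have eim : limg ff = limg f by apply/eqP; rewrite eqEdim sub dff leqnn.
have eker : lker ff = lker f.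
  apply/esym/eqP; rewrite eqEdim; apply/andP; split.
    by apply/subvP=> x; rewrite !memv_ker comp_lfunE => /eqP->; rewrite linear0.
  have := limg_ker_dim ff {:V}; have := limg_ker_dim f {:V}.
  by rewrite !capfv dff => <- /eqP; rewrite eqn_add2r => /eqP->.
exists n, (ff^-1 \o f)%VF, (f \o ff^-1)%VF; split=> x; rewrite -!ffE.
  by rewrite (comp_lfunE ff^-1%VF f) limg_lfunVK ?eim ?memv_img ?memvf // pE.
have e : ff (ff^-1%VF (ff x)) = ff x by rewrite limg_lfunVK // memv_img ?memvf.
rewrite (comp_lfunE f ff^-1%VF) -pE; apply/eqP; rewrite -/f -subr_eq0 -linearB -memv_ker.
by rewrite -eker memv_ker linearB /= e subrr.
Qed.

(** Let f = S^{2N} be a power of S^2 as in Fitting's lemma; f is a bialgebra map.  The projection p = w f on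
    the image of f along its kernel is a coalgebra map, and S o p is its convolution inverse.  Put
    P(h) = h_1 S(p h_2), so that h = P(h_1) p(h_2), and f(P h) = eps(h) since f p = f.  Now
    Delta(P h) = h_1 S(p h_3) (x) P(h_2), hence eps(h) = P(h)_1 S(P(h)_2) = h_1 S(p h_3) S(P(h_2)).
    If S^{j+1} P = eps, applying S^j to this identity turns S(P(h_2)) into eps(h_2) and gives S^j P = eps.
    Starting from S^{2N} P = f P = eps, one descends to P = eps, that is p = id: f is injective, and so is S. *)
Lemma antipode_inj : injective S.
Proof.
have [n [u [w [fu fw]]]] := fitting_group_inverse (S \o S)%VF.
pose f := antipode_iter n.+1.*2.
have fE x : iter n.+1 (S \o S)%VF x = f x.
  rewrite /f; elim: n.+1 => //= m ->; by rewrite comp_lfunE.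
have {}fu x : f x = f (f (u x)) by rewrite -!fE.
have {}fw x : f x = w (f (f x)) by rewrite -!fE.
have lf : lin f by apply: lin_antipode_iter.
have fM x y : f (x * y) = f x * f y by apply: antipode_iterM.
have fD (W : lmodType k) := @comul_antipode_iter W n.+1; rewrite -/f in fD.
pose p x := w (f x).
have lp : lin p by rewrite /p; lin.
have pu x : p x = f (u x) by rewrite /p {1}fu -fw.
have pf x : p (f x) = f x by rewrite /p -fw.
have fp x : f (p x) = f x by rewrite pu -fu.
have pD (W : lmodType k) x (g : H -> H -> W) : bilin g ->
    lift g (D (p x)) = \sw_(a, b <- D x) g (p a) (p b).
  move=> bg; transitivity (\sw_(a, b <- D (p x)) g (p a) (p b)).
    rewrite pu fD // fD; last by lin.
    by apply: eq_lift => a b; rewrite !pf.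
  pose g' a b := g (w a) (w b); have bg' : bilin g' by rewrite /g'; lin.
  by transitivity (lift g' (D (f (p x)))); [rewrite fD|rewrite fp fD].
pose P x := \sw_(a, b <- D x) (a * S (p b)).
have lP : lin P by rewrite /P; lin.
have ef z : eps (f z) = eps z.
  by rewrite /f /antipode_iter; elim: n.+1.*2 => //= m IH; rewrite counit_antipode.
have ep z : eps (p z) = eps z by rewrite -ef fp ef.
have Pp x : \sw_(a, b <- D x) (P a * p b) = x.
  rewrite /P; under eq_lift => a b do (rewrite (lin_of_lift (F := fun z => z * p b)); last by lin).
  rewrite (@comulA_sw _ _ HH _ x (fun a c b => a * S (p c) * p b)); last by solve_lin.
  under eq_lift => a b do under eq_lift => c d do rewrite -mulrA.
  under eq_lift => a b do (rewrite -(pD _ b (fun c d => a * (S c * d))); last by lin).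
  under eq_lift => a b do sw_rewrite (@antipode_l _ _ HH _ (p b) (fun z => a * z)).
  under eq_lift => a b do rewrite ep mulr1.
  by sw_rewrite (@counit_r _ _ HH _ x id).
have DP (W : lmodType k) x (g : H -> H -> W) : bilin g -> lift g (D (P x)) =
    \sw_(a, b <- D x) \sw_(c, d <- D b) g (a * S (p d)) (P c).
  move=> bg; rewrite /P (lin_of_lift (F := fun z => lift g (D z))); last by lin.
  under eq_lift => a b do (rewrite comulM_sw //; under eq_lift => c d do
    (rewrite comul_antipode; last by lin); under eq_lift => c d do (rewrite pD; last by lin)).
  rewrite (@comulA_sw _ _ HH _ x (fun c d b => \sw_(a', b' <- D b)
     g (c * S (p b')) (d * S (p a')))); last by solve_lin.
  apply: eq_lift => a b; rewrite -comulA_sw; last by solve_lin.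
  by apply: eq_lift => c d; rewrite lin_of_lift //; lin.
have fP x : f (P x) = eps x *: 1.
  rewrite /P lin_of_lift //; under eq_lift => a b do rewrite fM.
  have fS z : f (S (p z)) = S (f z) by rewrite -(fp z) /f /antipode_iter -iterSr.
  under eq_lift => a b do rewrite fS.
  rewrite -(fD _ x (fun a b => a * S b)); last by lin.
  by rewrite antipoder ef.
(* The descent from S^{j+1} P = eps to S^j P = eps. *)
have desc j x : (forall x, antipode_iter j.+1 (P x) = eps x *: 1) -> antipode_iter j (P x) = eps x *: 1.
  move=> hj; have lj : lin (antipode_iter j) by apply: lin_antipode_iter.
  have := DP _ x (fun a b => antipode_iter j (a * S b)).
  rewrite antipode_r //.
  have -> : eps (P x) = eps x by rewrite -ef fP linearZ /= counit1 [_ *: 1]mulr1.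
  rewrite antipode_iter1 => ->; last by lin.
  transitivity (\sw_(a, b <- D x) \sw_(c, d <- D b) (eps c *: antipode_iter j (a * S (p d)))).
    rewrite /P lin_of_lift //; apply: eq_lift => a b.
    by sw_rewrite (@counit_l _ _ HH _ b (fun d => antipode_iter j (a * S (p d)))).
  apply: eq_lift => a b; apply: eq_lift => c d.
  by case: (@antipode_iter_scalar j (S (P c)) (eps c) (a * S (p d))) => //; rewrite -hj /antipode_iter iterSr.
have {}fP x : P x = eps x *: 1.
  move: fP; rewrite /f; elim: n.+1.*2 => [|j IH] hj; first exact: hj.
  by apply: IH => y; apply: desc.
have px x : p x = x.
  rewrite -{2}(Pp x); under eq_lift => a b do rewrite fP -scalerAl mul1r.
  by sw_rewrite (@counit_l _ _ HH _ x p).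
move=> x y exy; rewrite -(px x) -(px y) /p /f /antipode_iter doubleS !iterSr.
by rewrite exy.
Qed.

Local Notation S' := (S^-1)%VF.

Lemma antipode_ker : lker S == 0%VS.
Proof. by apply/lker0P; apply: antipode_inj. Qed.
Lemma antipodeK : cancel S S'. Proof. exact: lker0_lfunK antipode_ker. Qed.
Lemma antipodeVK : cancel S' S. Proof. exact: lker0_lfunVK antipode_ker. Qed.

Lemma antipodeV1 : S' 1 = 1.
Proof. by rewrite -{1}antipode1 antipodeK. Qed.
Lemma antipodeVM (x y : H) : S' (x * y) = S' y * S' x.
Proof. by apply: antipode_inj; rewrite antipodeM !antipodeVK. Qed.
Lemma counit_antipodeV h : eps (S' h) = eps h.
Proof. by rewrite -counit_antipode antipodeVK. Qed.

Section Inverse.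
Variable W : lmodType k.
Lemma comul_antipodeV h (f : H -> H -> W) : bilin f ->
  lift f (D (S' h)) = \sw_(a, b <- D h) f (S' b) (S' a).
Proof.
move=> bf; rewrite -{2}(antipodeVK h) comul_antipode; last by lin.
by apply: eq_lift => a b; rewrite !antipodeK.
Qed.
(** S^-1 is the antipode of H^cop, hence the exchange of the two factors. *)
Lemma antipodeV_l h (f : H -> W) : lin f ->
  \sw_(a, b <- D h) f (S' b * a) = eps h *: f 1.
Proof.
move=> lf; rewrite -antipodeV1.
sw_rewrite <- (@antipode_l _ _ HH _ h (fun x => f (S' x))).
by apply: eq_lift => a b; rewrite antipodeVM antipodeK.
Qed.
Lemma antipodeV_r h (f : H -> W) : lin f ->
  \sw_(a, b <- D h) f (b * S' a) = eps h *: f 1.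
Proof.
move=> lf; rewrite -antipodeV1.
sw_rewrite <- (@antipode_r _ _ HH _ h (fun x => f (S' x))).
by apply: eq_lift => a b; rewrite antipodeVM antipodeK.
Qed.

Implicit Type f : H -> H -> W.
Lemma antipodeV_l_head h f : bilin f ->
  \sw_(a, b <- D h) \sw_(c, d <- D b) f (S' c * a) d = f 1 h.
Proof.
move=> bf; sw_rewrite <- (@comulA_sw _ _ HH W h (fun a c d => f (S' c * a) d)).
under eq_lift => a b do sw_rewrite (@antipodeV_l a (fun x => f x b)).
by sw_rewrite (@counit_l _ _ HH _ h (f 1)).
Qed.
Lemma antipodeV_l_tail h f : bilin f ->
  \sw_(a, b <- D h) \sw_(c, d <- D b) f a (S' d * c) = f h 1.
Proof.
move=> bf; under eq_lift => a b do sw_rewrite (@antipodeV_l b (f a)).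
by sw_rewrite (@counit_r _ _ HH _ h (f^~ 1)).
Qed.
Lemma antipodeV_r_tail h f : bilin f ->
  \sw_(a, b <- D h) \sw_(c, d <- D b) f a (d * S' c) = f h 1.
Proof.
move=> bf; under eq_lift => a b do sw_rewrite (@antipodeV_r b (f a)).
by sw_rewrite (@counit_r _ _ HH _ h (f^~ 1)).
Qed.
End Inverse.
End Antipode.

(** * Dual bases *)

Section DualBasis.
Variables (k : fieldType) (U : vectType k).
Lemma dbasE (i : 'I_(\dim {:U})) u : dbas i u = coord (vbasis {:U}) i u.
Proof. by rewrite /dbas lfunE. Qed.
Lemma bas_sum (u : U) : \sum_i dbas i u *: bas i = u.
Proof.
rewrite [RHS](coord_vbasis (memvf u)); apply: eq_bigr => i _; by rewrite dbasE.
Qed.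
Lemma dbas_sum (q : 'Hom(U, k^o)) : \sum_i q (bas i) *: dbas i = q.
Proof.
apply/lfunP=> u; rewrite sum_lfunE -{2}(bas_sum u) linear_sum.
by apply: eq_bigr => i _; rewrite scale_lfunE linearZ [RHS]mulrC.
Qed.
(** Functionals on the first factor separate the elements of a tensor product; identities between
    coactions are proved by evaluating them this way. *)
Lemma tens_coords (V : vectType k) (s t : tens U V) :
  (forall q : 'Hom(U, k^o), \sw_(x, v <- s) (q x *: v) = \sw_(x, v <- t) (q x *: v)) ->
  s = t.
Proof.
pose f (r : tens U V) : tens U V :=  \sum_(i < \dim {:U}) (bas i *t \sw_(x, v <- r) (dbas (U := U) i x *: v)).
have e : f =1 id.
  apply: tens_ext; [rewrite /f; lin|exact: lin_id|move=> u v]; rewrite /f.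
  under eq_bigr => i _ do (rewrite lift_tensor; last by lin).
  rewrite -{2}(bas_sum u) (lin_bigsum (f := fun x => x *t v)); last by lin.
  apply: eq_bigr => i _; rewrite (linZ (f := fun x => x *t v)); last by lin.
  by rewrite (linZ (f := fun x => bas i *t x)) //; lin.
by move=> h; rewrite -[s]e -[t]e; apply: eq_bigr => i _; rewrite h.
Qed.
End DualBasis.

(** * Hopf bimodules *)

Section HopfBimod.
Variables (k : fieldType) (H : falgType k) (HH : hopf_structure H).
Local Notation D := (comul HH).
Local Notation eps := (counit HH).
Local Notation S := (antipode HH).
Local Notation S' := ((antipode HH)^-1)%VF.
Local Notation Hd := 'Hom(H, k^o).

(** The axioms contain no antipode: the antipode and its inverse only enter in the translation between these
    objects and the modules over H # D(H). *)
Record hopf_bimod (M : vectType k) := HopfBimod {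
  lmul : H -> M -> M;
  rmul : M -> H -> M;
  coact : 'Hom(M, tens H M);
  lmul_bilin : bilin lmul;
  rmul_bilin : bilin rmul;
  lmul1 : forall m, lmul 1 m = m;
  lmulM : forall a b m, lmul (a * b) m = lmul a (lmul b m);
  rmul1 : forall m, rmul m 1 = m;
  rmulM : forall a b m, rmul m (a * b) = rmul (rmul m a) b;
  lrmulA : forall a b m, lmul a (rmul m b) = rmul (lmul a m) b;
  coact_counit : forall m, \sw_(x, n <- coact m) (eps x *: n) = m;
  coactA : forall m, \sw_(x, n <- coact m) \sw_(y, n' <- coact n) (x *t (y *t n'))
     = \sw_(x, n <- coact m) \sw_(x1, x2 <- D x) (x1 *t (x2 *t n));
  coact_lmul : forall a m, coact (lmul a m) =
     \sw_(a1, a2 <- D a) \sw_(x, n <- coact m) ((a1 * x) *t lmul a2 n);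
  coact_rmul : forall a m, coact (rmul m a) =
     \sw_(a1, a2 <- D a) \sw_(x, n <- coact m) ((x * a1) *t rmul n a2)
}.
Hint Resolve lmul_bilin rmul_bilin : bil.

Section HbimodCPS.
Variables (M : vectType k) (X : hopf_bimod M) (W : lmodType k).
Lemma coact_counit_sw m (f : M -> W) : lin f -> \sw_(x, n <- coact X m) (eps x *: f n) = f m.
Proof.
move=> lf; rewrite -{2}(coact_counit X m) lin_of_lift //.
by apply: eq_lift => a b; rewrite linZ.
Qed.
Lemma coactA_sw m (f : H -> H -> M -> W) : trilin f ->
  \sw_(x, n <- coact X m) \sw_(y, n' <- coact X n) f x y n'
    = \sw_(x, n <- coact X m) \sw_(x1, x2 <- D x) f x1 x2 n.
Proof.
move=> tf; pose F t := \sw_(a, t' <- t) \sw_(b, c <- t') f a b c.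
have lF : lin F by rewrite /F; lin.
have FE u v w : F (u *t (v *t w)) = f u v w by apply: lift_assocP.
have := congr1 F (coactA X m); rewrite !(lin_of_lift _ _ lF).
under eq_lift => a b do rewrite (lin_of_lift _ _ lF).
under [RHS]eq_lift => a b do rewrite (lin_of_lift _ _ lF).
under eq_lift => a b do under eq_lift => a1 a2 do rewrite FE.
by move=> ->; apply: eq_lift => a b; apply: eq_lift => ? ?; rewrite FE.
Qed.
Lemma coact_lmul_sw a m (f : H -> M -> W) : bilin f ->
  lift f (coact X (lmul X a m)) = \sw_(a1, a2 <- D a) \sw_(x, n <- coact X m) f (a1 * x) (lmul X a2 n).
Proof.
move=> bf; rewrite coact_lmul lift_lift; apply: eq_lift => a1 a2.
by rewrite lift_lift; apply: eq_lift => x n; rewrite lift_tensor.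
Qed.
Lemma coact_rmul_sw a m (f : H -> M -> W) : bilin f ->
  lift f (coact X (rmul X m a)) = \sw_(a1, a2 <- D a) \sw_(x, n <- coact X m) f (x * a1) (rmul X n a2).
Proof.
move=> bf; rewrite coact_rmul lift_lift; apply: eq_lift => a1 a2.
by rewrite lift_lift; apply: eq_lift => x n; rewrite lift_tensor.
Qed.
End HbimodCPS.

Definition convol (p q : Hd) : Hd := linfun (fun x => \sw_(a, b <- D x) (p a * q b) : k^o).
Lemma convolE p q x : convol p q x = \sw_(a, b <- D x) (p a * q b : k^o).
Proof. by rewrite /convol linfunE //; lin. Qed.
Lemma convol_bilin : bilin convol.
Proof. by rewrite /convol; lin. Qed.
(** The coproduct of H^* for the convolution product; only its defining property [dual_comulE] is used. *)
Definition dual_comul (p : Hd) : tens Hd Hd :=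
  \sum_i \sum_j p (bas i * bas j) *: (dbas i *t dbas j).
Lemma dual_comulE (p : Hd) (W : lmodType k) x y (w : W) :
  lift (fun p1 p2 : Hd => (p1 x : k) *: ((p2 y : k) *: w)) (dual_comul p) = (p (x * y) : k) *: w.
Proof.
have lf : bilin (fun p1 p2 : Hd => (p1 x : k) *: ((p2 y : k) *: w)) by lin.
have l1 : lin (lift (fun p1 p2 : Hd => (p1 x : k) *: ((p2 y : k) *: w))) by lin.
rewrite /dual_comul lin_bigsum //; under eq_bigr => i _ do (rewrite lin_bigsum //;
  under eq_bigr => j _ do rewrite linZ // lift_tensor //).
rewrite -{2}(bas_sum x) -{2}(bas_sum y) mulr_suml linear_sum scaler_suml.
apply: eq_bigr => i _; rewrite mulr_sumr linear_sum scaler_suml.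
apply: eq_bigr => j _; rewrite !scalerA; congr (_ *: _).
rewrite -scalerAl -scalerAr; rewrite [RHS]linearZ linearZ /=.
by rewrite -[RHS]/(dbas i x * (dbas j y * p (bas i * bas j))) mulrC mulrA.
Qed.

Section Act.
Variables (M : vectType k) (X : hopf_bimod M).
Implicit Types (a b h g : H) (m : M) (p q : Hd).

Definition coact_by q m : M := \sw_(x, n <- coact X m) ((q x : k) *: n).
Definition adj_act h a : H := \sw_(h1, h2 <- D h) (h1 * a * S h2).
(** The adjoint action of H on a bimodule.  For M = H it is [adj_act], the action of H on itself in
    the definition of H # D(H). *)
Definition bim_adj h m : M := \sw_(h1, h2 <- D h) rmul X (lmul X h1 m) (S h2).

Lemma coact_by_bilin : bilin coact_by. Proof. by rewrite /coact_by; lin. Qed.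
Lemma adj_act_bilin : bilin adj_act. Proof. by rewrite /adj_act; lin. Qed.
Lemma bim_adj_bilin : bilin bim_adj. Proof. by rewrite /bim_adj; lin. Qed.

Lemma bim_adj1 m : bim_adj 1 m = m.
Proof. by rewrite /bim_adj comul1_sw ?antipode1 ?lmul1 ?rmul1 //; lin. Qed.
Lemma bim_adjM h g m : bim_adj (h * g) m = bim_adj h (bim_adj g m).
Proof.
rewrite /bim_adj comulM_sw; last by lin.
apply: eq_lift => h1 h2; pull_sw (fun z => rmul X (lmul X h1 z) (S h2)).
by apply: eq_lift => g1 g2; rewrite lmulM antipodeM rmulM lrmulA.
Qed.
Lemma bim_adj_lmul h a m : bim_adj h (lmul X a m) = \sw_(h1, h2 <- D h) lmul X (adj_act h1 a) (bim_adj h2 m).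
Proof.
rewrite /bim_adj /adj_act; symmetry.
under eq_lift => h1 h2 do pull_sw (fun z => lmul X z (\sw_(b, b0 <- D h2) rmul X (lmul X b m) (S b0))).
under eq_lift => h1 h2 do under eq_lift => a1 a2 do pull_sw (lmul X (a1 * a * S a2)).
rewrite (@comulA_sw _ _ HH _ h (fun a1 a2 h2 => \sw_(b, b0 <- D h2) lmul X (a1 * a * S a2) (rmul X (lmul X b m) (S b0)))); last by solve_lin.
apply: eq_lift => h1 h'.
under eq_lift => a1 a2 do under eq_lift => b1 b2 do rewrite lrmulA -lmulM -mulrA.
by sw_rewrite (@antipode_l_head _ _ HH _ h' (fun x b => rmul X (lmul X (h1 * a * x) m) (S b))); rewrite mulr1 lmulM.
Qed.

Lemma coact_byM p q m : coact_by p (coact_by q m) = coact_by (convol q p) m.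
Proof.
rewrite /coact_by; pull_sw (fun z => \sw_(x, n <- coact X z) (p x *: n)).
under eq_lift => x n do (rewrite linearZ /=;
   (rewrite (linZ (f := fun z => \sw_(y, n' <- z) (p y *: n'))); last by lin); rewrite scale_lift).
rewrite (@coactA_sw _ X _ m (fun x y n => q x *: (p y *: n))); last by solve_lin.
apply: eq_lift => x n; rewrite convolE.
pull_sw (fun z : k^o => (z : k) *: n).
by apply: eq_lift => a b; rewrite scalerA.
Qed.

Lemma coact_by1 m : coact_by eps m = m. Proof. exact: coact_counit. Qed.
Lemma coact_by_lmul q a m : coact_by q (lmul X a m) =
  \sw_(a1, a2 <- D a) \sw_(x, n <- coact X m) ((q (a1 * x) : k) *: lmul X a2 n).
Proof. by rewrite /coact_by coact_lmul_sw //; lin. Qed.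
Lemma coact_by_rmul q a m : coact_by q (rmul X m a) =
  \sw_(a1, a2 <- D a) \sw_(x, n <- coact X m) ((q (x * a1) : k) *: rmul X n a2).
Proof. by rewrite /coact_by coact_rmul_sw //; lin. Qed.

(** The element p >< 1 acts on H by the coaction followed by p o S^-1, and the same formula is used on every
    Hopf bimodule. *)
Definition dual_act (p : Hd) m : M := coact_by (p \o S')%VF m.
Lemma dual_actE p m : dual_act p m = \sw_(x, n <- coact X m) ((p (S' x) : k) *: n).
Proof. by apply: eq_lift => x n; rewrite comp_lfunE. Qed.
Lemma dual_act_bilin : bilin dual_act.
Proof. have h := coact_by_bilin; rewrite /dual_act; lin. Qed.
(** Evaluating the coaction is an anti-action of H^*, and S^-1 reverses the coproduct once more, which makes
    it an action. *)
Lemma dual_actM p q m : dual_act p (dual_act q m) = dual_act (convol p q) m.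
Proof.
rewrite /dual_act coact_byM; congr (coact_by _ m); apply/lfunP => x.
rewrite comp_lfunE !convolE comul_antipodeV; last by lin.
by apply: eq_lift => a b; rewrite !comp_lfunE mulrC.
Qed.
Lemma dual_act1 m : dual_act eps m = m.
Proof. by rewrite -[RHS]coact_by1; congr (coact_by _ m); apply/lfunP => x; rewrite comp_lfunE counit_antipodeV. Qed.

Lemma dual_act_lmul p a m : dual_act p (lmul X a m) =
  lift (fun p1 p2 : Hd => lmul X (hit_r HH a (p2 \o S')%VF) (dual_act p1 m)) (dual_comul p).
Proof.
rewrite /dual_act coact_by_lmul /hit_r /coact_by.
transitivity (lift (fun p1 p2 : Hd => \sw_(a1, a2 <- D a) \sw_(x, n <- coact X m)
   ((p1 (S' x) : k) *: ((p2 (S' a1) : k) *: lmul X a2 n))) (dual_comul p)).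
symmetry; rewrite [LHS]lift_exch; apply: eq_lift => a1 a2; rewrite [LHS]lift_exch.
  by apply: eq_lift => x n; rewrite dual_comulE comp_lfunE antipodeVM.
apply: eq_lift => p1 p2.
pull_sw (fun z => lmul X z (\sw_(x, n <- coact X m) ((p1 \o S')%VF x *: n))).
apply: eq_lift => a1 a2.
pull_sw (lmul X ((p2 \o S')%VF a1 *: a2)).
apply: eq_lift => x n; rewrite !comp_lfunE.
by case: (lmul_bilin X) => fr fl; rewrite (linZ _ _ (fr _)) (linZ _ _ (fl _)).
Qed.

Lemma coreg2E h q g l : coreg2 h q g l = q (g * l * h).
Proof. by rewrite /coreg2 linfunE //; lin. Qed.

(** The commutation relation of the Drinfeld double.  The adjoint action by the middle part of h surrounds the
    H-component of the coaction by two factors; after S^-1 they stand next to the outer parts h_1 and S^-1(h_3) by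
    which q is translated, and cancel with them. *)
Lemma bim_adj_dual_act h q m : bim_adj h (dual_act q m) = \sw_(h1, h' <- D h) \sw_(h2, h3 <- D h')
  dual_act (coreg2 h1 q (S' h3)) (bim_adj h2 m).
Proof.
have RE h1 h2 h3 : dual_act (coreg2 h1 q (S' h3)) (bim_adj h2 m) =
  \sw_(a, b <- D h2) \sw_(a1, a2 <- D a) \sw_(b1, b2 <- D b) \sw_(x, n <- coact X m)
  ((q (S' h3 * (b2 * S' x * S' a1) * h1) : k) *: rmul X (lmul X a2 n) (S b1)).
  rewrite dual_actE /bim_adj; pull_sw (fun z => \sw_(x, n <- coact X z) (coreg2 h1 q (S' h3) (S' x) *: n)).
  apply: eq_lift => a b; rewrite coact_rmul_sw; last by lin.
  rewrite comul_antipode; last by lin.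
  rewrite [RHS]lift_exch; apply: eq_lift => b1 b2.
  rewrite coact_lmul_sw; last by lin.
  apply: eq_lift => a1 a2; apply: eq_lift => x n.
  by rewrite coreg2E !antipodeVM antipodeK !mulrA.
under eq_lift => h1 h' do under eq_lift => h2 h3 do rewrite RE.
transitivity (\sw_(h1, h2 <- D h) \sw_(x, n <- coact X m)
   ((q (S' x) : k) *: rmul X (lmul X h1 n) (S h2))).
  apply: eq_lift => h1 h2; pull_sw (fun z => rmul X (lmul X h1 z) (S h2)).
  by apply: eq_lift => x n; pull_scale (fun z => rmul X (lmul X h1 z) (S h2)); rewrite comp_lfunE.
pose G z t := \sw_(a2, r <- D t) \sw_(x, n <- coact X m)
   ((q (S' x * z) : k) *: rmul X (lmul X a2 n) (S r)).
transitivity (\sw_(h1, h' <- D h) \sw_(a1, t <- D h') G (S' a1 * h1) t).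
  rewrite antipodeV_l_head /G; last by lin.
  by apply: eq_lift => a2 r; apply: eq_lift => x n; rewrite mulr1.
apply: eq_lift => h1 h'; symmetry.
rewrite (@comulA_sw _ _ HH _ h' (fun a b h3 => \sw_(a1, a2 <- D a) \sw_(b1, b2 <- D b)
  \sw_(x, n <- coact X m) (q (S' h3 * (b2 * S' x * S' a1) * h1) *: rmul X (lmul X a2 n) (S b1)))); last by solve_lin.
rewrite /G -(@comulA_sw _ _ HH _ h' (fun a1 a2 r => \sw_(x, n <- coact X m)
   (q (S' x * (S' a1 * h1)) *: rmul X (lmul X a2 n) (S r)))); last by solve_lin.
apply: eq_lift => a r.
rewrite [LHS]lift_exch; apply: eq_lift => a1 a2.
rewrite (@comulA_sw _ _ HH _ r (fun b1 b2 h3 => \sw_(x, n <- coact X m)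
  (q (S' h3 * (b2 * S' x * S' a1) * h1) *: rmul X (lmul X a2 n) (S b1)))); last by solve_lin.
under eq_lift => b1 s do under eq_lift => b2 h3 do under eq_lift => x n do rewrite !mulrA.
sw_rewrite (@antipodeV_l_tail _ _ HH _ r (fun b1 z => \sw_(x, n <- coact X m)
  (q (z * S' x * S' a1 * h1) *: rmul X (lmul X a2 n) (S b1)))).
by apply: eq_lift => x n; rewrite mul1r mulrA.
Qed.
End Act.
End HopfBimod.

#[export] Hint Resolve lmul_bilin rmul_bilin coact_by_bilin bim_adj_bilin dual_act_bilin convol_bilin adj_act_bilin : bil.

(** * Hopf bimodules are modules over H # D(H) *)

Section Smash.
Variables (k : fieldType) (H : falgType k) (HH : hopf_structure H).
Local Notation D := (comul HH).
Local Notation eps := (counit HH).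
Local Notation S := (antipode HH).
Local Notation S' := ((antipode HH)^-1)%VF.
Local Notation Hd := 'Hom(H, k^o).
Local Notation L := (smash_double HH).
Local Notation LT := (tens H (tens Hd H)).
Local Notation convol := (convol HH).
Local Notation adj_act := (adj_act HH).

Lemma hit_r_bilin : bilin (hit_r HH).
Proof. by rewrite /hit_r; lin. Qed.
Lemma coreg2_lin1 (q : Hd) g : lin (fun h => coreg2 h q g).
Proof. by rewrite /coreg2; lin. Qed.
Lemma coreg2_lin2 (h g : H) : lin (fun q : Hd => coreg2 h q g).
Proof. by rewrite /coreg2; lin. Qed.
Lemma coreg2_lin3 (h : H) (q : Hd) : lin (coreg2 h q).
Proof. by rewrite /coreg2; lin. Qed.
Lemma lin_dual_comul : lin (@dual_comul k H).
Proof. by rewrite /dual_comul; lin. Qed.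

(** This function and the next ones are the operations of D(H) and H # D(H) on the underlying tensor products,
    with the products of H and H^* written directly; they are convertible to the original ones. *)
Definition dbl_act (x : tens Hd H) (l : H) : H :=
  \sw_(p, h <- x) hit_r HH (adj_act h l) (p \o S')%VF.
Lemma dbl_act_bilin : bilin dbl_act.
Proof. have h := hit_r_bilin; rewrite /dbl_act; lin. Qed.
Lemma dbl_actE p h l : dbl_act (p *t h) l = hit_r HH (adj_act h l) (p \o S')%VF.
Proof. by rewrite /dbl_act lift_tensor //; have h0 := hit_r_bilin; lin. Qed.

Definition dbl_mul (x y : tens Hd H) : tens Hd H :=
  \sw_(p, h <- x) \sw_(q, g <- y)
    \sw_(h1, h' <- D h) \sw_(h2, h3 <- D h')
      (convol p (coreg2 h1 q (S' h3)) *t (h2 * g)).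
Lemma dbl_mul_bilin : bilin dbl_mul.
Proof.
have h1 := coreg2_lin1; have h2 := coreg2_lin2; have h3 := coreg2_lin3.
have h4 := convol_bilin HH; rewrite /dbl_mul; lin.
Qed.
Lemma dbl_mulE p h q g : dbl_mul (p *t h) (q *t g) =
  \sw_(h1, h' <- D h) \sw_(h2, h3 <- D h') (convol p (coreg2 h1 q (S' h3)) *t (h2 * g)).
Proof.
have h1 := coreg2_lin1; have h2 := coreg2_lin2; have h3 := coreg2_lin3.
have h4 := convol_bilin HH; rewrite /dbl_mul lift_tensor; last by lin.
by rewrite lift_tensor //; lin.
Qed.

Definition dbl_comul (x : tens Hd H) : tens (tens Hd H) (tens Hd H) :=
  \sw_(p, h <- x) lift (fun p1 p2 : Hd => \sw_(h1, h2 <- D h) ((p2 *t h1) *t (p1 *t h2))) (dual_comul p).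
Lemma lin_dbl_comul : lin dbl_comul.
Proof. by have h := lin_dual_comul; rewrite /dbl_comul; lin. Qed.
Lemma dbl_comulE p h : dbl_comul (p *t h) =
  lift (fun p1 p2 : Hd => \sw_(h1, h2 <- D h) ((p2 *t h1) *t (p1 *t h2))) (dual_comul p).
Proof. by have h0 := lin_dual_comul; rewrite /dbl_comul lift_tensor //; lin. Qed.

Definition smash_mul (s t : LT) : LT :=
  \sw_(a, x <- s) \sw_(b, y <- t) \sw_(x1, x2 <- dbl_comul x) ((a * dbl_act x1 b) *t dbl_mul x2 y).
Lemma smash_amul (s t : L) : amul s t = smash_mul s t. Proof. by []. Qed.
Lemma smash_mul_bilin : bilin smash_mul.
Proof.
have h1 := dbl_act_bilin; have h2 := dbl_mul_bilin; have h3 := lin_dbl_comul.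
by rewrite /smash_mul; lin.
Qed.
Lemma smash_mulE a p h b y : smash_mul (a *t (p *t h)) (b *t y) =
  lift (fun p1 p2 : Hd => \sw_(h1, h2 <- D h)
     ((a * hit_r HH (adj_act h1 b) (p2 \o S')%VF) *t dbl_mul (p1 *t h2) y)) (dual_comul p).
Proof.
have h1 := dbl_act_bilin; have h2 := dbl_mul_bilin; have h3 := lin_dbl_comul.
rewrite /smash_mul lift_tensor; last by lin.
rewrite lift_tensor; last by lin.
rewrite dbl_comulE lift_lift; apply: eq_lift => p1 p2.
rewrite lift_lift; apply: eq_lift => g1 g2.
by rewrite lift_tensor ?dbl_actE //; lin.
Qed.

(** The three operations are taken without their axioms, so that H (x) V carries an action of H # D(H)
    for any operation of H on V, and V |-> H (x) V is defined on all objects. *)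
Definition smash_act_of (M : vectType k) (l : H -> M -> M) (r : M -> H -> M)
    (c : 'Hom(M, tens H M)) (x : LT) (m : M) : M :=
  \sw_(a, u <- x) lift (fun (p : Hd) (h : H) => l a (\sw_(y, n <- c (\sw_(h1, h2 <- D h) r (l h1 m) (S h2)))
     (((p \o S')%VF y : k) *: n))) u.

Section Hact.
Variables (M : vectType k) (X : hopf_bimod HH M).

Definition smash_act : LT -> M -> M := smash_act_of (lmul X) (rmul X) (coact X).
Lemma smash_act_def x m : smash_act x m =
  \sw_(a, u <- x) \sw_(p, h <- u) lmul X a (dual_act X p (bim_adj X h m)).
Proof. by []. Qed.
Lemma smash_act_bilin : bilin smash_act.
Proof.
by split=> [x|m] c u v; rewrite !smash_act_def; move: c u v; [change (lin (fun m => \sw_(a, u <- x) \sw_(p, h <- u) lmul X a (dual_act X p (bim_adj X h m))))|change (lin (fun x => \sw_(a, u <- x) \sw_(p, h <- u) lmul X a (dual_act X p (bim_adj X h m))))]; lin.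
Qed.
Lemma smash_actE a p h m : smash_act (a *t (p *t h)) m = lmul X a (dual_act X p (bim_adj X h m)).
Proof. by rewrite smash_act_def !lift_tensor //; lin. Qed.

(** On pure tensors the product moves h past b (an adjoint action on b), then p past b (through the coproduct of p), then
    h past q.  These are [bim_adj_lmul], [dual_act_lmul] and [bim_adj_dual_act]. *)
Lemma smash_actM x y m : smash_act (smash_mul x y) m = smash_act x (smash_act y m).
Proof.
have b1 := smash_act_bilin; have b2 := smash_mul_bilin.
have b3 := convol_bilin HH.
have h1 := coreg2_lin1; have h2 := coreg2_lin2; have h3 := coreg2_lin3.
have b4 := hit_r_bilin.
have b5 := dbl_mul_bilin.
have b6 := lin_dual_comul.
apply: (@tens_ext _ _ _ _ (fun x => smash_act (smash_mul x y) m) (fun x => smash_act x (smash_act y m))); [by lin|by lin|move=> a u].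
apply: (@tens_ext _ _ _ _ (fun u => smash_act (smash_mul (a *t u) y) m) (fun u => smash_act (a *t u) (smash_act y m))); [by lin|by lin|move=> p h].
apply: (@tens_ext _ _ _ _ (fun y => smash_act (smash_mul (a *t (p *t h)) y) m)
  (fun y => smash_act (a *t (p *t h)) (smash_act y m))); [by lin|by lin|move=> b w].
apply: (@tens_ext _ _ _ _ (fun w => smash_act (smash_mul (a *t (p *t h)) (b *t w)) m)
  (fun w => smash_act (a *t (p *t h)) (smash_act (b *t w) m))); [by lin|by lin|move=> q g].
rewrite !smash_actE bim_adj_lmul.
pull_sw (dual_act X p); pull_sw (lmul X a).
rewrite smash_mulE; pull_sw (fun z => smash_act z m).
transitivity (lift (fun p1 p2 : Hd => \sw_(h1, h2 <- D h)
  lmul X a (lmul X (hit_r HH (adj_act h1 b) (p2 \o S')%VF) (dual_act X p1 (bim_adj X h2 (dual_act X q (bim_adj X g m)))))) (dual_comul p)).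
  apply: eq_lift => p1 p2; pull_sw (fun z => smash_act z m).
  apply: eq_lift => g1 g2; rewrite dbl_mulE bim_adj_dual_act.
  pull_sw (fun z => lmul X a (lmul X (hit_r HH (adj_act g1 b) (p2 \o S')%VF) (dual_act X p1 z))).
  pull_sw (fun z => smash_act ((a * hit_r HH (adj_act g1 b) (p2 \o S')%VF) *t z) m).
  apply: eq_lift => c c'.
  pull_sw (fun z => lmul X a (lmul X (hit_r HH (adj_act g1 b) (p2 \o S')%VF) (dual_act X p1 z))).
  pull_sw (fun z => smash_act ((a * hit_r HH (adj_act g1 b) (p2 \o S')%VF) *t z) m).
  apply: eq_lift => d d'.
  by rewrite smash_actE lmulM dual_actM bim_adjM.
rewrite [LHS]lift_exch; apply: eq_lift => c d.
rewrite dual_act_lmul; pull_sw (lmul X a).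
by apply: eq_lift.
Qed.

Lemma smash_act1 m : smash_act (1 *t (eps *t 1)) m = m.
Proof. by rewrite smash_actE bim_adj1 dual_act1 lmul1. Qed.

End Hact.
End Smash.

#[export] Hint Resolve smash_act_bilin smash_mul_bilin dbl_mul_bilin dbl_act_bilin hit_r_bilin : bil.

(** * Elements of H # D(H) that act by the bimodule operations *)

Section Recover.
Variables (k : fieldType) (H : falgType k) (HH : hopf_structure H).
Local Notation D := (comul HH).
Local Notation eps := (counit HH).
Local Notation S := (antipode HH).
Local Notation S' := ((antipode HH)^-1)%VF.
Local Notation Hd := 'Hom(H, k^o).
Local Notation LT := (tens H (tens Hd H)).

Definition el_left (a : H) : LT := a *t (eps *t 1).
(** The twist by S undoes the S^-1 in the action of H^*: [el_dual q] acts by m |-> q(m_{-1}) m_0. *)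
Definition el_dual (q : Hd) : LT := 1 *t ((q \o S)%VF *t 1).
(** This is (R^2 . a) # R^1 for the canonical R, by which right multiplication is defined. *)
Definition el_right (a : H) : LT := \sum_i (hit_r HH a (dbas i \o S')%VF *t (eps *t bas i)).
Definition el_hopf (h : H) : LT := 1 *t (eps *t h).

Lemma lin_el_left : lin el_left. Proof. by rewrite /el_left; lin. Qed.
Lemma lin_el_dual : lin el_dual. Proof. by rewrite /el_dual; lin. Qed.
Lemma lin_el_hopf : lin el_hopf. Proof. by rewrite /el_hopf; lin. Qed.
Lemma lin_el_right : lin el_right. Proof. by rewrite /el_right; lin. Qed.

Section R.
Variables (M : vectType k) (X : hopf_bimod HH M).
Lemma smash_act_left a m : smash_act X (el_left a) m = lmul X a m.
Proof. by rewrite /el_left smash_actE bim_adj1 dual_act1. Qed.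
Lemma smash_act_hopf h m : smash_act X (el_hopf h) m = bim_adj X h m.
Proof. by rewrite /el_hopf smash_actE dual_act1 lmul1. Qed.
Lemma smash_act_dual q m : smash_act X (el_dual q) m = coact_by X q m.
Proof.
rewrite /el_dual smash_actE bim_adj1 lmul1 /dual_act; congr (coact_by X _ m).
by apply/lfunP => x; rewrite !comp_lfunE antipodeVK.
Qed.
(** The sum over dual bases contracts to a_2 . (S^-1(a_1) |> m), where |> is the adjoint action, and this equals
    a_3 S^-1(a_2) m a_1 = m a. *)
Lemma smash_act_right a m : smash_act X (el_right a) m = rmul X m a.
Proof.
rewrite /el_right (lin_bigsum (f := fun z => smash_act X z m)); last by lin.
under eq_bigr => i _ do rewrite smash_actE dual_act1.
transitivity (\sw_(a1, a2 <- D a) lmul X a2 (bim_adj X (S' a1) m)).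
  under eq_bigr => i _ do pull_sw (fun z => lmul X z (bim_adj X (bas i) m)).
  transitivity (\sw_(a1, a2 <- D a) \sum_i (lmul X (dbas i (S' a1) *: a2) (bim_adj X (bas i) m))).
    by rewrite lift_sum; apply: eq_bigr => i _; apply: eq_lift => a1 a2; rewrite comp_lfunE.
  apply: eq_lift => a1 a2; rewrite -{2}(bas_sum (S' a1)).
  rewrite (lin_bigsum (f := fun z => lmul X a2 (bim_adj X z m))); last by lin.
  apply: eq_bigr => i _; pull_scale (fun z => lmul X a2 (bim_adj X z m)).
  by pull_scale (fun z => lmul X z (bim_adj X (bas i) m)).
rewrite /bim_adj; under eq_lift => a1 a2 do (rewrite comul_antipodeV; last by lin).
under eq_lift => a1 a2 do pull_sw (lmul X a2).
rewrite comulA_sw; last by solve_lin.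
under eq_lift => a1 a2 do under eq_lift => b1 b2 do rewrite antipodeVK lrmulA -lmulM.
sw_rewrite (@antipodeV_r_tail _ _ HH _ a (fun a1 z => rmul X (lmul X z m) a1)).
by rewrite lmul1.
Qed.
End R.

Section Gen.
Variables (V : vectType k) (av : H -> V -> V).
Definition free_lmul (a : H) (t : tens H V) : tens H V := \sw_(l, v <- t) ((a * l) *t v).
(** The inverse antipode turns the left action of H on V into a right action; the map av is the action of H
    on V. *)
Definition free_rmul (t : tens H V) (a : H) : tens H V :=
  \sw_(l, v <- t) \sw_(a1, a2 <- D a) ((l * a1) *t av (S' a2) v).
Definition free_coact : 'Hom(tens H V, tens H (tens H V)) :=
  linfun (fun t : tens H V => \sw_(l, v <- t) \sw_(l1, l2 <- D l) (l1 *t (l2 *t v))).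
Hypotheses (av_bilin : bilin av) (av1 : forall v, av 1 v = v)
  (avM : forall a b v, av (a * b) v = av a (av b v)).

Lemma free_lmul_bilin : bilin free_lmul. Proof. by rewrite /free_lmul; lin. Qed.
Lemma free_rmul_bilin : bilin free_rmul. Proof. by rewrite /free_rmul; lin. Qed.
Lemma free_lmulE a l v : free_lmul a (l *t v) = (a * l) *t v.
Proof. by rewrite /free_lmul lift_tensor //; lin. Qed.
Lemma free_rmulE a l v : free_rmul (l *t v) a = \sw_(a1, a2 <- D a) ((l * a1) *t av (S' a2) v).
Proof. by rewrite /free_rmul lift_tensor //; lin. Qed.
Lemma free_coactE l v : free_coact (l *t v) = \sw_(l1, l2 <- D l) (l1 *t (l2 *t v)).
Proof. by rewrite /free_coact linfunE ?lift_tensor //; lin. Qed.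

Lemma free_ext (W : lmodType k) (f g : tens H V -> W) t : lin f -> lin g ->
  (forall l v, f (l *t v) = g (l *t v)) -> f t = g t.
Proof. by move=> lf lg e; apply: tens_ext. Qed.

Ltac free_ext_tac F G := apply: (@free_ext _ F G); [by have ? := free_lmul_bilin; have ? := free_rmul_bilin; lin
  |by have ? := free_lmul_bilin; have ? := free_rmul_bilin; lin|cbv beta].

Lemma free_lmul1 : forall t, free_lmul 1 t = t.
Proof.
by move=> t; free_ext_tac (free_lmul 1) (fun t : tens H V => t) => l v; rewrite free_lmulE mul1r.
Qed.
Lemma free_lmulM : forall a b t, free_lmul (a * b) t = free_lmul a (free_lmul b t).
Proof.
by move=> a b t; free_ext_tac (free_lmul (a * b)) (fun t => free_lmul a (free_lmul b t)) => l v; rewrite !free_lmulE mulrA.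
Qed.
Lemma free_rmul1 : forall t, free_rmul t 1 = t.
Proof.
move=> t; free_ext_tac (fun t => free_rmul t 1) (fun t : tens H V => t) => l v.
by rewrite free_rmulE comul1_sw ?mulr1 ?antipodeV1 ?av1 //; lin.
Qed.
Lemma free_rmulM : forall a b t, free_rmul t (a * b) = free_rmul (free_rmul t a) b.
Proof.
move=> a b t; free_ext_tac (fun t => free_rmul t (a * b)) (fun t => free_rmul (free_rmul t a) b) => l v.
rewrite !free_rmulE comulM_sw; last by lin.
have b2 := free_rmul_bilin; pull_sw (fun t => free_rmul t b).
apply: eq_lift => a1 a2; rewrite free_rmulE; apply: eq_lift => b1 b2'.
by rewrite mulrA antipodeVM avM.
Qed.
Lemma free_lrmulA : forall a b t, free_lmul a (free_rmul t b) = free_rmul (free_lmul a t) b.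
Proof.
move=> a b t; free_ext_tac (fun t => free_lmul a (free_rmul t b)) (fun t => free_rmul (free_lmul a t) b) => l v.
rewrite free_rmulE free_lmulE free_rmulE; have b1 := free_lmul_bilin; pull_sw (free_lmul a).
by apply: eq_lift => b1' b2; rewrite free_lmulE mulrA.
Qed.
Lemma free_coact_counit : forall t, \sw_(x, n <- free_coact t) (eps x *: n) = t.
Proof.
move=> t; free_ext_tac (fun t => \sw_(x, n <- free_coact t) (eps x *: n)) (fun t : tens H V => t) => l v.
rewrite free_coactE; pull_sw (fun z : tens H (tens H V) => \sw_(x, n <- z) (eps x *: n)).
under eq_lift => l1 l2 do (rewrite lift_tensor; last by lin).
by sw_rewrite (@counit_l _ _ HH _ l (fun l => l *t v)).
Qed.
Lemma free_coactA : forall t, \sw_(x, n <- free_coact t) \sw_(y, n' <- free_coact n) (x *t (y *t n')) = \sw_(x, n <- free_coact t) \sw_(x1, x2 <- D x) (x1 *t (x2 *t n)).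
Proof.
move=> t; free_ext_tac (fun t => \sw_(x, n <- free_coact t) \sw_(y, n' <- free_coact n) (x *t (y *t n')))
  (fun t => \sw_(x, n <- free_coact t) \sw_(x1, x2 <- D x) (x1 *t (x2 *t n))) => l v.
rewrite free_coactE; pull_sw (fun z : tens H (tens H V) => \sw_(x, n <- z) \sw_(y, n' <- free_coact n) (x *t (y *t n'))).
pull_sw (fun z : tens H (tens H V) => \sw_(x, n <- z) \sw_(x1, x2 <- D x) (x1 *t (x2 *t n))).
under eq_lift => l1 l2 do (rewrite lift_tensor; last by lin).
under [RHS]eq_lift => l1 l2 do (rewrite lift_tensor; last by lin).
rewrite [RHS]comulA_sw; last by solve_lin.
apply: eq_lift => l1 l2; rewrite free_coactE lift_lift; apply: eq_lift => l3 l4.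
by rewrite lift_tensor //; lin.
Qed.
Lemma free_coact_lmul : forall a t, free_coact (free_lmul a t) =
  \sw_(a1, a2 <- D a) \sw_(x, n <- free_coact t) ((a1 * x) *t free_lmul a2 n).
Proof.
move=> a t; have b1 := free_lmul_bilin.
free_ext_tac (fun t => free_coact (free_lmul a t)) (fun t => \sw_(a1, a2 <- D a) \sw_(x, n <- free_coact t) ((a1 * x) *t free_lmul a2 n)) => l v.
rewrite free_lmulE !free_coactE comulM_sw; last by lin.
apply: eq_lift => a1 a2; rewrite lift_lift; apply: eq_lift => l1 l2.
by rewrite lift_tensor ?free_lmulE //; lin.
Qed.
Lemma free_coact_rmul : forall a t, free_coact (free_rmul t a) =
  \sw_(a1, a2 <- D a) \sw_(x, n <- free_coact t) ((x * a1) *t free_rmul n a2).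
Proof.
move=> a t; have b1 := free_rmul_bilin.
free_ext_tac (fun t => free_coact (free_rmul t a)) (fun t => \sw_(a1, a2 <- D a) \sw_(x, n <- free_coact t) ((x * a1) *t free_rmul n a2)) => l v.
rewrite free_rmulE free_coactE; pull_sw free_coact.
under eq_lift => a1 a2 do (rewrite free_coactE comulM_sw; last by lin).
symmetry; under eq_lift => a1 a2 do rewrite lift_lift.
rewrite [LHS]lift_exch [RHS]lift_exch; apply: eq_lift => l1 l2.
under eq_lift => a1 a2 do (rewrite lift_tensor; last by lin).
under eq_lift => a1 a2 do (rewrite free_rmulE; pull_sw (fun z => (l1 * a1) *t z)).
by rewrite [RHS]comulA_sw //; solve_lin.
Qed.

(** These will turn out to be all Hopf bimodules: V is recovered as the space of coinvariants. *)
Definition free_bimod : hopf_bimod HH (tens H V) :=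
  @HopfBimod _ _ _ _ free_lmul free_rmul free_coact free_lmul_bilin free_rmul_bilin free_lmul1 free_lmulM free_rmul1 free_rmulM free_lrmulA
    free_coact_counit free_coactA free_coact_lmul free_coact_rmul.
End Gen.
End Recover.
#[export] Hint Resolve lin_el_left lin_el_dual lin_el_right lin_el_hopf lin_dual_comul : linear_fun.

(** * A faithful representation on H (x) H and the isomorphism of algebras *)

Section Faithful.
Variables (k : fieldType) (H : falgType k) (HH : hopf_structure H).
Local Notation D := (comul HH).
Local Notation eps := (counit HH).
Local Notation S := (antipode HH).
Local Notation S' := ((antipode HH)^-1)%VF.
Local Notation Hd := 'Hom(H, k^o).
Local Notation L := (smash_double HH).
Local Notation LT := (tens H (tens Hd H)).
Local Notation convol := (convol HH).
Local Notation adj_act := (adj_act HH).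
Local Notation smash_mul := (smash_mul HH).
Local Notation el_right := (el_right HH).
Local Notation el_dual := (el_dual HH).
Local Notation el_left := (el_left HH).

(** Associativity and the unit laws hold as soon as they hold for operators. *)
Lemma algebra_of_faithful (A : alg_data k) (mul : A -> A -> A)
    (V : vectType k) (rho : A -> V -> V) :
  (forall x y, amul x y = mul x y) ->
  bilin mul -> (forall v, rho (aone A) v = v) ->
  (forall x y v, rho (mul x y) v = rho x (rho y v)) ->
  (forall x y, (forall v, rho x v = rho y v) -> x = y) -> is_algebra A.
Proof.
move=> e [b1 b2] r1 rM inj; split=> [|x y z|x|x]; try by apply: inj => v; rewrite !e ?rM ?r1.
split=> [x|y] c u v; first by rewrite !e b1.
by rewrite !e -b2.
Qed.

Definition reg_act (a b : H) : H := a * b.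
Definition reg_bimod : hopf_bimod HH (tens H H) :=
  @free_bimod _ _ HH H reg_act (mul_bilin H) (@mul1r H) (fun a b v => esym (mulrA a b v)).

Local Notation HT := (tens (tens H Hd) H).
Local Notation Q := (tens_alg (heisenberg (cop_bialg HH)) (falg_data H)).

Lemma hit_rE a (p : Hd) : hit_r HH a p = \sw_(l1, l2 <- D a) ((p l1 : k) *: l2).
Proof. by []. Qed.

(** The opposite coproduct reverses the convolution product of the dual and turns its action on H into
    p . x = p(x_1) x_2. *)
Definition heis_mul (x y : tens H Hd) : tens H Hd :=
  \sw_(a, p <- x) \sw_(b, q <- y)
    lift (fun p1 p2 : Hd => (a * hit_r HH b p1) *t convol q p2) (dual_comul p).
Lemma heis_mul_bilin : bilin heis_mul.
Proof. by have h := @lin_dual_comul k H; have h2 := convol_bilin HH; rewrite /heis_mul; lin. Qed.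
Definition comul_cop (z : H) : tens H H := \sw_(a, b <- D z) (b *t a).
Lemma convol_cop (p q : Hd) :
  linfun (fun z : H => lift (fun x1 x2 : H => (p x1 * q x2 : k^o)) (comul_cop z)) = convol q p.
Proof.
apply/lfunP => z; rewrite convolE linfunE; last by rewrite /comul_cop; lin.
rewrite /comul_cop lift_lift; apply: eq_lift => a b.
rewrite lift_tensor; first exact: (@mulrC k).
by lin.
Qed.
Lemma hit_r_cop (p : Hd) (z : H) :
  lift (fun x1 x2 : H => (p x2 : k) *: x1) (comul_cop z) = hit_r HH z p.
Proof.
rewrite /comul_cop lift_lift; apply: eq_lift => a b.
by rewrite lift_tensor //; lin.
Qed.
Lemma heis_amul (x y : heisenberg (cop_bialg HH)) : amul x y = heis_mul x y.
Proof.
apply: eq_lift => a p; apply: eq_lift => b q; apply: eq_lift => p1 p2.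
by rewrite -hit_r_cop -convol_cop.
Qed.
Definition heisH_mul (x y : HT) : HT :=
  \sw_(u, h <- x) \sw_(w, g <- y) (heis_mul u w *t (h * g)).
Lemma heisH_mul_bilin : bilin heisH_mul.
Proof. by have h := heis_mul_bilin; rewrite /heisH_mul; lin. Qed.
Lemma heisH_amul (x y : Q) : amul x y = heisH_mul x y.
Proof.
apply: eq_lift => u h; apply: eq_lift => w g; by rewrite heis_amul.
Qed.

Definition heis_act_HH (z : HT) (t : tens H H) : tens H H :=
  \sw_(u, h <- z) \sw_(a, q <- u) \sw_(l, v <- t) \sw_(l1, l2 <- D l)
    (((q : Hd) l1 : k) *: ((a * l2) *t (h * v))).
Lemma heis_act_HH_bilin : bilin heis_act_HH.
Proof. by rewrite /heis_act_HH; lin. Qed.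
Lemma heis_act_HHE a (q : Hd) h l v : heis_act_HH ((a *t q) *t h) (l *t v) =
  \sw_(l1, l2 <- D l) ((q l1 : k) *: ((a * l2) *t (h * v))).
Proof. by rewrite /heis_act_HH !lift_tensor //; lin. Qed.

(** Both sides apply q to l_1, and p to b_1 l_2; in the product the latter is split by the coproduct of p. *)
Lemma heis_act_HHM x y t : heis_act_HH (heisH_mul x y) t = heis_act_HH x (heis_act_HH y t).
Proof.
have b1 := heis_act_HH_bilin; have b2 := heisH_mul_bilin; have b3 := heis_mul_bilin.
apply: (@tens_ext _ _ _ _ (fun x => heis_act_HH (heisH_mul x y) t) (fun x => heis_act_HH x (heis_act_HH y t))); [by lin|by lin|move=> u h].
apply: (@tens_ext _ _ _ _ (fun u => heis_act_HH (heisH_mul (u *t h) y) t) (fun u => heis_act_HH (u *t h) (heis_act_HH y t))); [by lin|by lin|move=> a p].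
apply: (@tens_ext _ _ _ _ (fun y => heis_act_HH (heisH_mul ((a *t p) *t h) y) t) (fun y => heis_act_HH ((a *t p) *t h) (heis_act_HH y t))); [by lin|by lin|move=> w g].
apply: (@tens_ext _ _ _ _ (fun w => heis_act_HH (heisH_mul ((a *t p) *t h) (w *t g)) t) (fun w => heis_act_HH ((a *t p) *t h) (heis_act_HH (w *t g) t))); [by lin|by lin|move=> b q].
apply: (@tens_ext _ _ _ _ (fun t => heis_act_HH (heisH_mul ((a *t p) *t h) ((b *t q) *t g)) t) (fun t => heis_act_HH ((a *t p) *t h) (heis_act_HH ((b *t q) *t g) t))); [by lin|by lin|move=> l v].
rewrite /heisH_mul !lift_tensor; try by lin.
have b4 := convol_bilin HH; have b5 := @lin_dual_comul k H.
rewrite /heis_mul !lift_tensor; try by lin.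
pull_sw (fun z => heis_act_HH (z *t (h * g)) (l *t v)).
rewrite heis_act_HHE; pull_sw (heis_act_HH ((a *t p) *t h)).
transitivity (\sw_(l1, r <- D l) \sw_(b1, b2 <- D b) \sw_(l2, l3 <- D r)
   ((q l1 : k) *: ((p (b1 * l2) : k) *: ((a * (b2 * l3)) *t (h * (g * v)))))).
  transitivity (\sw_(l1, r <- D l) \sw_(b1, b2 <- D b) \sw_(l2, l3 <- D r) (lift (fun p1 p2 : Hd =>
   ((p1 b1 : k) *: ((p2 l2 : k) *: ((q l1 : k) *: ((a * (b2 * l3)) *t (h * (g * v)))))) ) (dual_comul p))).
    symmetry; under eq_lift => l1 r do under eq_lift => c1 c2 do rewrite lift_exch.
    under eq_lift => l1 r do rewrite lift_exch.
    rewrite [LHS]lift_exch; apply: eq_lift => p1 p2; rewrite heis_act_HHE.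
    symmetry; transitivity (\sw_(l1, l2 <- D l) \sw_(c, d <- D l1) \sw_(c1, c2 <- D b)
      ((p1 c1 : k) *: ((p2 d : k) *: ((q c : k) *: ((a * (c2 * l2)) *t (h * (g * v))))))).
      apply: eq_lift => l1 l2; rewrite convolE hit_rE.
      pull_sw (fun z : k^o => (z : k) *: (a * (\sw_(c1, c2 <- D b) p1 c1 *: c2) * l2 *t (h * g * v))).
      apply: eq_lift => c d.
      pull_sw (fun z => (q c * p2 d : k) *: (a * z * l2 *t (h * g * v))).
      apply: eq_lift => c1 c2; pull_scale (fun z => (a * z * l2 *t (h * g * v))).
      by rewrite !scalerA -!mulrA; congr (_ *: _); rewrite mulrC -mulrA mulrCA.
    rewrite comulA_sw; last by solve_lin.
    by apply: eq_lift => c r; rewrite [LHS]lift_exch.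
  apply: eq_lift => l1 r; apply: eq_lift => c1 c2; apply: eq_lift => l2 l3.
  by rewrite dual_comulE !scalerA mulrC.
apply: eq_lift => l1 r; pull_scale (heis_act_HH ((a *t p) *t h)); rewrite heis_act_HHE.
rewrite comulM_sw; last by lin.
rewrite scale_lift; apply: eq_lift => c1 c2; rewrite scale_lift; apply: eq_lift => l2 l3.
by [].
Qed.

Lemma heis_act_HH1 t : heis_act_HH ((1 *t eps) *t 1) t = t.
Proof.
have b1 := heis_act_HH_bilin.
apply: (@tens_ext _ _ _ _ (heis_act_HH ((1 *t eps) *t 1)) (fun t => t)); [by lin|by lin|move=> l v].
rewrite heis_act_HHE; under eq_lift => l1 l2 do rewrite !mul1r.
by sw_rewrite (@counit_l _ _ HH _ l (fun z => z *t v)).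
Qed.

(** The operator of (a # q) (x) h sends c_1 (x) 1 to q(c_1) a c_2 (x) h, with c_3 left over; multiplying the first
    factor on the right by S(c_3) gives q(c) a (x) h.  Letting c run through a basis recovers the element from
    its operator. *)
Lemma heis_act_HH_inj x y : (forall t, heis_act_HH x t = heis_act_HH y t) -> x = y.
Proof.
have b1 := heis_act_HH_bilin.
pose ev (c : H) (t : tens H H) : tens H H := \sw_(l, v <- t) ((l * S c) *t v).
have bev : bilin ev by rewrite /ev; lin.
pose E (c : H) (z : HT) := \sw_(c1, c2 <- D c) ev c2 (heis_act_HH z (c1 *t 1)).
have EE c a q h : E c ((a *t q) *t h) = (q c : k) *: (a *t h).
  rewrite /E; under eq_lift => c1 c2 do (rewrite heis_act_HHE; pull_sw (ev c2)).
  rewrite (@comulA_sw _ _ HH _ c (fun l1 l2 c2 => ev c2 (q l1 *: (a * l2 *t (h * 1))))); last by solve_lin.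
  under eq_lift => c1 r do under eq_lift => c2 c3 do
    (pull_scale (ev c3); rewrite /ev lift_tensor; last by lin).
  under eq_lift => c1 r do under eq_lift => c2 c3 do rewrite -mulrA mulr1.
  by sw_rewrite (@antipode_r_tail _ _ HH _ c (fun c1 z => (q c1 : k) *: ((a * z) *t h))); rewrite mulr1.
pose rec (z : HT) : HT := \sum_(i < \dim {:H}) \sw_(a, h <- E (bas i) z) ((a *t dbas i) *t h).
have bE : bilin E by rewrite /E; lin.
have recK z : rec z = z.
  apply: (@tens_ext _ _ _ _ rec (fun z => z)); [by rewrite /rec; lin|by lin|move=> u h].
  apply: (@tens_ext _ _ _ _ (fun u => rec (u *t h)) (fun u => u *t h)); [by rewrite /rec; lin|by lin|move=> a q].
  rewrite /rec; under eq_bigr => i _ do (rewrite EE; pull_scale (fun z : tens H H => \sw_(a, h <- z) ((a *t dbas i) *t h)); rewrite lift_tensor; last by lin).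
  rewrite -{2}(dbas_sum q) (lin_bigsum (f := fun q => (a *t q) *t h)); last by lin.
  by apply: eq_bigr => i _; pull_scale (fun q => (a *t q) *t h).
move=> h; rewrite -[x]recK -[y]recK; apply: eq_bigr => i _; congr (lift _ _).
by apply: eq_lift => c1 c2; rewrite h.
Qed.

Lemma heisH_one : aone Q = (1 *t eps) *t 1.
Proof.
rewrite -[aone Q]/((1 *t linfun (fun x => eps x)) *t 1).
by rewrite (_ : linfun _ = eps) // -[RHS]fun_of_lfunK.
Qed.

Lemma heisH_algebra : is_algebra Q.
Proof.
apply: (@algebra_of_faithful Q heisH_mul (tens H H) heis_act_HH heisH_amul heisH_mul_bilin).
- by move=> v; rewrite heisH_one; exact: heis_act_HH1.
- exact: heis_act_HHM.
- exact: heis_act_HH_inj.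
Qed.

Lemma reg_bimod_lmul a l v : lmul reg_bimod a (l *t v) = (a * l) *t v. Proof. exact: free_lmulE. Qed.
Lemma reg_bimod_rmul a l v : rmul reg_bimod (l *t v) a = \sw_(a1, a2 <- D a) ((l * a1) *t (S' a2 * v)).
Proof. exact: (@free_rmulE _ _ HH H reg_act (mul_bilin H)). Qed.
Lemma reg_bimod_coact l v : coact reg_bimod (l *t v) = \sw_(l1, l2 <- D l) (l1 *t (l2 *t v)).
Proof. exact: free_coactE. Qed.

(** The element sum_i (x_i |> x) p_i, for dual bases x_i and p_i and the adjoint action |>, sends l (x) v to
    (l_1 x S(l_2)) l_3 (x) v = l x (x) v. *)
Definition el_rmul (x : H) : LT := \sum_i smash_mul (el_left (adj_act (bas i) x)) (el_dual (dbas i)).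
Lemma lin_el_rmul : lin el_rmul.
Proof. by have h := @lin_el_left _ _ HH; rewrite /el_rmul; lin. Qed.
Lemma smash_act_rmul x l v : smash_act reg_bimod (el_rmul x) (l *t v) = (l * x) *t v.
Proof.
rewrite /el_rmul (lin_bigsum (f := fun z => smash_act reg_bimod z (l *t v))); last by lin.
under eq_bigr => i _ do rewrite smash_actM smash_act_left smash_act_dual /coact_by.
transitivity (\sw_(l1, l2 <- D l) ((adj_act l1 x * l2) *t v)).
  under eq_bigr => i _ do pull_sw (lmul reg_bimod (adj_act (bas i) x)).
  rewrite -lift_sum reg_bimod_coact lift_lift; apply: eq_lift => l1 l2.
  rewrite lift_tensor; last by lin.
  rewrite -{2}(bas_sum l1) (lin_bigsum (f := fun z => (adj_act z x * l2) *t v)); last by lin.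
  apply: eq_bigr => i _; rewrite linZ; last by lin.
  by rewrite reg_bimod_lmul; pull_scale (fun z => (adj_act z x * l2) *t v).
under eq_lift => l1 l2 do pull_sw (fun z => (z * l2) *t v).
rewrite comulA_sw; last by solve_lin.
under eq_lift => l1 r do under eq_lift => l2 l3 do rewrite -!mulrA.
by sw_rewrite (@antipode_l_tail _ _ HH _ l (fun l1 z => (l1 * (x * z)) *t v)); rewrite mulr1.
Qed.

(** The right action of S(h_1) on l (x) v is l S(h_2) (x) h_1 v with h_3 left over; multiplying the first factor by
    it gives l S(h_2) h_3 (x) h_1 v = l (x) h v. *)
Definition el_central (h : H) : LT := \sw_(h1, h2 <- D h) smash_mul (el_rmul h2) (el_right (S h1)).
Lemma lin_el_central : lin el_central.
Proof. by have h := lin_el_rmul; have h1 := lin_el_right HH; rewrite /el_central; lin. Qed.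
Lemma smash_act_central h l v : smash_act reg_bimod (el_central h) (l *t v) = l *t (h * v).
Proof.
rewrite /el_central; pull_sw (fun z => smash_act reg_bimod z (l *t v)).
transitivity (\sw_(h1, h2 <- D h) \sw_(b1, b2 <- D h1) ((l * (S b2 * h2)) *t (b1 * v))).
  apply: eq_lift => h1 h2; rewrite smash_actM smash_act_right reg_bimod_rmul comul_antipode; last by lin.
  pull_sw (smash_act reg_bimod (el_rmul h2)); apply: eq_lift => b1 b2.
  by rewrite smash_act_rmul antipodeK mulrA.
rewrite comulA_sw; last by solve_lin.
by sw_rewrite (@antipode_l_tail _ _ HH _ h (fun b1 z => (l * z) *t (b1 * v))); rewrite mulr1.
Qed.

Definition heis_to_smash (z : HT) : LT :=
  \sw_(u, h <- z) \sw_(a, q <- u) smash_mul (smash_mul (el_left a) (el_dual q)) (el_central h).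
Lemma lin_heis_to_smash : lin heis_to_smash.
Proof. by rewrite /heis_to_smash; lin. Qed.
Lemma smash_act_heis z t : smash_act reg_bimod (heis_to_smash z) t = heis_act_HH z t.
Proof.
have b1 := heis_act_HH_bilin; have l1 := lin_heis_to_smash.
apply: (@tens_ext _ _ _ _ (fun z => smash_act reg_bimod (heis_to_smash z) t) (fun z => heis_act_HH z t)); [by lin|by lin|move=> u h].
apply: (@tens_ext _ _ _ _ (fun u => smash_act reg_bimod (heis_to_smash (u *t h)) t) (fun u => heis_act_HH (u *t h) t)); [by lin|by lin|move=> a q].
apply: (@tens_ext _ _ _ _ (smash_act reg_bimod (heis_to_smash ((a *t q) *t h))) (heis_act_HH ((a *t q) *t h))); [by lin|by lin|move=> l v].
have h1 := @lin_el_left _ _ HH; have h2 := @lin_el_dual _ _ HH; have h3 := lin_el_central.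
rewrite /heis_to_smash !lift_tensor; try by lin.
rewrite !smash_actM smash_act_central smash_act_dual smash_act_left heis_act_HHE /coact_by reg_bimod_coact lift_lift.
pull_sw (lmul reg_bimod a); apply: eq_lift => l1' l2.
rewrite lift_tensor; last by lin.
by pull_scale (lmul reg_bimod a); rewrite reg_bimod_lmul.
Qed.

Let P : 'Hom(HT, LT) := linfun heis_to_smash.
Lemma heis_to_smash_lfunE z : P z = heis_to_smash z.
Proof. by rewrite /P linfunE //; exact: lin_heis_to_smash. Qed.
Lemma heis_to_smash_ker : lker P == 0%VS.
Proof.
apply/lker0P => x y; rewrite !heis_to_smash_lfunE => e; apply: heis_act_HH_inj => t.
by rewrite -!smash_act_heis e.
Qed.
Lemma heis_to_smash_full : limg P = fullv.
Proof.
apply/eqP; rewrite eqEdim subvf /= limg_dim_eq; last by rewrite (eqP heis_to_smash_ker) capv0.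
(* An injective map between spaces of the same dimension (dim H)^3. *)
have dT (U V : vectType k) : \dim {:tens U V} = (\dim {:U} * \dim {:V})%N by rewrite [LHS]dimvf dim_matrix.
by rewrite !dT mulnA.
Qed.
Lemma heis_to_smashK : cancel P P^-1%VF. Proof. exact: lker0_lfunK heis_to_smash_ker. Qed.
Lemma heis_to_smashVK : cancel P^-1%VF P.
Proof. by move=> x; rewrite limg_lfunVK // heis_to_smash_full memvf. Qed.

Lemma heis_act_invol x t : heis_act_HH (P^-1%VF x) t = smash_act reg_bimod x t.
Proof. by rewrite -smash_act_heis -heis_to_smash_lfunE heis_to_smashVK. Qed.

(** By bijectivity, every element of H # D(H) acts as an element of the second algebra, whose action is
    faithful. *)
Lemma smash_act_inj (x y : LT) : (forall t, smash_act reg_bimod x t = smash_act reg_bimod y t) -> x = y.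
Proof.
move=> e; rewrite -(heis_to_smashVK x) -(heis_to_smashVK y); congr (P _); apply: heis_act_HH_inj => t.
by rewrite -!smash_act_heis -!heis_to_smash_lfunE !heis_to_smashVK.
Qed.

Lemma smash_algebra : is_algebra L.
Proof.
apply: (@algebra_of_faithful L smash_mul (tens H H) (smash_act reg_bimod) (@smash_amul _ _ _) (@smash_mul_bilin _ _ _)).
- exact: smash_act1.
- exact: smash_actM.
- exact: smash_act_inj.
Qed.

Lemma smash_iso : alg_iso L Q.
Proof.
exists (P^-1)%VF; split.
- by exists P; [exact: heis_to_smashVK|exact: heis_to_smashK].
- rewrite heisH_one -[RHS]heis_to_smashK; congr (_ _); apply: smash_act_inj => t.
  by rewrite heis_to_smash_lfunE smash_act_heis heis_act_HH1 smash_act1.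
move=> x y; rewrite smash_amul heisH_amul -[RHS]heis_to_smashK; congr (_ _); apply: smash_act_inj => t.
by rewrite heis_to_smash_lfunE smash_act_heis heis_act_HHM !heis_act_invol smash_actM.
Qed.
End Faithful.

(** * Modules over H # D(H) are Hopf bimodules *)

Section Bim.
Variables (k : fieldType) (H : falgType k) (HH : hopf_structure H).
Local Notation D := (comul HH).
Local Notation eps := (counit HH).
Local Notation S := (antipode HH).
Local Notation S' := ((antipode HH)^-1)%VF.
Local Notation Hd := 'Hom(H, k^o).
Local Notation L := (smash_double HH).
Local Notation LT := (tens H (tens Hd H)).
Local Notation convol := (convol HH).
Local Notation smash_mul := (smash_mul HH).
Local Notation el_right := (el_right HH).
Local Notation el_dual := (el_dual HH).
Local Notation el_left := (el_left HH).
Local Notation el_hopf := (el_hopf HH).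

Definition mod_l (M : mod_data L) (a : H) (m : M) : M := mact (el_left a : L) m.
Definition mod_r (M : mod_data L) (m : M) (a : H) : M := mact (el_right a : L) m.
(** The coaction is the one for which [el_dual q] acts by m |-> q(m_{-1}) m_0. *)
Definition mod_co (M : mod_data L) : 'Hom(M, tens H M) :=
  linfun (fun m : M => \sum_i (bas i *t mact (el_dual (dbas i) : L) m)).

Lemma el_leftM a b : el_left (a * b) = smash_mul (el_left a) (el_left b).
Proof. by apply: (@smash_act_inj _ _ HH) => t; rewrite smash_actM !smash_act_left lmulM. Qed.
Lemma el_right1 : el_right 1 = aone L.
Proof. by apply: (@smash_act_inj _ _ HH) => t; rewrite smash_act_right rmul1 smash_act1. Qed.
Lemma el_rightM a b : el_right (a * b) = smash_mul (el_right b) (el_right a).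
Proof. by apply: (@smash_act_inj _ _ HH) => t; rewrite smash_actM !smash_act_right rmulM. Qed.
Lemma el_left_rightC a b : smash_mul (el_left a) (el_right b) = smash_mul (el_right b) (el_left a).
Proof. by apply: (@smash_act_inj _ _ HH) => t; rewrite !smash_actM !smash_act_right !smash_act_left lrmulA. Qed.
Lemma el_dual1 : el_dual eps = aone L.
Proof. by apply: (@smash_act_inj _ _ HH) => t; rewrite smash_act_dual coact_by1 smash_act1. Qed.
Lemma el_dualM p q : smash_mul (el_dual p) (el_dual q) = el_dual (convol q p).
Proof. by apply: (@smash_act_inj _ _ HH) => t; rewrite smash_actM !smash_act_dual coact_byM. Qed.
Definition dual_ltrans (q : Hd) (a : H) : Hd := linfun (fun x => q (a * x)).
Definition dual_rtrans (q : Hd) (a : H) : Hd := linfun (fun x => q (x * a)).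
Lemma dual_ltransE q a x : dual_ltrans q a x = q (a * x). Proof. by rewrite /dual_ltrans linfunE //; lin. Qed.
Lemma dual_rtransE q a x : dual_rtrans q a x = q (x * a). Proof. by rewrite /dual_rtrans linfunE //; lin. Qed.
Lemma dual_ltrans_bilin : bilin dual_ltrans. Proof. by rewrite /dual_ltrans; lin. Qed.
Lemma dual_rtrans_bilin : bilin dual_rtrans. Proof. by rewrite /dual_rtrans; lin. Qed.
(** The compatibility of the coaction with left multiplication, as a relation in H # D(H): it holds because it
    holds for operators on H (x) H. *)
Lemma el_dual_left q a : smash_mul (el_dual q) (el_left a) =
  \sw_(a1, a2 <- D a) smash_mul (el_left a2) (el_dual (dual_ltrans q a1)).
Proof.
apply: (@smash_act_inj _ _ HH) => t; rewrite smash_actM smash_act_left smash_act_dual coact_by_lmul.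
pull_sw (fun z => smash_act (reg_bimod HH) z t); apply: eq_lift => a1 a2.
rewrite smash_actM smash_act_left smash_act_dual /coact_by; pull_sw (lmul (reg_bimod HH) a2).
by apply: eq_lift => x n; pull_scale (lmul (reg_bimod HH) a2); rewrite dual_ltransE.
Qed.
Lemma el_dual_right q a : smash_mul (el_dual q) (el_right a) =
  \sw_(a1, a2 <- D a) smash_mul (el_right a2) (el_dual (dual_rtrans q a1)).
Proof.
apply: (@smash_act_inj _ _ HH) => t; rewrite smash_actM smash_act_right smash_act_dual coact_by_rmul.
pull_sw (fun z => smash_act (reg_bimod HH) z t); apply: eq_lift => a1 a2.
rewrite smash_actM smash_act_right smash_act_dual /coact_by; pull_sw (fun z => rmul (reg_bimod HH) z a2).
by apply: eq_lift => x n; pull_scale (fun z => rmul (reg_bimod HH) z a2); rewrite dual_rtransE.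
Qed.
(** Since the factor from H is in turn a combination of left and right multiplications ([el_hopfE]), the
    action of H # D(H) is determined by the bimodule structure and the coaction. *)
Lemma smash_decomp a p h : a *t (p *t h) =
  smash_mul (el_left a) (smash_mul (el_dual (p \o S')%VF) (el_hopf h)).
Proof.
apply: (@smash_act_inj _ _ HH) => t; rewrite !smash_actM smash_act_left smash_act_dual smash_act_hopf.
by rewrite smash_actE.
Qed.
Lemma el_hopfE h : el_hopf h = \sw_(h1, h2 <- D h) smash_mul (el_right (S h2)) (el_left h1).
Proof.
apply: (@smash_act_inj _ _ HH) => t; rewrite smash_act_hopf; pull_sw (fun z => smash_act (reg_bimod HH) z t).
by apply: eq_lift => h1 h2; rewrite smash_actM smash_act_left smash_act_right.
Qed.

Section Mod.
Variables (M : mod_data L) (HM : is_module M).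
Local Notation act := (@mact k L M : LT -> M -> M).
Lemma mod_act_bilin : bilin act. Proof. exact: (mact_bilin HM). Qed.
Lemma mod_actM x y m : act (smash_mul x y) m = act x (act y m).
Proof. by rewrite -(mactM HM) smash_amul. Qed.
Hint Resolve mod_act_bilin : bil.
Lemma mod_l_bilin : bilin (@mod_l M).
Proof. have h := @lin_el_left _ _ HH; rewrite /mod_l; lin. Qed.
Lemma mod_r_bilin : bilin (@mod_r M).
Proof. have h := @lin_el_right _ _ HH; rewrite /mod_r; lin. Qed.
Lemma mod_coE m : mod_co M m = \sum_i (bas i *t act (el_dual (dbas i)) m).
Proof. by rewrite /mod_co linfunE //; lin. Qed.
Lemma mod_co_dual (q : Hd) m : \sw_(x, n <- mod_co M m) ((q x : k) *: n) = act (el_dual q) m.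
Proof.
rewrite mod_coE (lin_bigsum (f := fun z : tens H M => \sw_(x, n <- z) (q x *: n))); last by lin.
under eq_bigr => i _ do (rewrite lift_tensor; last by lin).
have lq : lin (fun z => act (el_dual z) m) by have h := @lin_el_dual _ _ HH; lin.
rewrite -{2}(dbas_sum q) (lin_bigsum _ lq).
by apply: eq_bigr => i _; exact: (esym (linZ _ _ lq)).
Qed.
Lemma mod_co_counit m : \sw_(x, n <- mod_co M m) (eps x *: n) = m.
Proof. by rewrite mod_co_dual el_dual1 (mact1 HM). Qed.
Lemma mod_coA m : \sw_(x, n <- mod_co M m) \sw_(y, n' <- mod_co M n) (x *t (y *t n'))
     = \sw_(x, n <- mod_co M m) \sw_(x1, x2 <- D x) (x1 *t (x2 *t n)).
Proof.
apply: tens_coords => q; rewrite !lift_lift; apply: tens_coords => p.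
rewrite !lift_lift; transitivity (act (el_dual p) (act (el_dual q) m)).
  rewrite -(mod_co_dual q m); pull_sw (act (el_dual p)); apply: eq_lift => x n.
  pull_scale (act (el_dual p)); rewrite -mod_co_dual scale_lift !lift_lift; apply: eq_lift => y n'.
  rewrite lift_tensor; last by lin.
  by rewrite (linZ (f := lift (fun (y : H) (n : M) => p y *: n))) ?lift_tensor ?scalerA //; lin.
rewrite -mod_actM el_dualM -mod_co_dual; apply: eq_lift => x n; rewrite convolE !lift_lift.
pull_sw (fun z : k^o => (z : k) *: n); apply: eq_lift => x1 x2.
rewrite lift_tensor; last by lin.
by rewrite (linZ (f := lift (fun (y : H) (n : M) => p y *: n))) ?lift_tensor ?scalerA //; lin.
Qed.
Lemma mod_co_l a m : mod_co M (mod_l a m) =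
     \sw_(a1, a2 <- D a) \sw_(x, n <- mod_co M m) ((a1 * x) *t mod_l a2 n).
Proof.
have b1 := mod_l_bilin; have b2 := dual_ltrans_bilin.
apply: tens_coords => q; rewrite mod_co_dual /mod_l -mod_actM el_dual_left.
pull_sw (fun z => act z m); rewrite lift_lift; apply: eq_lift => a1 a2.
rewrite mod_actM -mod_co_dual; pull_sw (act (el_left a2)); rewrite lift_lift; apply: eq_lift => x n.
rewrite lift_tensor; last by lin.
by pull_scale (act (el_left a2)); rewrite dual_ltransE.
Qed.
Lemma mod_co_r a m : mod_co M (mod_r m a) =
     \sw_(a1, a2 <- D a) \sw_(x, n <- mod_co M m) ((x * a1) *t mod_r n a2).
Proof.
have b1 := mod_r_bilin; have b2 := dual_rtrans_bilin.
apply: tens_coords => q; rewrite mod_co_dual /mod_r -mod_actM el_dual_right.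
pull_sw (fun z => act z m); rewrite lift_lift; apply: eq_lift => a1 a2.
rewrite mod_actM -mod_co_dual; pull_sw (act (el_right a2)); rewrite lift_lift; apply: eq_lift => x n.
rewrite lift_tensor; last by lin.
by pull_scale (act (el_right a2)); rewrite dual_rtransE.
Qed.
Definition mod_bimod : hopf_bimod HH M.
Proof.
apply: (@HopfBimod _ _ _ _ (@mod_l M) (@mod_r M) (mod_co M) mod_l_bilin mod_r_bilin) => *.
- exact: (mact1 HM).
- by rewrite /mod_l el_leftM mod_actM.
- by rewrite /mod_r el_right1; exact: (mact1 HM).
- by rewrite /mod_r el_rightM mod_actM.
- by rewrite /mod_l /mod_r -!mod_actM el_left_rightC.
- exact: mod_co_counit.
- exact: mod_coA.
- exact: mod_co_l.
- exact: mod_co_r.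
Defined.
Lemma mod_l1 (m : M) : mod_l 1 m = m. Proof. exact: (lmul1 mod_bimod). Qed.
Lemma mod_lM a b (m : M) : mod_l (a * b) m = mod_l a (mod_l b m). Proof. exact: (lmulM mod_bimod). Qed.
Lemma mod_r1 (m : M) : mod_r m 1 = m. Proof. exact: (rmul1 mod_bimod). Qed.
Lemma mod_rM a b (m : M) : mod_r m (a * b) = mod_r (mod_r m a) b. Proof. exact: (rmulM mod_bimod). Qed.
Lemma mod_lrA a b (m : M) : mod_l a (mod_r m b) = mod_r (mod_l a m) b. Proof. exact: (lrmulA mod_bimod). Qed.
(** An H # D(H)-module is the module of its own Hopf bimodule: the translation loses nothing. *)
Lemma mod_act_bimod x m : act x m = smash_act mod_bimod x m.
Proof.
apply: (@tens_ext _ _ _ _ (fun x => act x m) (fun x => smash_act mod_bimod x m)); [by lin|by lin|move=> a u].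
apply: (@tens_ext _ _ _ _ (fun u => act (a *t u) m) (fun u => smash_act mod_bimod (a *t u) m)); [by lin|by lin|move=> p h].
rewrite smash_actE smash_decomp !mod_actM; congr (mod_l _ _).
rewrite -mod_co_dual; congr (lift _ (mod_co M _)).
rewrite el_hopfE /bim_adj; pull_sw (fun z => act z m); apply: eq_lift => h1 h2.
by rewrite mod_actM.
Qed.
End Mod.

Lemma coact_sum (M : vectType k) (X : hopf_bimod HH M) m :
  \sum_i (bas i *t coact_by X (dbas i) m) = coact X m.
Proof.
rewrite -[RHS]lift_id /coact_by; under eq_bigr => i _ do pull_sw (fun z => bas i *t z).
rewrite -lift_sum; apply: eq_lift => x n.
rewrite -{2}(bas_sum x) (lin_bigsum (f := fun z => z *t n)); last by lin.
by apply: eq_bigr => i _; pull_scale (fun z => z *t n); pull_scale (fun z => bas i *t z).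
Qed.

Section From.
Variables (M : mod_data L) (X : hopf_bimod HH M).
Hypothesis e : forall (x : LT) (m : M), mact (x : L) m = smash_act X x m.
(** The hypothesis e is used for an action given by another formula, as on the tensor product and on the
    unit object, once that formula is identified with [smash_act]. *)
Lemma module_of_bimod : is_module M.
Proof.
case: (smash_act_bilin X) => h1 h2; split=> [|m|x y m]; rewrite ?e.
- by split=> [x|m] c u v; rewrite !e ?h1 -?h2.
- exact: smash_act1.
- by rewrite smash_amul smash_actM.
Qed.
Lemma mod_l_of_bimod a m : mod_l a m = lmul X a m. Proof. by rewrite /mod_l e smash_act_left. Qed.
Lemma mod_r_of_bimod a m : mod_r m a = rmul X m a. Proof. by rewrite /mod_r e smash_act_right. Qed.
Lemma mod_co_of_bimod m : mod_co M m = coact X m.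
Proof.
rewrite (mod_coE module_of_bimod) -coact_sum; apply: eq_bigr => i _.
by rewrite e smash_act_dual.
Qed.
End From.

Section Homs.
Variables (M N : vectType k) (X : hopf_bimod HH M) (Y : hopf_bimod HH N) (f : 'Hom(M, N)).
Hypotheses (fl : forall a m, f (lmul X a m) = lmul Y a (f m))
  (fr : forall a m, f (rmul X m a) = rmul Y (f m) a)
  (fc : forall m, coact Y (f m) = \sw_(x, n <- coact X m) (x *t f n)).
Lemma smash_act_hom x m : f (smash_act X x m) = smash_act Y x (f m).
Proof.
rewrite !smash_act_def lfun_lift; apply: eq_lift => a u.
rewrite lfun_lift; apply: eq_lift => p h; rewrite fl; congr (lmul _ _ _).
have -> : bim_adj Y h (f m) = f (bim_adj X h m).
  by rewrite /bim_adj lfun_lift; apply: eq_lift => h1 h2; rewrite fr fl.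
rewrite /dual_act /coact_by lfun_lift fc lift_lift; apply: eq_lift => y n.
by rewrite lift_tensor ?linearZ //; lin.
Qed.
End Homs.

Lemma modhom_co (M N : mod_data L) (f : 'Hom(M, N)) : is_module M -> is_module N ->
  is_modhom f -> forall m, mod_co N (f m) = \sw_(x, n <- mod_co M m) (x *t f n).
Proof.
move=> HM HN hf m; rewrite (mod_coE HM) (mod_coE HN).
rewrite (lin_bigsum (f := fun z : tens H M => \sw_(x, n <- z) (x *t f n))); last by lin.
by apply: eq_bigr => i _; rewrite lift_tensor ?hf //; lin.
Qed.
End Bim.

#[export] Hint Resolve mod_l_bilin mod_r_bilin mod_act_bilin : bil.

(** * Linear maps out of quotients *)

Section Quo.
Variables (k : fieldType) (V : vectType k) (B : {vspace V}).
Lemma lin_quo_pi : lin (@quo_pi k V B). Proof. exact: quo_pi_linear. Qed.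
Lemma lin_quo_repr : lin (@quo_repr k V B). Proof. exact: linearP. Qed.
Lemma quo_fact (W : vectType k) (g : V -> W) t : lin g ->
  (forall v, v \in B -> g v = 0) -> g (quo_repr (quo_pi B t)) = g t.
Proof.
move=> lg gB; apply/eqP; rewrite -subr_eq0 -[- g t]scaleN1r -linZ // -linD // scaleN1r.
apply/eqP; apply: gB; rewrite -quo_pi_eq0.
by rewrite (linD lin_quo_pi) -scaleN1r (linZ _ _ lin_quo_pi) quo_reprK scaleN1r subrr.
Qed.
End Quo.
#[export] Hint Resolve lin_quo_pi lin_quo_repr : linear_fun.

(** * The tensor product over H *)

Section Tensor.
Variables (k : fieldType) (H : falgType k) (HH : hopf_structure H).
Local Notation D := (comul HH).
Local Notation eps := (counit HH).
Local Notation S := (antipode HH).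
Local Notation S' := ((antipode HH)^-1)%VF.
Local Notation Hd := 'Hom(H, k^o).
Local Notation L := (smash_double HH).
Local Notation LT := (tens H (tens Hd H)).
Local Notation R := (double_R HH).

Lemma ractE (M : mod_data L) (m : M) a : is_module M -> ract R m a = mod_r m a.
Proof.
move=> HM; have h1 := mod_act_bilin HM; have h2 := dbl_act_bilin HH.
pose A (r1 r2 : tens Hd H) : M := mact (dbl_act HH r2 a *t r1 : L) m.
have bA : bilin A by rewrite /A; lin.
rewrite -[LHS]/(lift A R) /mod_r /el_right /double_R (lin_bigsum (f := lift A)); last by lin.
rewrite (lin_bigsum (f := fun z => mact (z : L) m)); last by lin.
apply: eq_bigr => i _; rewrite lift_tensor // /A dbl_actE.
by congr (mact _ m); rewrite /adj_act comul1_sw ?mul1r ?antipode1 ?mulr1 //; lin.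
Qed.

Section MN.
Variables (M N : mod_data L) (HM : is_module M) (HN : is_module N).
Local Notation B := (bal_rel R M N).
Local Notation T := (quo B).
Definition tprod (m : M) (n : N) : T := quo_pi B (m *t n).
Lemma tprod_bilin : bilin tprod. Proof. by rewrite /tprod; lin. Qed.
Hint Resolve tprod_bilin : bil.
(** The relations are imposed on basis vectors only, and the others follow by trilinearity. *)
Lemma bal_rel_mem m a n : mod_r m a *t n - m *t mod_l a n \in B.
Proof.
have b1 := mod_r_bilin HM; have b2 := mod_l_bilin HN.
pose d m a n : tens M N := mod_r m a *t n - m *t mod_l a n.
have d1 a' n' : lin (fun m => d m a' n') by rewrite /d; lin.
have d2 m' n' : lin (fun a => d m' a n') by rewrite /d; lin.
have d3 m' a' : lin (d m' a') by rewrite /d; lin.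
rewrite -/(d m a n) -(bas_sum m) (lin_bigsum _ (d1 _ _)); apply: memv_suml => i _.
rewrite (linZ _ _ (d1 _ _)); apply: memvZ.
rewrite -(bas_sum a) (lin_bigsum _ (d2 _ _)); apply: memv_suml => j _.
rewrite (linZ _ _ (d2 _ _)); apply: memvZ.
rewrite -(bas_sum n) (lin_bigsum _ (d3 _ _)); apply: memv_suml => l _.
rewrite (linZ _ _ (d3 _ _)); apply: memvZ.
rewrite memvE /bal_rel (sumv_sup i) // (sumv_sup j) // (sumv_sup l) //.
by rewrite -memvE ractE // memv_line.
Qed.
Lemma tprod_bal m a n : tprod (mod_r m a) n = tprod m (mod_l a n).
Proof.
apply/eqP; rewrite -subr_eq0 /tprod -scaleN1r -(linZ _ _ (@lin_quo_pi _ _ _)).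
by rewrite -(linD (@lin_quo_pi _ _ _)) scaleN1r quo_pi_eq0 bal_rel_mem.
Qed.
(** The universal property of the tensor product over H. *)
Lemma lift_tprod (W : vectType k) (g : M -> N -> W) m n : bilin g ->
  (forall m a n, g (mod_r m a) n = g m (mod_l a n)) ->
  lift g (quo_repr (tprod m n)) = g m n.
Proof.
move=> bg e; rewrite -[RHS](lift_tensor _ _ bg) /tprod.
have lg : lin (lift g) by lin.
apply: (quo_fact (g := lift g)) => // v.
pose G := linfun (lift g); have GE x : G x = lift g x by rewrite /G linfunE.
rewrite -GE => vB; apply/eqP; rewrite -memv_ker; move: v vB; apply/subvP.
apply/subv_sumP => i _; apply/subv_sumP => j _; apply/subv_sumP => l _.
rewrite -memvE memv_ker GE ractE // -scaleN1r linD // linZ // !lift_tensor //.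
by rewrite e scaleN1r subrr.
Qed.
Lemma smod_ext (W : lmodType k) (f g : T -> W) : lin f -> lin g ->
  (forall m n, f (tprod m n) = g (tprod m n)) -> f =1 g.
Proof.
move=> lf lg e x; rewrite -(quo_reprK x).
by apply: (@tens_ext _ _ _ _ (fun z => f (quo_pi B z)) (fun z => g (quo_pi B z))) => //; lin.
Qed.

Definition smod_l (a : H) (t : T) : T := \sw_(m, n <- quo_repr t) tprod (mod_l a m) n.
Definition smod_r (t : T) (a : H) : T := \sw_(m, n <- quo_repr t) tprod m (mod_r n a).
Definition smod_co : 'Hom(T, tens H T) := linfun (fun t : T => \sw_(m, n <- quo_repr t)
  \sw_(x, m0 <- mod_co M m) \sw_(y, n0 <- mod_co N n) ((x * y) *t tprod m0 n0)).
Local Notation X := (mod_bimod HM).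
Local Notation Y := (mod_bimod HN).
Lemma smod_l_bilin : bilin smod_l. Proof. by rewrite /smod_l; lin. Qed.
Lemma smod_r_bilin : bilin smod_r. Proof. by rewrite /smod_r; lin. Qed.
Lemma smod_lE a m n : smod_l a (tprod m n) = tprod (mod_l a m) n.
Proof.
rewrite /smod_l (lift_tprod (g := fun m n => tprod (mod_l a m) n)) //; first by lin.
by move=> m' b n'; rewrite -tprod_bal (mod_lrA HM).
Qed.
Lemma smod_rE a m n : smod_r (tprod m n) a = tprod m (mod_r n a).
Proof.
rewrite /smod_r (lift_tprod (g := fun m n => tprod m (mod_r n a))) //; first by lin.
by move=> m' b n'; rewrite tprod_bal -(mod_lrA HN).
Qed.
Lemma smod_coE m n : smod_co (tprod m n) =
  \sw_(x, m0 <- mod_co M m) \sw_(y, n0 <- mod_co N n) ((x * y) *t tprod m0 n0).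
Proof.
rewrite /smod_co linfunE; last by lin.
rewrite (lift_tprod (g := fun m n => \sw_(x, m0 <- mod_co M m) \sw_(y, n0 <- mod_co N n)
   ((x * y) *t tprod m0 n0))) //; first by lin.
move=> m' b n'; rewrite (coact_rmul_sw X); last by lin.
rewrite [LHS]lift_exch; apply: eq_lift => x m0.
rewrite (coact_lmul_sw Y); last by lin.
by apply: eq_lift => b1 b2; apply: eq_lift => y n0; rewrite mulrA tprod_bal.
Qed.
Ltac smod_ext_tac F G := apply: (@smod_ext _ F G); [by have ? := smod_l_bilin; have ? := smod_r_bilin; lin
  |by have ? := smod_l_bilin; have ? := smod_r_bilin; lin|cbv beta].

Lemma smod_l1 t : smod_l 1 t = t.
Proof. by smod_ext_tac (smod_l 1) (fun t : T => t) => m n; rewrite smod_lE (mod_l1 HM). Qed.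
Lemma smod_lM a b t : smod_l (a * b) t = smod_l a (smod_l b t).
Proof. by smod_ext_tac (smod_l (a * b)) (fun t : T => smod_l a (smod_l b t)) => m n; rewrite !smod_lE (mod_lM HM). Qed.
Lemma smod_r1 t : smod_r t 1 = t.
Proof. by smod_ext_tac (smod_r^~ 1) (fun t : T => t) => m n; rewrite smod_rE (mod_r1 HN). Qed.
Lemma smod_rM a b t : smod_r t (a * b) = smod_r (smod_r t a) b.
Proof. by smod_ext_tac (fun t : T => smod_r t (a * b)) (fun t : T => smod_r (smod_r t a) b) => m n; rewrite !smod_rE (mod_rM HN). Qed.
Lemma smod_lrA a b t : smod_l a (smod_r t b) = smod_r (smod_l a t) b.
Proof.
by smod_ext_tac (fun t : T => smod_l a (smod_r t b)) (fun t : T => smod_r (smod_l a t) b) => m n; rewrite smod_rE !smod_lE smod_rE.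
Qed.
Lemma smod_co_counit t : \sw_(x, n <- smod_co t) (eps x *: n) = t.
Proof.
smod_ext_tac (fun t : T => \sw_(x, n <- smod_co t) (eps x *: n)) (fun t : T => t) => m n.
rewrite smod_coE lift_lift; under eq_lift => x m0 do rewrite lift_lift.
under eq_lift => x m0 do under eq_lift => y n0 do
  ((rewrite lift_tensor ?counitM; last by lin); rewrite -scalerA).
under eq_lift => x m0 do under eq_lift => y n0 do (rewrite -(linZ (f := tprod m0)); last by lin).
under eq_lift => x m0 do rewrite -scale_lift.
under eq_lift => x m0 do (rewrite -(lin_of_lift (F := tprod m0)); last by lin).
under eq_lift => x m0 do rewrite (coact_counit Y n).
by rewrite (coact_counit_sw X m (f := fun m => tprod m n)) //; lin.
Qed.
Lemma smod_coA t : \sw_(x, n <- smod_co t) \sw_(y, n' <- smod_co n) (x *t (y *t n')) =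
  \sw_(x, n <- smod_co t) \sw_(x1, x2 <- D x) (x1 *t (x2 *t n)).
Proof.
smod_ext_tac (fun t : T => \sw_(x, n <- smod_co t) \sw_(y, n' <- smod_co n) (x *t (y *t n')))
  (fun t : T => \sw_(x, n <- smod_co t) \sw_(x1, x2 <- D x) (x1 *t (x2 *t n))) => m n.
rewrite smod_coE.
transitivity (\sw_(x, m0 <- mod_co M m) \sw_(x', m1 <- mod_co M m0) \sw_(y, n0 <- mod_co N n)
  \sw_(y', n1 <- mod_co N n0) ((x * y) *t ((x' * y') *t tprod m1 n1))).
  rewrite lift_lift; apply: eq_lift => x m0; rewrite lift_lift [RHS]lift_exch.
  apply: eq_lift => y n0; rewrite lift_tensor; last by lin.
  rewrite smod_coE lift_lift; apply: eq_lift => x' m1; rewrite lift_lift; apply: eq_lift => y' n1.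
  by rewrite lift_tensor //; lin.
rewrite (@coactA_sw _ _ _ _ X _ m (fun x x' m1 => \sw_(y, n0 <- mod_co N n) \sw_(y', n1 <- mod_co N n0)
   ((x * y) *t ((x' * y') *t tprod m1 n1)))); last by solve_lin.
rewrite lift_lift; apply: eq_lift => x m0; rewrite lift_lift.
under eq_lift => x1 x2 do (rewrite (@coactA_sw _ _ _ _ Y _ n (fun y y' n1 =>
   ((x1 * y) *t ((x2 * y') *t tprod m0 n1)))); last by solve_lin).
rewrite [LHS]lift_exch; apply: eq_lift => y n0.
rewrite lift_tensor; last by lin.
by rewrite comulM_sw //; lin.
Qed.
Lemma smod_co_l a t : smod_co (smod_l a t) =
  \sw_(a1, a2 <- D a) \sw_(x, n <- smod_co t) ((a1 * x) *t smod_l a2 n).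
Proof.
have b1 := smod_l_bilin.
smod_ext_tac (fun t : T => smod_co (smod_l a t))
   (fun t : T => \sw_(a1, a2 <- D a) \sw_(x, n <- smod_co t) ((a1 * x) *t smod_l a2 n)) => m n.
rewrite smod_lE !smod_coE (coact_lmul_sw X); last by lin.
apply: eq_lift => a1 a2; rewrite lift_lift; apply: eq_lift => x m0.
rewrite lift_lift; apply: eq_lift => y n0.
by rewrite lift_tensor ?smod_lE ?mulrA //; lin.
Qed.
Lemma smod_co_r a t : smod_co (smod_r t a) =
  \sw_(a1, a2 <- D a) \sw_(x, n <- smod_co t) ((x * a1) *t smod_r n a2).
Proof.
have b1 := smod_r_bilin.
smod_ext_tac (fun t : T => smod_co (smod_r t a))
   (fun t : T => \sw_(a1, a2 <- D a) \sw_(x, n <- smod_co t) ((x * a1) *t smod_r n a2)) => m n.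
rewrite smod_rE !smod_coE.
under eq_lift => x m0 do (rewrite (coact_rmul_sw Y); last by lin).
rewrite [LHS]lift_exch; apply: eq_lift => a1 a2; rewrite lift_lift; apply: eq_lift => x m0.
rewrite lift_lift; apply: eq_lift => y n0.
by rewrite lift_tensor ?smod_rE ?mulrA //; lin.
Qed.
Definition smod_bimod : hopf_bimod HH T :=
  @HopfBimod _ _ _ _ smod_l smod_r smod_co smod_l_bilin smod_r_bilin smod_l1 smod_lM smod_r1 smod_rM smod_lrA
    smod_co_counit smod_coA smod_co_l smod_co_r.

(** Between the two tensor factors, S(h_2) on the right of m and h_3 on the left of n meet and cancel. *)
Lemma bim_adj_tprod h m n : bim_adj smod_bimod h (tprod m n) = \sw_(h1, h2 <- D h) tprod (bim_adj X h1 m) (bim_adj Y h2 n).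
Proof.
rewrite /bim_adj; transitivity (\sw_(h1, h2 <- D h) tprod (mod_l h1 m) (mod_r n (S h2))).
  by apply: eq_lift => h1 h2; rewrite [lmul smod_bimod _ _]smod_lE [rmul smod_bimod _ _]smod_rE.
symmetry; transitivity (\sw_(h1, r <- D h) \sw_(h2, s <- D r) \sw_(h3, h4 <- D s)
   tprod (mod_l h1 m) (mod_r (mod_l (S h2 * h3) n) (S h4))).
  transitivity (\sw_(a, b <- D h) \sw_(h1, h2 <- D a) \sw_(h3, h4 <- D b)
     tprod (mod_l h1 m) (mod_r (mod_l (S h2 * h3) n) (S h4))); last by (rewrite comulA_sw //; solve_lin).
  apply: eq_lift => a b; pull_sw (fun z => tprod z (\sw_(h0, h2 <- D b) rmul Y (lmul Y h0 n) (S h2))).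
  apply: eq_lift => h1 h2; pull_sw (tprod (rmul X (lmul X h1 m) (S h2))).
  apply: eq_lift => h3 h4; rewrite tprod_bal; congr (tprod _ _).
  by rewrite mod_lM // mod_lrA.
under eq_lift => h1 r do sw_rewrite (@antipode_l_head _ _ HH _ r (fun z h4 => tprod (mod_l h1 m) (mod_r (mod_l z n) (S h4)))).
by apply: eq_lift => h1 h2; rewrite mod_l1.
Qed.
(** S^-1 reverses the product m_{-1} n_{-1} of the coaction, which matches the opposite coproduct of H^* in
    the double. *)
Lemma dual_act_tprod p m n : dual_act smod_bimod p (tprod m n) =
  lift (fun p1 p2 : Hd => tprod (dual_act X p2 m) (dual_act Y p1 n)) (dual_comul p).
Proof.
rewrite dual_actE [coact smod_bimod _]smod_coE lift_lift; symmetry.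
transitivity (\sw_(x, m0 <- mod_co M m) \sw_(y, n0 <- mod_co N n) lift (fun p1 p2 : Hd =>
  ((p1 (S' y) : k) *: ((p2 (S' x) : k) *: tprod m0 n0))) (dual_comul p)).
  symmetry; under eq_lift => x m0 do rewrite lift_exch.
  rewrite [LHS]lift_exch; apply: eq_lift => p1 p2; rewrite !dual_actE.
  pull_sw (fun z => tprod z (\sw_(x, n0 <- coact Y n) p1 (S' x) *: n0)).
  apply: eq_lift => x m0; pull_sw (tprod (p2 (S' x) *: m0)).
  apply: eq_lift => y n0; pull_scale (tprod (p2 (S' x) *: m0)).
  by pull_scale (fun z => tprod z n0).
apply: eq_lift => x m0; rewrite lift_lift; apply: eq_lift => y n0.
by rewrite dual_comulE lift_tensor ?antipodeVM //; lin.
Qed.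
(** The action (a # h_1) m (x) (1 # h_2) n of the monoidal structure is the one of the Hopf bimodule
    just constructed: this is the tensor product in the dictionary. *)
Lemma smod_act (x : LT) (t : T) :
  mact (m := smod_tens R M N) (x : L) t = smash_act smod_bimod x t.
Proof.
pose G (x : LT) m n : T := \sw_(a, h <- x) \sw_(h1, h2 <- dbl_comul HH h)
   tprod (mact (a *t h1 : L) m) (mact (1 *t h2 : L) n).
have aM := mod_act_bilin HM; have aN := mod_act_bilin HN; have lD := lin_dbl_comul HH.
have GE m n : G x m n = smash_act smod_bimod x (tprod m n).
  apply: (@tens_ext _ _ _ _ (fun x => G x m n) (fun x => smash_act smod_bimod x (tprod m n))); [by rewrite /G; lin|by lin|move=> a u].
  apply: (@tens_ext _ _ _ _ (fun u => G (a *t u) m n) (fun u => smash_act smod_bimod (a *t u) (tprod m n))); [by rewrite /G; lin|by lin|move=> p h].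
  rewrite smash_actE /G lift_tensor; last by lin.
  rewrite dbl_comulE bim_adj_tprod; pull_sw (fun z => lmul smod_bimod a (dual_act smod_bimod p z)).
  rewrite lift_lift; under eq_lift => p1 p2 do (rewrite lift_lift;
    under eq_lift => h1 h2 do (rewrite lift_tensor; last by lin)).
  rewrite [LHS]lift_exch; apply: eq_lift => h1 h2.
  rewrite dual_act_tprod; pull_sw (lmul smod_bimod a); apply: eq_lift => p1 p2.
  rewrite [lmul smod_bimod _ _]smod_lE (mod_act_bimod HM) (mod_act_bimod HN) !smash_actE lmul1.
  by [].
transitivity (\sw_(m, n <- quo_repr t) smash_act smod_bimod x (tprod m n)); last first.
  transitivity (smash_act smod_bimod x (quo_pi B (quo_repr t))); last by rewrite quo_reprK.
  rewrite -{2}(lift_id (quo_repr t)).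
  by pull_sw (fun z => smash_act smod_bimod x (quo_pi B z)).
under [RHS]eq_lift => m n do rewrite -GE.
rewrite /G [RHS]lift_exch; apply: eq_lift => a h.
by rewrite [RHS]lift_exch.
Qed.
Lemma smod_module : is_module (smod_tens R M N : mod_data L).
Proof. exact: (@module_of_bimod _ _ HH (smod_tens R M N) smod_bimod smod_act). Qed.
Lemma mod_l_smod a (t : smod_tens R M N) : mod_l a t = smod_l a t.
Proof. exact: (@mod_l_of_bimod _ _ HH (smod_tens R M N) smod_bimod smod_act). Qed.
Lemma mod_r_smod a (t : smod_tens R M N) : mod_r t a = smod_r t a.
Proof. exact: (@mod_r_of_bimod _ _ HH (smod_tens R M N) smod_bimod smod_act). Qed.
Lemma mod_co_smod (t : smod_tens R M N) : mod_co (smod_tens R M N) t = smod_co t.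
Proof. exact: (@mod_co_of_bimod _ _ HH (smod_tens R M N) smod_bimod smod_act). Qed.
End MN.
End Tensor.

#[export] Hint Resolve tprod_bilin : bil.

(** * Categories of modules with an arbitrary tensor product *)

Section ModCat.
Variables (k : fieldType) (L : alg_data k).
Variables (tob : mod_data L -> mod_data L -> mod_data L)
  (tmor : forall X X' Y Y' : mod_data L, 'Hom(X, X') -> 'Hom(Y, Y') -> 'Hom(tob X Y, tob X' Y'))
  (uob : mod_data L)
  (assoc : forall X Y Z, 'Hom(tob (tob X Y) Z, tob X (tob Y Z)))
  (lunit : forall X, 'Hom(tob uob X, X)) (runit : forall X, 'Hom(tob X uob, X)).
(** Both categories of the theorem are instances, by conversion; linearity and the criterion for isomorphisms
    only depend on the modules. *)
Definition modcat : premonoidal k :=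
  @Premonoidal k (mod_data L) (@is_module k L)
    (fun M N => 'Hom(M, N)) (@is_modhom k L)
    (fun M => \1%VF) (fun _ _ _ g f => (g \o f)%VF)
    tob tmor uob assoc lunit runit.
Lemma modcat_lin : is_lin_category modcat.
Proof.
split=> /=.
- move=> X Y a f g [hX hY hf] [_ _ hg]; split=> // x m.
  rewrite !add_lfunE !scale_lfunE hf hg.
  by case: (mact_bilin hY) => /(_ x) -> _.
- move=> X Y hX hY; split=> // x m; rewrite !zero_lfunE.
  by case: (mact_bilin hY) => h _; rewrite (lin0 (h x)).
- by move=> X hX; split=> // x m; rewrite !id_lfunE.
- move=> X Y Z g f [hY hZ hg] [hX _ hf]; split=> // x m.
  by rewrite !comp_lfunE hf hg.
- by move=> X Y Z T h g f *; rewrite comp_lfunA.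
- by move=> *; rewrite comp_lfun1l.
- by move=> *; rewrite comp_lfun1r.
- by move=> X Y Z a g g' f *; rewrite comp_lfunDl comp_lfunZl.
- by move=> X Y Z a g f f' *; rewrite comp_lfunDr comp_lfunZr.
Qed.
Lemma modcat_isom (X Y : mod_data L) (f : 'Hom(X, Y)) (g : 'Hom(Y, X)) :
  is_module X -> is_module Y -> is_modhom f -> cancel f g -> cancel g f ->
  @isom k modcat X Y f.
Proof.
move=> hX hY hf fg gf; split; first by split.
exists g; split=> /=; last 2 first.
- by apply/lfunP => x; rewrite comp_lfunE fg id_lfunE.
- by apply/lfunP => x; rewrite comp_lfunE gf id_lfunE.
by split=> // x m; rewrite -{1}(gf m) -hf fg.
Qed.
End ModCat.

(** * Unitors and associator over H *)

Section Monoidal.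
Variables (k : fieldType) (H : falgType k) (HH : hopf_structure H).
Local Notation D := (comul HH).
Local Notation Hd := 'Hom(H, k^o).
Local Notation L := (smash_double HH).
Local Notation LT := (tens H (tens Hd H)).
Local Notation R := (double_R HH).
Implicit Types M N P : mod_data L.

Lemma modhom_l M N (f : 'Hom(M, N)) a m : is_modhom f -> f (mod_l a m) = mod_l a (f m).
Proof. by move=> hf; rewrite /mod_l hf. Qed.
Lemma modhom_r M N (f : 'Hom(M, N)) a m : is_modhom f -> f (mod_r m a) = mod_r (f m) a.
Proof. by move=> hf; rewrite /mod_r hf. Qed.
(** The bimodule operations and the coaction suffice because they determine the action ([mod_act_bimod]). *)
Lemma modhom_of M N (f : 'Hom(M, N)) : is_module M -> is_module N ->
  (forall a m, f (mod_l a m) = mod_l a (f m)) -> (forall a m, f (mod_r m a) = mod_r (f m) a) ->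
  (forall m, mod_co N (f m) = \sw_(x, n <- mod_co M m) (x *t f n)) -> is_modhom f.
Proof.
move=> HM HN fl fr fc x m; rewrite (mod_act_bimod HM) (mod_act_bimod HN).
exact: (@smash_act_hom _ _ _ _ _ (mod_bimod HM) (mod_bimod HN)).
Qed.

Local Notation U := (smod_unit (@double_act k H HH)).
Definition unit_bimod : hopf_bimod HH H.
Proof.
apply: (@HopfBimod _ _ _ _ (fun a b : H => a * b) (fun b a : H => b * a) D) => *.
- exact: mul_bilin.
- exact: mul_bilin.
- exact: mul1r.
- by rewrite mulrA.
- exact: mulr1.
- by rewrite mulrA.
- by rewrite mulrA.
- exact: counit_comull.
- by rewrite comulA.
- exact: comulM.
- by rewrite comulM lift_exch.
Defined.
Lemma unit_act (x : LT) (b : H) : mact (m := U) x b = smash_act unit_bimod x b.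
Proof.
have b1 := dbl_act_bilin HH.
apply: (@tens_ext _ _ _ _ (fun x : LT => \sw_(a, h <- x) (a * dbl_act HH h b)) (fun x => smash_act unit_bimod x b)); [by lin|by lin|move=> a u].
apply: (@tens_ext _ _ _ _ (fun u => \sw_(a, h <- a *t u) (a * dbl_act HH h b)) (fun u => smash_act unit_bimod (a *t u) b)); [by lin|by lin|move=> p h].
rewrite lift_tensor; last by lin.
by rewrite smash_actE dbl_actE.
Qed.
Lemma unit_module : is_module U.
Proof. exact: (@module_of_bimod _ _ HH U unit_bimod unit_act). Qed.
Lemma unit_l a (b : U) : mod_l a b = (a * b : H).
Proof. exact: (@mod_l_of_bimod _ _ HH U unit_bimod unit_act). Qed.
Lemma unit_r a (b : U) : mod_r b a = (b * a : H).
Proof. exact: (@mod_r_of_bimod _ _ HH U unit_bimod unit_act). Qed.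
Lemma unit_co (b : U) : mod_co U b = D (b : H).
Proof. exact: (@mod_co_of_bimod _ _ HH U unit_bimod unit_act). Qed.

Section Tmap.
Variables (M M' N N' : mod_data L) (f : 'Hom(M, M')) (g : 'Hom(N, N')).
Hypotheses (HM : is_module M) (HM' : is_module M') (HN : is_module N) (HN' : is_module N')
  (hf : is_modhom f) (hg : is_modhom g).
Lemma smod_tmapE m n : smod_tmap R f g (tprod m n) = tprod (f m) (g n).
Proof.
rewrite /smod_tmap linfunE; last by rewrite -/(tprod _ _); lin.
rewrite -/(tprod _ _) (lift_tprod HM (g := fun m n => tprod (f m) (g n))) //; first by lin.
by move=> m' a n'; rewrite modhom_r // modhom_l // tprod_bal.
Qed.
Lemma smod_tmap_hom : is_modhom (smod_tmap R f g).
Proof.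
have b1 := smod_l_bilin N HM; have b2 := smod_r_bilin M HN.
have b1' := smod_l_bilin N' HM'; have b2' := smod_r_bilin M' HN'.
apply: modhom_of; [exact: smod_module|exact: smod_module| | |].
- move=> a t; rewrite (mod_l_smod HM HN) (mod_l_smod HM' HN').
  apply: (@smod_ext _ _ _ _ _ _ (fun t => smod_tmap R f g (smod_l a t)) (fun t => smod_l a (smod_tmap R f g t))); [by lin|by lin|move=> m n].
  by rewrite smod_lE // !smod_tmapE smod_lE // modhom_l.
- move=> a t; rewrite (mod_r_smod HM HN) (mod_r_smod HM' HN').
  apply: (@smod_ext _ _ _ _ _ _ (fun t => smod_tmap R f g (smod_r t a)) (fun t => smod_r (smod_tmap R f g t) a)); [by lin|by lin|move=> m n].
  by rewrite smod_rE // !smod_tmapE smod_rE // modhom_r.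
move=> t; rewrite (mod_co_smod HM HN) (mod_co_smod HM' HN').
apply: (@smod_ext _ _ _ _ _ _ (fun t => smod_co M' N' (smod_tmap R f g t))
  (fun t => \sw_(x, n <- smod_co M N t) (x *t smod_tmap R f g n))); [by lin|by lin|move=> m n].
rewrite smod_tmapE !smod_coE // (modhom_co HM HM' hf) lift_lift [RHS]lift_lift.
apply: eq_lift => x m0; rewrite lift_tensor; last by lin.
rewrite (modhom_co HN HN' hg) lift_lift [RHS]lift_lift.
apply: eq_lift => y n0; rewrite !lift_tensor ?smod_tmapE //; by lin.
Qed.
End Tmap.

Lemma smod_lfun_ext M N (W : vectType k) (f g : 'Hom(smod_tens R M N, W)) :
  (forall m n, f (tprod m n) = g (tprod m n)) -> f = g.
Proof. by move=> e; apply/lfunP; apply: smod_ext => //; lin. Qed.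

Section Unitors.
Variables (M : mod_data L) (HM : is_module M).
Let HU := unit_module.
Lemma smod_lunitE (a : U) m : smod_lunit R M (tprod a m) = mod_l (a : H) m.
Proof.
have b1 := mod_l_bilin HM.
rewrite /smod_lunit linfunE; last first.
  by have b2 : bilin (fun (a : U) (m : M) => lact a m) := b1; lin.
rewrite (lift_tprod HU (g := fun (a : U) m => mod_l (a : H) m)) //.
by move=> c b m'; rewrite unit_r mod_lM.
Qed.
Lemma smod_runitE m (a : U) : smod_runit R M (tprod m a) = mod_r m (a : H).
Proof.
pose g (m : M) (a : U) : M := ract R m a.
have gE m' a' : g m' a' = mod_r m' (a' : H) by rewrite /g ractE.
have bg : bilin g.
  case: (mod_r_bilin HM) => h1 h2; split=> [x|y] c u v; rewrite !gE ?h1 //.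
  by rewrite -h2.
rewrite /smod_runit linfunE; last by rewrite -/g; lin.
rewrite -/g (lift_tprod HM _ _ bg) ?gE // => m' b c.
by rewrite !gE unit_l mod_rM.
Qed.
Lemma smod_lunit_isom : is_modhom (smod_lunit R M) /\
  exists g : 'Hom(M, smod_tens R U M), cancel (smod_lunit R M) g /\ cancel g (smod_lunit R M).
Proof.
have b1 := mod_l_bilin HM; have b2 := smod_l_bilin M HU; have b3 := smod_r_bilin U HM; split.
  apply: modhom_of => //; [exact: smod_module| | |].
  - move=> a t; rewrite (mod_l_smod HU HM).
    apply: (@smod_ext _ _ _ _ _ _ (fun t => smod_lunit R M (smod_l a t)) (fun t => mod_l a (smod_lunit R M t))); [by lin|by lin|move=> b m].
    by rewrite smod_lE // !smod_lunitE unit_l mod_lM.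
  - have b4 := mod_r_bilin HM.
    move=> a t; rewrite (mod_r_smod HU HM).
    apply: (@smod_ext _ _ _ _ _ _ (fun t => smod_lunit R M (smod_r t a)) (fun t => mod_r (smod_lunit R M t) a)); [by lin|by lin|move=> b m].
    by rewrite smod_rE // !smod_lunitE mod_lrA.
  move=> t; rewrite (mod_co_smod HU HM).
  apply: (@smod_ext _ _ _ _ _ _ (fun t => mod_co M (smod_lunit R M t))
    (fun t => \sw_(x, n <- smod_co U M t) (x *t smod_lunit R M n))); [by lin|by lin|move=> b m].
  rewrite smod_lunitE smod_coE // (mod_co_l HM) lift_lift unit_co; apply: eq_lift => b1' b2'.
  rewrite lift_lift; apply: eq_lift => x n.
  by rewrite lift_tensor ?smod_lunitE //; lin.
pose g := linfun (fun m : M => tprod (1 : U) m).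
have gE m : g m = tprod (1 : U) m by rewrite /g linfunE //; lin.
exists g; split=> [|m]; last by rewrite gE smod_lunitE mod_l1.
apply: smod_ext; [by lin|by lin|move=> a m].
by rewrite smod_lunitE gE -(tprod_bal HU HM) unit_r mul1r.
Qed.
Lemma smod_runit_isom : is_modhom (smod_runit R M) /\
  exists g : 'Hom(M, smod_tens R M U), cancel (smod_runit R M) g /\ cancel g (smod_runit R M).
Proof.
have b1 := mod_l_bilin HM; have b2 := smod_l_bilin U HM; have b3 := smod_r_bilin M HU.
have b4 := mod_r_bilin HM; split.
  apply: modhom_of => //; [exact: smod_module| | |].
  - move=> a t; rewrite (mod_l_smod HM HU).
    apply: (@smod_ext _ _ _ _ _ _ (fun t => smod_runit R M (smod_l a t)) (fun t => mod_l a (smod_runit R M t))); [by lin|by lin|move=> m b].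
    by rewrite smod_lE // !smod_runitE mod_lrA.
  - move=> a t; rewrite (mod_r_smod HM HU).
    apply: (@smod_ext _ _ _ _ _ _ (fun t => smod_runit R M (smod_r t a)) (fun t => mod_r (smod_runit R M t) a)); [by lin|by lin|move=> m b].
    by rewrite smod_rE // !smod_runitE unit_r mod_rM.
  move=> t; rewrite (mod_co_smod HM HU).
  apply: (@smod_ext _ _ _ _ _ _ (fun t => mod_co M (smod_runit R M t))
    (fun t => \sw_(x, n <- smod_co M U t) (x *t smod_runit R M n))); [by lin|by lin|move=> m b].
  rewrite smod_runitE smod_coE // (mod_co_r HM) lift_exch lift_lift; apply: eq_lift => x n.
  rewrite lift_lift unit_co; apply: eq_lift => b1' b2'.
  by rewrite lift_tensor ?smod_runitE //; lin.
pose g := linfun (fun m : M => tprod m (1 : U)).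
have gE m : g m = tprod m (1 : U) by rewrite /g linfunE //; lin.
exists g; split=> [|m]; last by rewrite gE smod_runitE mod_r1.
apply: smod_ext; [by lin|by lin|move=> m a].
by rewrite smod_runitE gE (tprod_bal HM HU) unit_l mulr1.
Qed.
End Unitors.

Section Assoc.
Variables (M N P : mod_data L) (HM : is_module M) (HN : is_module N) (HP : is_module P).
Let HMN := smod_module HM HN.
Let HNP := smod_module HN HP.
(** The associator is well defined because (m a) (x) (n (x) p) = m (x) (a n (x) p), and (m (x) n) b (x) p = (m (x) n) (x) b p. *)
Lemma smod_assocE m n p : smod_assoc R M N P (tprod (tprod m n : smod_tens R M N) p) = tprod m (tprod n p : smod_tens R N P).
Proof.
pose g (p : P) (m : M) (n : N) := tprod m (tprod n p : smod_tens R N P).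
have g_bal p' m' a n' : g p' (mod_r m' a) n' = g p' m' (mod_l a n').
  by rewrite /g (tprod_bal HM HNP) (mod_l_smod HN HP) smod_lE.
have bg p' : bilin (g p') by rewrite /g; lin.
have lg m' n' : lin (fun p => g p m' n') by rewrite /g; lin.
pose F (s : smod_tens R M N) p := lift (g p) (quo_repr s).
have FE m' n' p' : F (tprod m' n') p' = g p' m' n' by rewrite /F (lift_tprod HM _ _ (bg p')).
have bF : bilin F by rewrite /F; lin.
rewrite /smod_assoc linfunE; last by rewrite -/F; lin.
rewrite -[LHS]/(lift F (quo_repr (tprod (tprod m n : smod_tens R M N) p))).
rewrite (lift_tprod HMN _ _ bF) ?FE // => s a p'.
rewrite (mod_r_smod HM HN).
have b2 := smod_r_bilin M HN; have b3 := mod_l_bilin HP.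
apply: (@smod_ext _ _ _ _ _ _ (fun s => F (smod_r s a) p') (fun s => F s (mod_l a p'))); [by lin|by lin|move=> m' n'].
by rewrite smod_rE // !FE /g tprod_bal.
Qed.
Definition smod_unassoc : 'Hom(smod_tens R M (smod_tens R N P), smod_tens R (smod_tens R M N) P) :=
  linfun (fun t : quo (bal_rel R M (smod_tens R N P)) =>
    \sw_(m, s <- quo_repr t) \sw_(n, p <- quo_repr (s : quo (bal_rel R N P)))
      tprod (tprod m n : smod_tens R M N) p).
Lemma smod_unassocE m n p : smod_unassoc (tprod m (tprod n p : smod_tens R N P)) = tprod (tprod m n : smod_tens R M N) p.
Proof.
pose g (m : M) (n : N) (p : P) := tprod (tprod m n : smod_tens R M N) p.
have g_bal p' m' a n' : g m' (mod_r n' a) p' = g m' n' (mod_l a p').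
  by rewrite /g -(tprod_bal HMN HP) (mod_r_smod HM HN) smod_rE.
have bg m' : bilin (g m') by rewrite /g; lin.
have lg p' n' : lin (fun m => g m n' p') by rewrite /g; lin.
pose F m (s : smod_tens R N P) := lift (g m) (quo_repr s).
have FE m' n' p' : F m' (tprod n' p') = g m' n' p' by rewrite /F (lift_tprod HN _ _ (bg m')).
have bF : bilin F by rewrite /F; lin.
rewrite /smod_unassoc linfunE; last by rewrite -/F; lin.
rewrite -[LHS]/(lift F (quo_repr (tprod m (tprod n p : smod_tens R N P)))).
rewrite (lift_tprod HM _ _ bF) ?FE // => m' a s.
rewrite (mod_l_smod HN HP).
have b2 := smod_l_bilin P HN; have b3 := mod_r_bilin HM.
apply: (@smod_ext _ _ _ _ _ _ (fun s => F (mod_r m' a) s) (fun s => F m' (smod_l a s))); [by lin|by lin|move=> n' p'].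
by rewrite smod_lE // !FE /g (tprod_bal HM HN).
Qed.
Lemma smod_ext3 (W : lmodType k) (f g : smod_tens R (smod_tens R M N) P -> W) : lin f -> lin g ->
  (forall m n p, f (tprod (tprod m n : smod_tens R M N) p) = g (tprod (tprod m n : smod_tens R M N) p)) -> f =1 g.
Proof.
move=> lf lg e; apply: smod_ext => // s p.
apply: (@smod_ext _ _ _ M N _ (fun s => f (tprod (s : smod_tens R M N) p)) (fun s => g (tprod (s : smod_tens R M N) p)));
  [by lin|by lin|by move=> m n].
Qed.
Lemma smod_ext3r (W : lmodType k) (f g : smod_tens R M (smod_tens R N P) -> W) : lin f -> lin g ->
  (forall m n p, f (tprod m (tprod n p : smod_tens R N P)) = g (tprod m (tprod n p : smod_tens R N P))) -> f =1 g.
Proof.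
move=> lf lg e; apply: smod_ext => // m s.
apply: (@smod_ext _ _ _ N P _ (fun s => f (tprod m (s : smod_tens R N P))) (fun s => g (tprod m (s : smod_tens R N P))));
  [by lin|by lin|by move=> n p].
Qed.
Lemma smod_assocK : cancel (smod_assoc R M N P) smod_unassoc.
Proof. by apply: smod_ext3; [by lin|by lin|move=> m n p]; rewrite smod_assocE smod_unassocE. Qed.
Lemma smod_unassocK : cancel smod_unassoc (smod_assoc R M N P).
Proof. by apply: smod_ext3r; [by lin|by lin|move=> m n p]; rewrite smod_unassocE smod_assocE. Qed.
Lemma smod_assoc_hom : is_modhom (smod_assoc R M N P).
Proof.
have b1 := smod_l_bilin N HM; have b2 := smod_r_bilin M HN.
have b3 := smod_l_bilin P HN; have b4 := smod_r_bilin N HP.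
have b5 := smod_l_bilin P HMN; have b6 := smod_r_bilin (smod_tens R M N) HP.
have b7 := smod_l_bilin (smod_tens R N P) HM; have b8 := smod_r_bilin M HNP.
apply: modhom_of; [exact: smod_module|exact: smod_module| | |].
- move=> a t; rewrite (mod_l_smod HMN HP) (mod_l_smod HM HNP).
  apply: (@smod_ext3 _ (fun t => smod_assoc R M N P (smod_l a t)) (fun t => smod_l a (smod_assoc R M N P t))); [by lin|by lin|move=> m n p].
  by rewrite (smod_lE HMN HP) (mod_l_smod HM HN) (smod_lE HM HN) !smod_assocE (smod_lE HM HNP).
- move=> a t; rewrite (mod_r_smod HMN HP) (mod_r_smod HM HNP).
  apply: (@smod_ext3 _ (fun t => smod_assoc R M N P (smod_r t a)) (fun t => smod_r (smod_assoc R M N P t) a)); [by lin|by lin|move=> m n p].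
  by rewrite (smod_rE HMN HP) !smod_assocE (smod_rE HM HNP) (mod_r_smod HN HP) (smod_rE HN HP).
move=> t; rewrite (mod_co_smod HMN HP) (mod_co_smod HM HNP).
apply: (@smod_ext3 _ (fun t => smod_co M (smod_tens R N P) (smod_assoc R M N P t))
    (fun t => \sw_(x, n <- smod_co (smod_tens R M N) P t) (x *t smod_assoc R M N P n))); [by lin|by lin|move=> m n p].
rewrite smod_assocE (smod_coE HM HNP) (smod_coE HMN HP) (mod_co_smod HM HN) (mod_co_smod HN HP) (smod_coE HM HN) (smod_coE HN HP).
rewrite lift_lift [RHS]lift_lift; apply: eq_lift => x m0.
rewrite lift_lift [RHS]lift_lift; apply: eq_lift => y n0.
rewrite lift_tensor; last by lin.
rewrite lift_lift [RHS]lift_lift; apply: eq_lift => z p0.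
by rewrite !lift_tensor ?smod_assocE ?mulrA //; lin.
Qed.
End Assoc.
End Monoidal.

(** * The monoidal category of H # D(H)-modules *)

Section SmashMon.
Variables (k : fieldType) (H : falgType k) (HH : hopf_structure H).
Local Notation L := (smash_double HH).
Local Notation R := (double_R HH).
Local Notation C := (smash_modules (@double_act k H HH) R).
Local Notation U := (smod_unit (@double_act k H HH)).

Lemma smash_lin : is_lin_category C.
Proof. exact: modcat_lin. Qed.

Lemma smod_tmap_linl (M M' N N' : mod_data L) (f f' : 'Hom(M, M')) (g : 'Hom(N, N')) a :
  is_module M -> is_module M' -> is_module N -> is_module N' ->
  is_modhom f -> is_modhom f' -> is_modhom g ->
  smod_tmap R (a *: f + f') g = a *: smod_tmap R f g + smod_tmap R f' g.
Proof.
move=> HM HM' HN HN' hf hf' hg; apply: smod_lfun_ext => m n.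
rewrite add_lfunE scale_lfunE !smod_tmapE // ?add_lfunE ?scale_lfunE.
  by case: (@tprod_bilin _ _ HH M' N') => _ ->.
by move=> x m'; rewrite !add_lfunE !scale_lfunE hf hf'; case: (mod_act_bilin HM') => ->.
Qed.
Lemma smod_tmap_linr (M M' N N' : mod_data L) (f : 'Hom(M, M')) (g g' : 'Hom(N, N')) a :
  is_module M -> is_module M' -> is_module N -> is_module N' ->
  is_modhom f -> is_modhom g -> is_modhom g' ->
  smod_tmap R f (a *: g + g') = a *: smod_tmap R f g + smod_tmap R f g'.
Proof.
move=> HM HM' HN HN' hf hg hg'; apply: smod_lfun_ext => m n.
rewrite add_lfunE scale_lfunE !smod_tmapE // ?add_lfunE ?scale_lfunE.
  by case: (@tprod_bilin _ _ HH M' N') => ->.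
by move=> x m'; rewrite !add_lfunE !scale_lfunE hg hg'; case: (mod_act_bilin HN') => ->.
Qed.
Lemma smod_tmap_id (M N : mod_data L) : is_module M -> is_module N ->
  smod_tmap R (\1%VF : 'Hom(M, M)) (\1%VF : 'Hom(N, N)) = \1%VF.
Proof.
move=> HM HN; apply: smod_lfun_ext => m n.
by rewrite smod_tmapE // ?id_lfunE // => x y; rewrite !id_lfunE.
Qed.
Lemma modhom_id (M : mod_data L) : is_modhom (\1%VF : 'Hom(M, M)).
Proof. by move=> x m; rewrite !id_lfunE. Qed.
Lemma modhom_comp (M N P : mod_data L) (g : 'Hom(N, P)) (f : 'Hom(M, N)) :
  is_modhom g -> is_modhom f -> is_modhom (g \o f)%VF.
Proof. by move=> hg hf x m; rewrite !comp_lfunE hf hg. Qed.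

Lemma smod_tmap_comp (X X' X'' Y Y' Y'' : mod_data L) (f : 'Hom(X, X')) (f' : 'Hom(X', X''))
    (g : 'Hom(Y, Y')) (g' : 'Hom(Y', Y'')) :
  is_module X -> is_module X' -> is_module X'' -> is_module Y -> is_module Y' -> is_module Y'' ->
  is_modhom f -> is_modhom f' -> is_modhom g -> is_modhom g' ->
  smod_tmap R (f' \o f)%VF (g' \o g)%VF = (smod_tmap R f' g' \o smod_tmap R f g)%VF.
Proof.
move=> hX hX' hX'' hY hY' hY'' hf hf' hg hg'.
apply: smod_lfun_ext => m n; rewrite comp_lfunE !smod_tmapE ?comp_lfunE //; exact: modhom_comp.
Qed.
Lemma smod_assoc_nat (X X' Y Y' Z Z' : mod_data L) (f : 'Hom(X, X')) (g : 'Hom(Y, Y')) (h : 'Hom(Z, Z')) :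
  is_module X -> is_module X' -> is_module Y -> is_module Y' -> is_module Z -> is_module Z' ->
  is_modhom f -> is_modhom g -> is_modhom h ->
  (smod_assoc R X' Y' Z' \o smod_tmap R (smod_tmap R f g) h =
   smod_tmap R f (smod_tmap R g h) \o smod_assoc R X Y Z)%VF.
Proof.
move=> hX hX' hY hY' hZ hZ' hf hg hh.
have e1 := smod_module hX hY; have e2 := smod_module hX' hY'.
have e3 := smod_module hY hZ; have e4 := smod_module hY' hZ'.
have t1 : is_modhom (smod_tmap R f g) by exact: smod_tmap_hom.
have t2 : is_modhom (smod_tmap R g h) by exact: smod_tmap_hom.
apply/lfunP; apply: smod_ext3; [by lin|by lin|move=> m n p]; rewrite !comp_lfunE.
by rewrite !(smod_tmapE, smod_assocE).
Qed.
Lemma smod_lunit_nat (X X' : mod_data L) (f : 'Hom(X, X')) :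
  is_module X -> is_module X' -> is_modhom f ->
  (smod_lunit R X' \o smod_tmap R (\1%VF : 'Hom(U, U)) f = f \o smod_lunit R X)%VF.
Proof.
move=> hX hX' hf; have hU := unit_module HH; have i1 := @modhom_id U.
by apply: smod_lfun_ext => a m; rewrite !comp_lfunE smod_tmapE // ?id_lfunE !smod_lunitE // modhom_l.
Qed.
Lemma smod_runit_nat (X X' : mod_data L) (f : 'Hom(X, X')) :
  is_module X -> is_module X' -> is_modhom f ->
  (smod_runit R X' \o smod_tmap R f (\1%VF : 'Hom(U, U)) = f \o smod_runit R X)%VF.
Proof.
move=> hX hX' hf; have hU := unit_module HH; have i1 := @modhom_id U.
by apply: smod_lfun_ext => a m; rewrite !comp_lfunE smod_tmapE // ?id_lfunE !smod_runitE // modhom_r.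
Qed.
Lemma comp_lfunE3 (A B C' D' : vectType k) (h : 'Hom(C', D')) (g : 'Hom(B, C')) (f : 'Hom(A, B)) t :
  (h \o (g \o f))%VF t = h (g (f t)).
Proof. by rewrite !comp_lfunE. Qed.
Lemma smod_pentagon (X Y Z T : mod_data L) :
  is_module X -> is_module Y -> is_module Z -> is_module T ->
  (smod_tmap R (\1%VF : 'Hom(X, X)) (smod_assoc R Y Z T) \o
     (smod_assoc R X (smod_tens R Y Z) T \o smod_tmap R (smod_assoc R X Y Z) (\1%VF : 'Hom(T, T)))
   = smod_assoc R X Y (smod_tens R Z T) \o smod_assoc R (smod_tens R X Y) Z T)%VF.
Proof.
move=> hX hY hZ hT.
have e1 := smod_module hX hY; have e2 := smod_module hY hZ; have e3 := smod_module hZ hT.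
have e4 := smod_module e1 hZ; have e5 := smod_module hX e2; have e6 := smod_module hY e3.
have e7 := smod_module e2 hT.
have a1 := smod_assoc_hom hX hY hZ; have a2 := smod_assoc_hom hY hZ hT.
have i1 := @modhom_id X; have i2 := @modhom_id T.
apply: smod_lfun_ext => s p; move: s.
apply: (@smod_ext3 _ _ _ X Y Z _ (fun s => (smod_tmap R (\1%VF : 'Hom(X, X)) (smod_assoc R Y Z T)
    \o (smod_assoc R X (smod_tens R Y Z) T \o smod_tmap R (smod_assoc R X Y Z) (\1%VF : 'Hom(T, T))))%VF
    (tprod (s : smod_tens R (smod_tens R X Y) Z) p))
  (fun s => (smod_assoc R X Y (smod_tens R Z T) \o smod_assoc R (smod_tens R X Y) Z T)%VF
    (tprod (s : smod_tens R (smod_tens R X Y) Z) p))); [by lin|by lin|move=> m n q].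
etransitivity; first exact: comp_lfunE3.
rewrite (smod_tmapE e4 e5 hT a1 i2) id_lfunE (smod_assocE hX hY hZ) (smod_assocE hX e2 hT).
rewrite (smod_tmapE hX hX e6 i1 a2) id_lfunE (smod_assocE hY hZ hT).
symmetry; etransitivity; first exact: comp_lfunE.
by rewrite (smod_assocE e1 hZ hT) (smod_assocE hX hY e3).
Qed.
Lemma smod_triangle (X Y : mod_data L) : is_module X -> is_module Y ->
  (smod_tmap R (\1%VF : 'Hom(X, X)) (smod_lunit R Y) \o smod_assoc R X U Y)%VF
    = smod_tmap R (smod_runit R X) (\1%VF : 'Hom(Y, Y)).
Proof.
move=> hX hY.
have hU := unit_module HH; have e1 := smod_module hX hU; have e2 := smod_module hU hY.
have [l1 _] := smod_lunit_isom hY; have [r1 _] := smod_runit_isom hX.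
have i1 := @modhom_id X; have i2 := @modhom_id Y.
apply: smod_lfun_ext => s p; move: s.
apply: (@smod_ext _ _ _ X U _ (fun s => (smod_tmap R (\1%VF : 'Hom(X, X)) (smod_lunit R Y) \o smod_assoc R X U Y)%VF
    (tprod (s : smod_tens R X U) p))
  (fun s => smod_tmap R (smod_runit R X) (\1%VF : 'Hom(Y, Y)) (tprod (s : smod_tens R X U) p))); [by lin|by lin|move=> m b].
by rewrite !comp_lfunE smod_assocE // !smod_tmapE // !id_lfunE smod_lunitE // smod_runitE // tprod_bal.
Qed.

Lemma smash_monoidal : is_monoidal C.
Proof.
split.
- exact: smash_lin.
- by move=> X Y hX hY; exact: smod_module.
- exact: unit_module.
- move=> X X' Y Y' f g [hX hX' hf] [hY hY' hg].
  by split; [exact: smod_module|exact: smod_module|exact: smod_tmap_hom].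
- exact: smod_tmap_id.
- move=> X X' X'' Y Y' Y'' f f' g g' [hX hX' hf] [_ hX'' hf'] [hY hY' hg] [_ hY'' hg'].
  exact: (smod_tmap_comp hX hX' hX'' hY hY' hY'' hf hf' hg hg').
- by move=> X X' Y Y' a f f' g [hX hX' hf] [_ _ hf'] [hY hY' hg]; exact: smod_tmap_linl.
- by move=> X X' Y Y' a f g g' [hX hX' hf] [hY hY' hg] [_ _ hg']; exact: smod_tmap_linr.
- move=> X Y Z hX hY hZ; apply: modcat_isom; [| |exact: smod_assoc_hom|exact: smod_assocK|exact: smod_unassocK].
  + by apply: smod_module => //; exact: smod_module.
  + by apply: smod_module => //; exact: smod_module.
- move=> X hX; have [h [g [fg gf]]] := smod_lunit_isom hX.
  by apply: modcat_isom; [apply: smod_module => //; exact: unit_module|exact: hX|exact: h|exact: fg|exact: gf].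
- move=> X hX; have [h [g [fg gf]]] := smod_runit_isom hX.
  by apply: modcat_isom; [apply: smod_module => //; exact: unit_module|exact: hX|exact: h|exact: fg|exact: gf].
- move=> X X' Y Y' Z Z' f g h [hX hX' hf] [hY hY' hg] [hZ hZ' hh].
  exact: (smod_assoc_nat hX hX' hY hY' hZ hZ' hf hg hh).
- by move=> X X' f [hX hX' hf]; exact: (smod_lunit_nat hX hX' hf).
- by move=> X X' f [hX hX' hf]; exact: (smod_runit_nat hX hX' hf).
- by move=> X Y Z T hX hY hZ hT; exact: (smod_pentagon hX hY hZ hT).
- by move=> X Y hX hY; exact: (smod_triangle hX hY).
Qed.
End SmashMon.

(** * The monoidal category of modules over H with the opposite coproduct *)

Section CopMon.
Variables (k : fieldType) (H : falgType k) (HH : hopf_structure H).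
Local Notation D := (comul HH).
Local Notation eps := (counit HH).
Local Notation K := (cop_bialg HH).
Local Notation C := (bialg_modules K).
Implicit Types M N P : mod_data K.

Section Act.
Variables (M : mod_data K) (HM : is_module M).
Definition hopf_act (a : H) (m : M) : M := mact (a : K) m.
Lemma hopf_act_bilin : bilin hopf_act. Proof. exact: (mact_bilin HM). Qed.
Lemma hopf_act1 m : hopf_act 1 m = m. Proof. exact: (mact1 HM). Qed.
Lemma hopf_actM a b m : hopf_act (a * b) m = hopf_act a (hopf_act b m). Proof. exact: (mactM HM). Qed.
End Act.
Hint Resolve hopf_act_bilin : bil.

(** The swap is that of the opposite coproduct. *)
Lemma bmod_tens_act M N : is_module M -> is_module N -> forall (x : H) (m : M) (n : N),
  hopf_act (M := bmod_tens M N) x (m *t n) = \sw_(a, b <- D x) (hopf_act b m *t hopf_act a n).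
Proof.
move=> HM HN x m n; have b1 := hopf_act_bilin HM; have b2 := hopf_act_bilin HN.
pose F (x1 x2 : H) (t : tens M N) := \sw_(m, n <- t) (hopf_act x1 m *t hopf_act x2 n).
have FE x1 x2 : F x1 x2 (m *t n) = hopf_act x1 m *t hopf_act x2 n by rewrite /F lift_tensor //; lin.
rewrite -[LHS]/(lift (fun x1 x2 => F x1 x2 (m *t n)) (comul_cop HH x)) /comul_cop lift_lift.
apply: eq_lift => a b; rewrite lift_tensor ?FE //.
by rewrite /F; lin.
Qed.
Lemma bmod_tens_bilin M N : is_module M -> is_module N -> bilin (hopf_act (M := bmod_tens M N)).
Proof.
move=> HM HN; have b1 := hopf_act_bilin HM; have b2 := hopf_act_bilin HN.
have e : bilin (fun (x : H) (t : tens M N) => lift (fun x1 x2 : H => \sw_(m, n <- t) (hopf_act x1 m *t hopf_act x2 n)) (comul_cop HH x)).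
  by rewrite /comul_cop; lin.
exact: e.
Qed.
Lemma bmod_tens_module M N : is_module M -> is_module N -> is_module (bmod_tens M N).
Proof.
move=> HM HN; have b1 := hopf_act_bilin HM; have b2 := hopf_act_bilin HN; have b3 := bmod_tens_bilin HM HN.
split=> [|t|x y t]; first exact: b3.
  apply: (@tens_ext _ _ _ _ (hopf_act (M := bmod_tens M N) 1) (fun t => t)); [by lin|by lin|move=> m n].
  by rewrite bmod_tens_act // comul1_sw ?hopf_act1 //; lin.
apply: (@tens_ext _ _ _ _ (hopf_act (M := bmod_tens M N) ((x : H) * (y : H)))
  (fun t => hopf_act (M := bmod_tens M N) x (hopf_act (M := bmod_tens M N) y t))); [by lin|by lin|move=> m n].
rewrite !bmod_tens_act // comulM_sw; last by lin.
pull_sw (hopf_act (M := bmod_tens M N) x); rewrite lift_exch; apply: eq_lift => a b.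
rewrite bmod_tens_act //; apply: eq_lift => c d.
by rewrite !hopf_actM.
Qed.
Lemma bmod_unit_module : is_module (bmod_unit K).
Proof.
split=> [|m|x y m].
- have e : bilin (fun (x : H) (c : k^o) => eps x * c : k^o).
    split=> [x|c] a u v; first by rewrite mulrDr mulrCA.
    by rewrite linearP mulrDl -mulrA.
  exact: e.
- by rewrite -[mact _ _]/(eps 1 * m) counit1 mul1r.
- by rewrite -[mact _ _]/(eps ((x : H) * (y : H)) * m) counitM -mulrA.
Qed.

Lemma tmap_tensor (M M' N N' : vectType k) (f : 'Hom(M, M')) (g : 'Hom(N, N')) m n :
  tmap f g (m *t n) = f m *t g n.
Proof. by rewrite /tmap linfunE ?lift_tensor //; lin. Qed.
Lemma tens_lfun_ext (M N W : vectType k) (f g : 'Hom(tens M N, W)) :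
  (forall m n, f (m *t n) = g (m *t n)) -> f = g.
Proof. by move=> e; apply/lfunP; apply: tens_ext => //; lin. Qed.
Lemma tens_ext3 (M N P : vectType k) (W : lmodType k) (f g : tens (tens M N) P -> W) :
  lin f -> lin g ->
  (forall m n p, f ((m *t n) *t p) = g ((m *t n) *t p)) -> f =1 g.
Proof.
move=> lf lg e; apply: tens_ext => // s p; move: s.
by apply: (@tens_ext _ _ _ _ (fun s => f (s *t p)) (fun s => g (s *t p))); [by lin|by lin|move=> m n].
Qed.
Lemma tens_ext3r (M N P : vectType k) (W : lmodType k) (f g : tens M (tens N P) -> W) :
  lin f -> lin g ->
  (forall m n p, f (m *t (n *t p)) = g (m *t (n *t p))) -> f =1 g.
Proof.
move=> lf lg e; apply: tens_ext => // m s; move: s.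
by apply: (@tens_ext _ _ _ _ (fun s => f (m *t s)) (fun s => g (m *t s))); [by lin|by lin|move=> n p].
Qed.
Lemma tmap_id (X Y : vectType k) : tmap (\1%VF : 'Hom(X, X)) (\1%VF : 'Hom(Y, Y)) = \1%VF.
Proof. by apply: tens_lfun_ext => m n; rewrite tmap_tensor !id_lfunE. Qed.
Lemma tmap_comp (X X' X'' Y Y' Y'' : vectType k) (f : 'Hom(X, X')) (f' : 'Hom(X', X''))
    (g : 'Hom(Y, Y')) (g' : 'Hom(Y', Y'')) :
  tmap (f' \o f)%VF (g' \o g)%VF = (tmap f' g' \o tmap f g)%VF.
Proof. by apply: tens_lfun_ext => m n; rewrite comp_lfunE !tmap_tensor !comp_lfunE. Qed.
Lemma tmap_linl (X X' Y Y' : vectType k) a (f f' : 'Hom(X, X')) (g : 'Hom(Y, Y')) :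
  tmap (a *: f + f') g = a *: tmap f g + tmap f' g.
Proof.
apply: tens_lfun_ext => m n; rewrite add_lfunE scale_lfunE !tmap_tensor.
by rewrite add_lfunE scale_lfunE; case: (tensor_bilin X' Y') => _ ->.
Qed.
Lemma tmap_linr (X X' Y Y' : vectType k) a (f : 'Hom(X, X')) (g g' : 'Hom(Y, Y')) :
  tmap f (a *: g + g') = a *: tmap f g + tmap f g'.
Proof.
apply: tens_lfun_ext => m n; rewrite add_lfunE scale_lfunE !tmap_tensor.
by rewrite add_lfunE scale_lfunE; case: (tensor_bilin X' Y') => ->.
Qed.
Lemma tmap_hom (M M' N N' : mod_data K) (f : 'Hom(M, M')) (g : 'Hom(N, N')) :
  is_module M -> is_module M' -> is_module N -> is_module N' ->
  is_modhom f -> is_modhom g ->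
  is_modhom (tmap f g : 'Hom(bmod_tens M N, bmod_tens M' N')).
Proof.
move=> HM HM' HN HN' hf hg x t.
have b3 := bmod_tens_bilin HM HN; have b4 := bmod_tens_bilin HM' HN'.
apply: (@tens_ext _ _ _ _ (fun t => tmap f g (hopf_act (M := bmod_tens M N) x t))
  (fun t => hopf_act (M := bmod_tens M' N') x (tmap f g t))); [by lin|by lin|move=> m n].
rewrite tmap_tensor !bmod_tens_act // lfun_lift; apply: eq_lift => a b.
by rewrite tmap_tensor /hopf_act hf hg.
Qed.
Lemma bmod_assocE M N P m n p : bmod_assoc M N P ((m *t n) *t p) = m *t (n *t p).
Proof.
by rewrite /bmod_assoc linfunE; [rewrite !lift_tensor //; lin|lin].
Qed.
Definition bmod_unassoc M N P : 'Hom(tens M (tens N P), tens (tens M N) P) :=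
  linfun (fun t : tens M (tens N P) =>
    \sw_(m, s <- t) \sw_(n, p <- s) ((m *t n) *t p)).
Lemma bmod_unassocE M N P m n p : bmod_unassoc M N P (m *t (n *t p)) = (m *t n) *t p.
Proof.
by rewrite /bmod_unassoc linfunE; [rewrite !lift_tensor //; lin|lin].
Qed.
Lemma bmod_lunitE M c m : bmod_lunit M (c *t m) = (c : k) *: m.
Proof. by rewrite /bmod_lunit linfunE ?lift_tensor //; lin. Qed.
Lemma bmod_runitE M m c : bmod_runit M (m *t c) = (c : k) *: m.
Proof. by rewrite /bmod_runit linfunE ?lift_tensor //; lin. Qed.

Lemma bmod_assoc_isom M N P : is_module M -> is_module N -> is_module P ->
  @isom k C _ _ (bmod_assoc M N P).
Proof.
move=> HM HN HP.
have e1 := bmod_tens_module HM HN; have e2 := bmod_tens_module HN HP.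
have e3 := bmod_tens_module e1 HP; have e4 := bmod_tens_module HM e2.
apply: (@modcat_isom _ _ _ _ _ _ _ _ _ _ (bmod_assoc M N P) (bmod_unassoc M N P)) => //.
- move=> x t.
  have b1 := hopf_act_bilin e3; have b2 := hopf_act_bilin e4; have b3 := hopf_act_bilin e2; have b4 := hopf_act_bilin e1.
  have b5 := hopf_act_bilin HM; have b6 := hopf_act_bilin HN; have b7 := hopf_act_bilin HP.
  apply: (@tens_ext3 M N P _ (fun t => bmod_assoc M N P (hopf_act (M := bmod_tens (bmod_tens M N) P) x t))
     (fun t => hopf_act (M := bmod_tens M (bmod_tens N P)) x (bmod_assoc M N P t))); [by lin|by lin|move=> m n p].
  rewrite bmod_assocE !bmod_tens_act // lfun_lift.
  transitivity (\sw_(a, b <- D x) \sw_(c, d <- D b) (hopf_act d m *t (hopf_act c n *t hopf_act a p))).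
    apply: eq_lift => a b; rewrite bmod_tens_act //.
    pull_sw (fun z : tens M N => bmod_assoc M N P (z *t hopf_act a p)).
    by apply: eq_lift => c d; rewrite bmod_assocE.
  symmetry; transitivity (\sw_(a, b <- D x) \sw_(c, d <- D a) (hopf_act b m *t (hopf_act d n *t hopf_act c p))).
    apply: eq_lift => a b; rewrite bmod_tens_act //.
    by pull_sw (fun z : tens N P => hopf_act b m *t z).
  by rewrite (@comulA_sw _ _ HH _ x (fun c d b => hopf_act b m *t (hopf_act d n *t hopf_act c p))) //; solve_lin.
- by apply: tens_ext3; [by lin|by lin|move=> m n p]; rewrite bmod_assocE bmod_unassocE.
by apply: tens_ext3r; [by lin|by lin|move=> m n p]; rewrite bmod_unassocE bmod_assocE.
Qed.
Lemma bmod_lunit_isom M : is_module M -> @isom k C _ _ (bmod_lunit M).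
Proof.
move=> HM; have hU := bmod_unit_module; have e1 := bmod_tens_module hU HM; have b1 := hopf_act_bilin HM.
have b2 := hopf_act_bilin e1; have b3 := hopf_act_bilin hU.
pose g := linfun (fun m : M => (1 : k^o) *t m : tens k^o M).
have gE m : g m = 1 *t m by rewrite /g linfunE //; lin.
apply: (@modcat_isom _ _ _ _ _ _ _ _ _ _ (bmod_lunit M) g) => //.
- move=> x t.
  apply: (@tens_ext _ k^o M _ (fun t => bmod_lunit M (hopf_act (M := bmod_tens (bmod_unit K) M) x t))
     (fun t => hopf_act (M := M) x (bmod_lunit M t))); [by lin|by lin|move=> c m].
  rewrite (bmod_tens_act hU HM) bmod_lunitE lfun_lift.
  transitivity (\sw_(a, b <- D x) ((eps b : k) *: ((c : k) *: hopf_act a m))).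
    by apply: eq_lift => a b; rewrite bmod_lunitE scalerA.
  by sw_rewrite (@counit_r _ _ HH M x (fun a => (c : k) *: hopf_act a m)); pull_scale (hopf_act (M := M) x).
- apply: (@tens_ext _ k^o M); [by lin|by lin|move=> c m].
  by rewrite bmod_lunitE gE; pull_scale (fun z : M => (1 : k^o) *t z);
    rewrite -(linZ (f := fun z : k^o => z *t m)) ?[_ *: 1]mulr1 //; lin.
by move=> m; rewrite gE bmod_lunitE scale1r.
Qed.
Lemma bmod_runit_isom M : is_module M -> @isom k C _ _ (bmod_runit M).
Proof.
move=> HM; have hU := bmod_unit_module; have e1 := bmod_tens_module HM hU; have b1 := hopf_act_bilin HM.
have b2 := hopf_act_bilin e1; have b3 := hopf_act_bilin hU.
pose g := linfun (fun m : M => m *t (1 : k^o) : tens M k^o).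
have gE m : g m = m *t 1 by rewrite /g linfunE //; lin.
apply: (@modcat_isom _ _ _ _ _ _ _ _ _ _ (bmod_runit M) g) => //.
- move=> x t.
  apply: (@tens_ext _ M k^o _ (fun t => bmod_runit M (hopf_act (M := bmod_tens M (bmod_unit K)) x t))
     (fun t => hopf_act (M := M) x (bmod_runit M t))); [by lin|by lin|move=> m c].
  rewrite (bmod_tens_act HM hU) bmod_runitE lfun_lift.
  transitivity (\sw_(a, b <- D x) ((eps a : k) *: ((c : k) *: hopf_act b m))).
    by apply: eq_lift => a b; rewrite bmod_runitE scalerA.
  by sw_rewrite (@counit_l _ _ HH M x (fun a => (c : k) *: hopf_act a m)); pull_scale (hopf_act (M := M) x).
- apply: (@tens_ext _ M k^o); [by lin|by lin|move=> m c].
  by rewrite bmod_runitE gE; pull_scale (fun z : M => z *t (1 : k^o));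
    rewrite -(linZ (f := fun z : k^o => m *t z)) ?[_ *: 1]mulr1 //; lin.
by move=> m; rewrite gE bmod_runitE scale1r.
Qed.

Lemma bmod_assoc_nat (X X' Y Y' Z Z' : mod_data K) (f : 'Hom(X, X')) (g : 'Hom(Y, Y')) (h : 'Hom(Z, Z')) :
  (bmod_assoc X' Y' Z' \o tmap (tmap f g) h = tmap f (tmap g h) \o bmod_assoc X Y Z)%VF.
Proof.
apply/lfunP; apply: tens_ext3; [by lin|by lin|move=> m n p].
by rewrite !comp_lfunE !(tmap_tensor, bmod_assocE).
Qed.
Lemma bmod_lunit_nat (X X' : mod_data K) (f : 'Hom(X, X')) :
  (bmod_lunit X' \o tmap (\1%VF : 'Hom(bmod_unit K, bmod_unit K)) f = f \o bmod_lunit X)%VF.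
Proof.
apply: tens_lfun_ext => c m; rewrite !comp_lfunE.
by rewrite (@tmap_tensor (bmod_unit K) (bmod_unit K)) !bmod_lunitE id_lfunE linearZ.
Qed.
Lemma bmod_runit_nat (X X' : mod_data K) (f : 'Hom(X, X')) :
  (bmod_runit X' \o tmap f (\1%VF : 'Hom(bmod_unit K, bmod_unit K)) = f \o bmod_runit X)%VF.
Proof.
apply: tens_lfun_ext => m c; rewrite !comp_lfunE.
by rewrite (@tmap_tensor _ _ (bmod_unit K) (bmod_unit K)) !bmod_runitE id_lfunE linearZ.
Qed.
Lemma bmod_pentagon (X Y Z T : mod_data K) :
  (tmap (\1%VF : 'Hom(X, X)) (bmod_assoc Y Z T) \o
     (bmod_assoc X (bmod_tens Y Z) T \o tmap (bmod_assoc X Y Z) (\1%VF : 'Hom(T, T)))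
   = bmod_assoc X Y (bmod_tens Z T) \o bmod_assoc (bmod_tens X Y) Z T)%VF.
Proof.
apply: tens_lfun_ext => s p; move: s.
apply: (@tens_ext3 X Y Z _ (fun s => (tmap (\1%VF : 'Hom(X, X)) (bmod_assoc Y Z T) \o
     (bmod_assoc X (bmod_tens Y Z) T \o tmap (bmod_assoc X Y Z) (\1%VF : 'Hom(T, T))))%VF (s *t p))
  (fun s => (bmod_assoc X Y (bmod_tens Z T) \o bmod_assoc (bmod_tens X Y) Z T)%VF (s *t p))); [by lin|by lin|move=> m n q].
rewrite !comp_lfunE (@tmap_tensor (bmod_tens (bmod_tens X Y) Z) (bmod_tens X (bmod_tens Y Z)) T T).
by rewrite bmod_assocE id_lfunE !bmod_assocE (@tmap_tensor X X) bmod_assocE id_lfunE.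
Qed.
Lemma bmod_triangle (X Y : mod_data K) :
  (tmap (\1%VF : 'Hom(X, X)) (bmod_lunit Y) \o bmod_assoc X (bmod_unit K) Y)%VF
    = tmap (bmod_runit X) (\1%VF : 'Hom(Y, Y)).
Proof.
apply/lfunP; apply: (@tens_ext3 X (bmod_unit K) Y); [by lin|by lin|move=> m c n].
rewrite comp_lfunE bmod_assocE (@tmap_tensor X X) bmod_lunitE (@tmap_tensor (bmod_tens X (bmod_unit K)) X) bmod_runitE !id_lfunE.
by pull_scale (fun z : Y => m *t z); pull_scale (fun z : X => z *t n).
Qed.

Lemma cop_monoidal : is_monoidal C.
Proof.
split.
- exact: modcat_lin.
- by move=> X Y hX hY; exact: bmod_tens_module.
- exact: bmod_unit_module.
- move=> X X' Y Y' f g [hX hX' hf] [hY hY' hg].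
  by split; [exact: bmod_tens_module|exact: bmod_tens_module|exact: tmap_hom].
- by move=> X Y _ _; exact: tmap_id.
- by move=> X X' X'' Y Y' Y'' f f' g g' _ _ _ _; exact: tmap_comp.
- by move=> X X' Y Y' a f f' g _ _ _; exact: tmap_linl.
- by move=> X X' Y Y' a f g g' _ _ _; exact: tmap_linr.
- by move=> X Y Z; exact: bmod_assoc_isom.
- by move=> X; exact: bmod_lunit_isom.
- by move=> X; exact: bmod_runit_isom.
- move=> X X' Y Y' Z Z' f g h _ _ _; exact: bmod_assoc_nat.
- move=> X X' f _; exact: bmod_lunit_nat.
- move=> X X' f _; exact: bmod_runit_nat.
- move=> X Y Z T _ _ _ _; exact: bmod_pentagon.
- move=> X Y _ _; exact: bmod_triangle.
Qed.
End CopMon.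

#[export] Hint Resolve hopf_act_bilin : bil.

(** * Coinvariants *)

Section Coinv.
Variables (k : fieldType) (H : falgType k) (HH : hopf_structure H).
Local Notation D := (comul HH).
Local Notation eps := (counit HH).
Local Notation S := (antipode HH).
Local Notation L := (smash_double HH).
Local Notation R := (double_R HH).
Local Notation C := (smash_modules (@double_act k H HH) R).
Local Notation K := (cop_bialg HH).
Local Notation DC := (bialg_modules K).

Definition coinv_proj (M : mod_data L) : 'End(M) :=
  linfun (fun m : M => \sw_(x, n <- mod_co M m) mod_l (S x) n).
(** Since S reverses products, v |-> v S(h) is a left action; the projection brings its values back to the
    coinvariants. *)
Definition coinv (M : mod_data L) : mod_data K :=
  @ModData k K (subvs_of (limg (coinv_proj M)))
    (fun (h : H) v => vsproj _ (coinv_proj M (mod_r (vsval v) (S h)))).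
Definition to_coinv (M : mod_data L) (m : M) : coinv M := vsproj (limg (coinv_proj M)) (coinv_proj M m).
Definition of_coinv (M : mod_data L) (v : coinv M) : M := vsval v.

Lemma lin_to_coinv M : lin (@to_coinv M).
Proof. by move=> a x y; rewrite /to_coinv !linearP. Qed.
Lemma lin_of_coinv M : lin (@of_coinv M). Proof. exact: linearP. Qed.
Lemma of_coinv_inj M : injective (@of_coinv M). Proof. exact: subvs_inj. Qed.
Lemma to_coinvK M m : of_coinv (to_coinv (M := M) m) = coinv_proj M m.
Proof. by rewrite /of_coinv /to_coinv vsprojK // memv_img ?memvf. Qed.
Lemma coinv_act M (h : H) (v : coinv M) : hopf_act h v = to_coinv (mod_r (of_coinv v) (S h)).
Proof. by []. Qed.

Section M.
Variables (M : mod_data L) (HM : is_module M).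
Local Notation X := (mod_bimod HM).
Local Notation E := (coinv_proj M).
Let b1 := mod_l_bilin HM.
Let b2 := mod_r_bilin HM.
Lemma coinv_projE m : E m = \sw_(x, n <- mod_co M m) mod_l (S x) n.
Proof. by rewrite /coinv_proj linfunE //; lin. Qed.
(** S(a_1 m_{-1}) a_2 m_0 = S(m_{-1}) S(a_1) a_2 m_0. *)
Lemma coinv_proj_l a m : E (mod_l a m) = (eps a : k) *: E m.
Proof.
rewrite !coinv_projE (coact_lmul_sw X); last by lin.
rewrite lift_exch scale_lift; apply: eq_lift => x n.
under eq_lift => a1 a2 do rewrite antipodeM -[lmul X a2 n]/(mod_l a2 n) -mod_lM // -mulrA.
by sw_rewrite (@antipode_l _ _ HH M a (fun z => mod_l (S x * z) n)); rewrite mulr1.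
Qed.
(** The values of E are coinvariant; conversely [coinv_proj_id] says that E fixes the coinvariants. *)
Lemma mod_co_coinv_proj m : mod_co M (E m) = 1 *t E m.
Proof.
rewrite coinv_projE lfun_lift; pull_sw (fun z : M => (1 : H) *t z).
transitivity (\sw_(x, n <- mod_co M m) \sw_(y, n' <- mod_co M n) \sw_(b1, b2 <- D x)
  ((S b2 * y) *t mod_l (S b1) n')).
  apply: eq_lift => x n; rewrite (mod_co_l HM) comul_antipode; last by lin.
  by rewrite lift_exch.
rewrite (@coactA_sw _ _ _ _ X _ m (fun x y n' => \sw_(b1, b2 <- D x)
  ((S b2 * y) *t mod_l (S b1) n'))); last by solve_lin.
apply: eq_lift => x n; rewrite comulA_sw; last by solve_lin.
by sw_rewrite (@antipode_l_tail _ _ HH _ x (fun b1 z => z *t mod_l (S b1) n)).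
Qed.
Lemma coinv_proj_id v : mod_co M v = 1 *t v -> E v = v.
Proof.
move=> e; rewrite coinv_projE e lift_tensor; last by lin.
by rewrite antipode1 mod_l1.
Qed.
Lemma coinv_proj_proj m : E (E m) = E m.
Proof. by apply: coinv_proj_id; rewrite mod_co_coinv_proj. Qed.
Lemma mod_co_of_coinv (v : coinv M) : mod_co M (of_coinv v) = 1 *t of_coinv v.
Proof.
have /memv_imgP[m _ e] := subvsP v; have {}e : of_coinv v = E m := e.
by rewrite e mod_co_coinv_proj.
Qed.
Lemma coinv_proj_of_coinv (v : coinv M) : E (of_coinv v) = of_coinv v.
Proof. exact: coinv_proj_id (mod_co_of_coinv v). Qed.
Lemma of_coinvK (v : coinv M) : to_coinv (of_coinv v) = v.
Proof. by apply: of_coinv_inj; rewrite to_coinvK coinv_proj_of_coinv. Qed.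
(** The fundamental theorem of Hopf modules: m_{-2} S(m_{-1}) m_0 = m. *)
Lemma coinv_decomposition m : \sw_(x, n <- mod_co M m) mod_l x (E n) = m.
Proof.
under eq_lift => x n do (rewrite coinv_projE; pull_sw (mod_l (M := M) x)).
rewrite (@coactA_sw _ _ _ _ X _ m (fun x y n => mod_l x (mod_l (S y) n))); last by solve_lin.
under eq_lift => x n do under eq_lift => x1 x2 do rewrite -mod_lM //.
under eq_lift => x n do sw_rewrite (@antipode_r _ _ HH M x (fun z => mod_l z n)).
under eq_lift => x n do rewrite mod_l1 //.
exact: mod_co_counit.
Qed.
(** This is what makes h * v = E(v S(h)) an action: the inner projection can be dropped. *)
Lemma coinv_proj_r m a : E (mod_r (E m) a) = E (mod_r m a).
Proof.
rewrite {1}(coinv_projE m); pull_sw (fun z => E (mod_r z a)).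
under eq_lift => x n do rewrite -mod_lrA // coinv_proj_l counit_antipode.
by rewrite (@coact_counit_sw _ _ _ _ X _ m (fun n => E (mod_r n a))) //; lin.
Qed.
Lemma coinv_module : is_module (coinv M).
Proof.
have l1 := @lin_to_coinv M; have l2 := @lin_of_coinv M; split=> [|v|x y v].
- have e : bilin (fun (h : H) (v : coinv M) => to_coinv (mod_r (of_coinv v) (S h))) by lin.
  exact: e.
- by rewrite -[mact _ v]/(to_coinv (mod_r (of_coinv v) (S 1))) antipode1 mod_r1 // of_coinvK.
rewrite -[LHS]/(to_coinv (mod_r (of_coinv v) (S ((x : H) * (y : H))))).
rewrite -[RHS]/(to_coinv (mod_r (of_coinv (to_coinv (mod_r (of_coinv v) (S y)))) (S x))).
by apply: of_coinv_inj; rewrite !to_coinvK coinv_proj_r antipodeM mod_rM.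
Qed.
End M.

Definition coinv_map (M N : mod_data L) (f : 'Hom(M, N)) : 'Hom(coinv M, coinv N) :=
  linfun (fun v : coinv M => to_coinv (f (of_coinv v))).
Lemma coinv_mapE (M N : mod_data L) (f : 'Hom(M, N)) v : coinv_map f v = to_coinv (f (of_coinv v)).
Proof.
have l1 := @lin_to_coinv N; have l2 := @lin_of_coinv M.
by rewrite /coinv_map linfunE //; lin.
Qed.
Lemma coinv_proj_hom (M N : mod_data L) (f : 'Hom(M, N)) m :
  is_module M -> is_module N -> is_modhom f -> f (coinv_proj M m) = coinv_proj N (f m).
Proof.
move=> HM HN hf; have b1 := mod_l_bilin HN; rewrite !coinv_projE // (modhom_co HM HN hf) lift_lift lfun_lift.
by apply: eq_lift => x n; rewrite lift_tensor ?modhom_l //; lin.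
Qed.
Lemma of_coinv_map (M N : mod_data L) (f : 'Hom(M, N)) v :
  is_module M -> is_module N -> is_modhom f -> of_coinv (coinv_map f v) = f (of_coinv v).
Proof. by move=> HM HN hf; rewrite coinv_mapE to_coinvK -coinv_proj_hom // coinv_proj_of_coinv. Qed.
Lemma coinv_map_hom (M N : mod_data L) (f : 'Hom(M, N)) :
  is_module M -> is_module N -> is_modhom f -> is_modhom (coinv_map f).
Proof.
move=> HM HN hf x v; apply: of_coinv_inj.
rewrite of_coinv_map // -[mact x v]/(hopf_act (x : H) v) -[mact x _]/(hopf_act (x : H) (coinv_map f v)).
by rewrite !coinv_act !to_coinvK of_coinv_map // coinv_proj_hom // modhom_r.
Qed.
Definition coinv_functor : prefunctor C DC := @Prefunctor k C DC coinv coinv_map.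
Lemma coinv_functor_lin : is_lin_functor coinv_functor.
Proof.
split=> /=.
- exact: coinv_module.
- by move=> X Y f [hX hY hf]; split; [exact: coinv_module|exact: coinv_module|exact: coinv_map_hom].
- move=> X hX; apply/lfunP => v; rewrite coinv_mapE !id_lfunE; exact: of_coinvK.
- move=> X Y Z g f [hY hZ hg] [hX _ hf]; apply/lfunP => v; apply: of_coinv_inj.
  have hgf := modhom_comp hg hf.
  by rewrite of_coinv_map // !comp_lfunE !of_coinv_map.
move=> X Y a f g _ _; apply/lfunP => v.
by rewrite add_lfunE scale_lfunE !coinv_mapE add_lfunE scale_lfunE lin_to_coinv.
Qed.
End Coinv.

#[export] Hint Resolve lin_to_coinv lin_of_coinv : linear_fun.

(** * Coinvariants as a monoidal functor *)

Section MonF.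
Variables (k : fieldType) (H : falgType k) (HH : hopf_structure H).
Local Notation D := (comul HH).
Local Notation eps := (counit HH).
Local Notation S := (antipode HH).
Local Notation L := (smash_double HH).
Local Notation R := (double_R HH).
Local Notation U := (smod_unit (@double_act k H HH)).
Local Notation K := (cop_bialg HH).
Local Notation DC := (bialg_modules K).
Local Notation F := (@coinv k H HH).
Implicit Types M N P : mod_data L.

Definition coinv_tens M N : 'Hom(bmod_tens (F M) (F N), F (smod_tens R M N)) :=
  linfun (fun t : tens (F M) (F N) =>
    \sw_(v, w <- t) to_coinv (tprod (of_coinv v) (of_coinv w) : smod_tens R M N)).
Lemma coinv_tensE M N (v : F M) (w : F N) :
  coinv_tens M N (v *t w) = to_coinv (tprod (of_coinv v) (of_coinv w) : smod_tens R M N).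
Proof. by rewrite /coinv_tens linfunE ?lift_tensor //; lin. Qed.

Section MN.
Variables (M N : mod_data L) (HM : is_module M) (HN : is_module N).
Let HT := smod_module HM HN.
Let b1 := mod_l_bilin HM.
Let b2 := mod_r_bilin HM.
Let b3 := mod_l_bilin HN.
Let b4 := mod_r_bilin HN.
Local Notation X := (mod_bimod HM).
Local Notation Y := (mod_bimod HN).
Local Notation T := (smod_tens R M N).

(** Writing n = n_{-1} E(n_0) and moving n_{-1} across the tensor product to m leaves a second factor that is already
    coinvariant. *)
Lemma coinv_proj_tprod (m : M) (n : N) : coinv_proj T (tprod m n) =
  \sw_(y, n0 <- mod_co N n) tprod (coinv_proj M (mod_r m y)) (coinv_proj N n0).
Proof.
transitivity (\sw_(x, m0 <- mod_co M m) \sw_(y, n0 <- mod_co N n) tprod (mod_l (S (x * y)) m0) n0).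
  have h := smod_l_bilin N HM; have h2 := mod_l_bilin HT.
  rewrite coinv_projE // (mod_co_smod HM HN) smod_coE // lift_lift; apply: eq_lift => x m0.
  rewrite lift_lift; apply: eq_lift => y n0.
  by rewrite lift_tensor ?(mod_l_smod HM HN) ?smod_lE //; lin.
symmetry; transitivity (\sw_(y, n0 <- mod_co N n) \sw_(y', n1 <- mod_co N n0) \sw_(x, m0 <- mod_co M m)
   tprod (mod_l (S (x * y)) m0) (mod_l y' (coinv_proj N n1))).
  rewrite (@coactA_sw _ _ _ _ Y _ n (fun y y' n1 => \sw_(x, m0 <- mod_co M m)
     tprod (mod_l (S (x * y)) m0) (mod_l y' (coinv_proj N n1)))); last by solve_lin.
  apply: eq_lift => y n0; rewrite coinv_projE // (coact_rmul_sw X); last by lin.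
  pull_sw (fun z : M => (tprod z (coinv_proj N n0) : T)); apply: eq_lift => y1 y2.
  pull_sw (fun z : M => (tprod z (coinv_proj N n0) : T)); apply: eq_lift => x m0.
  by rewrite mod_lrA // tprod_bal.
rewrite [RHS]lift_exch; apply: eq_lift => y n0.
rewrite [LHS]lift_exch; apply: eq_lift => x m0.
by rewrite -{2}(coinv_decomposition HN n0); pull_sw (fun z : N => (tprod (mod_l (S (x * y)) m0) z : T)).
Qed.
Lemma mod_co_tprod_coinv (v : F M) (w : F N) : mod_co T (tprod (of_coinv v) (of_coinv w)) = 1 *t (tprod (of_coinv v) (of_coinv w) : T).
Proof.
rewrite (mod_co_smod HM HN) smod_coE // !mod_co_of_coinv // lift_tensor; last by lin.
by rewrite lift_tensor ?mulr1 //; lin.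
Qed.
Lemma of_coinv_tens (v : F M) (w : F N) : of_coinv (coinv_tens M N (v *t w)) = tprod (of_coinv v) (of_coinv w).
Proof. by rewrite coinv_tensE to_coinvK coinv_proj_id // mod_co_tprod_coinv. Qed.
(** For coinvariant v and w the coaction of w S(h) is S(h_2) (x) w S(h_1), so that
    E((v (x) w) S(h)) = E(v S(h_2)) (x) E(w S(h_1)): the tensor product of modules over H^cop. *)
Lemma coinv_tens_hom : is_modhom (coinv_tens M N).
Proof.
have hF := coinv_module HM; have hF' := coinv_module HN.
have hB := bmod_tens_module hF hF'; have hFT := coinv_module HT.
have c1 := hopf_act_bilin hB; have c2 := hopf_act_bilin hFT; have c3 := mod_r_bilin HT.
move=> x t.
apply: (@tens_ext _ (F M) (F N) _ (fun t => coinv_tens M N (hopf_act (M := bmod_tens (F M) (F N)) x t))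
  (fun t => hopf_act (M := F T) x (coinv_tens M N t))); [by lin|by lin|move=> v w].
apply: of_coinv_inj; rewrite bmod_tens_act // coinv_act to_coinvK of_coinv_tens (mod_r_smod HM HN) smod_rE // coinv_proj_tprod.
rewrite (coact_rmul_sw Y); last by lin.
rewrite comul_antipode; last by lin.
rewrite lfun_lift; pull_sw (@of_coinv _ _ HH T); apply: eq_lift => a b.
rewrite of_coinv_tens !coinv_act !to_coinvK mod_co_of_coinv // lift_tensor; last by lin.
by rewrite mul1r.
Qed.

(** The inverse is read off [coinv_proj_tprod]; it is compatible with the balancing relation because E(a n) = eps(a) E(n). *)
Definition coinv_untens_fun (t : T) : tens (F M) (F N) :=
  \sw_(m, n <- quo_repr t) \sw_(y, n0 <- mod_co N n) (to_coinv (mod_r m y) *t to_coinv n0).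
Lemma lin_coinv_untens_fun : lin coinv_untens_fun.
Proof. by rewrite /coinv_untens_fun; lin. Qed.
Lemma coinv_untens_funE m n : coinv_untens_fun (tprod m n) = \sw_(y, n0 <- mod_co N n) (to_coinv (mod_r m y) *t to_coinv n0).
Proof.
rewrite /coinv_untens_fun (lift_tprod HM (g := fun m n => \sw_(y, n0 <- mod_co N n) (to_coinv (mod_r m y) *t to_coinv n0))) //; first by lin.
move=> m' a n'; symmetry; rewrite (coact_lmul_sw Y); last by lin.
rewrite lift_exch; apply: eq_lift => y n0.
transitivity (\sw_(a1, a2 <- D a) ((eps a2 : k) *: (to_coinv (mod_r m' (a1 * y)) *t to_coinv n0 : tens (F M) (F N)))).
  apply: eq_lift => a1 a2.
  have -> : to_coinv (lmul Y a2 n0) = (eps a2 : k) *: to_coinv n0 :> F N.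
    by apply: of_coinv_inj; rewrite (linZ _ _ (@lin_of_coinv _ _ HH N)) !to_coinvK coinv_proj_l.
  by rewrite (linZ (f := fun z : F N => _ *t z)) //; lin.
sw_rewrite (@counit_r _ _ HH _ a (fun a1 => (to_coinv (mod_r m' (a1 * y)) *t to_coinv n0 : tens (F M) (F N)))).
by rewrite mod_rM.
Qed.
Definition coinv_untens : 'Hom(F T, bmod_tens (F M) (F N)) :=
  linfun (fun v : F T => coinv_untens_fun (of_coinv v)).
Lemma coinv_untensE v : coinv_untens v = coinv_untens_fun (of_coinv v).
Proof. by have h := lin_coinv_untens_fun; rewrite /coinv_untens linfunE //; lin. Qed.
Lemma coinv_tensK : cancel (coinv_tens M N) coinv_untens.
Proof.
have h := lin_coinv_untens_fun.
apply: (@tens_ext _ (F M) (F N)); [by lin|by lin|move=> v w].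
rewrite coinv_untensE of_coinv_tens coinv_untens_funE mod_co_of_coinv // lift_tensor; last by lin.
by rewrite mod_r1 // !of_coinvK.
Qed.
Lemma coinv_untensK : cancel coinv_untens (coinv_tens M N).
Proof.
have h := lin_coinv_untens_fun.
have e : (fun t : T => coinv_tens M N (coinv_untens_fun t)) =1 (fun t : T => to_coinv t).
  apply: smod_ext; [by lin|exact: (@lin_to_coinv _ _ HH T)|move=> m n]; rewrite coinv_untens_funE; apply: of_coinv_inj.
  rewrite to_coinvK coinv_proj_tprod; pull_sw (fun z : tens (F M) (F N) => of_coinv (coinv_tens M N z)); apply: eq_lift => y n0.
  by rewrite of_coinv_tens !to_coinvK.
by move=> v; rewrite coinv_untensE e of_coinvK.
Qed.
Lemma coinv_tens_isom : @isom k DC _ _ (coinv_tens M N).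
Proof.
apply: modcat_isom; [|exact: coinv_module|exact: coinv_tens_hom|exact: coinv_tensK|exact: coinv_untensK].
by apply: bmod_tens_module; exact: coinv_module.
Qed.
End MN.

Definition coinv_unit : 'Hom(bmod_unit K, F U) :=
  linfun (fun c : k^o => to_coinv ((c : k) *: (1 : H) : U)).
Lemma coinv_unitE (c : k^o) : coinv_unit c = to_coinv ((c : k) *: (1 : H) : U).
Proof. by rewrite /coinv_unit linfunE //; lin. Qed.
Lemma coinv_proj_unit (b : U) : coinv_proj U b = (eps b : k) *: (1 : H).
Proof.
rewrite coinv_projE unit_co -(antipodel HH).
by apply: eq_lift => x n; rewrite unit_l.
Qed.
Lemma of_coinv_unit c : of_coinv (coinv_unit c) = (c : k) *: (1 : H).
Proof.
rewrite coinv_unitE to_coinvK coinv_proj_unit; congr (_ *: _).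
by rewrite linearZ /= counit1 [_ *: 1]mulr1.
Qed.
Lemma coinv_unit_isom : @isom k DC _ _ coinv_unit.
Proof.
have hU := unit_module HH.
pose g : 'Hom(F U, bmod_unit K) := linfun (fun v : F U => eps (of_coinv v : H) : k^o).
have gE v : g v = eps (of_coinv v : H) by rewrite /g linfunE //; lin.
apply: (@modcat_isom _ _ _ _ _ _ _ _ _ _ coinv_unit g).
- exact: bmod_unit_module.
- exact: coinv_module.
- move=> x c; apply: of_coinv_inj.
  rewrite of_coinv_unit -[mact x (coinv_unit c)]/(hopf_act (x : H) (coinv_unit c)) coinv_act to_coinvK unit_r coinv_proj_unit.
  rewrite of_coinv_unit; congr (_ *: _).
  by rewrite -scalerAl mul1r linearZ /= counit_antipode [RHS]mulrC.
- by move=> c; rewrite gE of_coinv_unit linearZ /= counit1 [_ *: 1]mulr1.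
move=> v; apply: of_coinv_inj; rewrite of_coinv_unit gE -coinv_proj_unit.
exact: coinv_proj_of_coinv.
Qed.

Lemma coinv_tens_nat (X X' Y Y' : mod_data L) (f : 'Hom(X, X')) (g : 'Hom(Y, Y')) :
  is_module X -> is_module X' -> is_module Y -> is_module Y' ->
  is_modhom f -> is_modhom g ->
  (coinv_tens X' Y' \o tmap (coinv_map f) (coinv_map g) = coinv_map (smod_tmap R f g) \o coinv_tens X Y)%VF.
Proof.
move=> hX hX' hY hY' hf hg; have t1 := smod_tmap_hom hX hX' hY hY' hf hg.
have e1 := smod_module hX hY; have e2 := smod_module hX' hY'.
apply: (@tens_lfun_ext _ (F X) (F Y)) => v w; apply: of_coinv_inj.
rewrite !comp_lfunE (@tmap_tensor _ (F X) (F X') (F Y) (F Y')) of_coinv_tens // (of_coinv_map _ e1 e2 t1) of_coinv_tens //.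
by rewrite smod_tmapE // !of_coinv_map.
Qed.
Lemma coinv_tens_assoc (X Y Z : mod_data L) : is_module X -> is_module Y -> is_module Z ->
  (coinv_map (smod_assoc R X Y Z) \o (coinv_tens (smod_tens R X Y) Z \o tmap (coinv_tens X Y) (\1%VF : 'Hom(F Z, F Z)))
   = coinv_tens X (smod_tens R Y Z) \o (tmap (\1%VF : 'Hom(F X, F X)) (coinv_tens Y Z) \o bmod_assoc (F X) (F Y) (F Z)))%VF.
Proof.
move=> hX hY hZ; have e1 := smod_module hX hY; have e2 := smod_module hY hZ.
have e3 := smod_module e1 hZ; have e4 := smod_module hX e2.
have a1 := smod_assoc_hom hX hY hZ.
apply/lfunP; apply: (@tens_ext3 _ (F X) (F Y) (F Z)); [by lin|by lin|move=> u v w].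
etransitivity; first exact: comp_lfunE3.
symmetry; etransitivity; first exact: comp_lfunE3.
apply: of_coinv_inj.
rewrite bmod_assocE.
rewrite (@tmap_tensor _ (F X) (F X) (bmod_tens (F Y) (F Z)) (F (smod_tens R Y Z))).
rewrite id_lfunE.
rewrite (of_coinv_tens hX e2).
rewrite (of_coinv_tens hY hZ).
rewrite (of_coinv_map _ e3 e4 a1).
rewrite (@tmap_tensor _ (bmod_tens (F X) (F Y)) (F (smod_tens R X Y)) (F Z) (F Z)).
rewrite id_lfunE.
rewrite (of_coinv_tens e1 hZ).
rewrite (of_coinv_tens hX hY).
by rewrite smod_assocE.
Qed.
Lemma coinv_tens_lunit (X : mod_data L) : is_module X ->
  (coinv_map (smod_lunit R X) \o (coinv_tens U X \o tmap coinv_unit (\1%VF : 'Hom(F X, F X))))%VF = bmod_lunit (F X).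
Proof.
move=> hX; have hU := unit_module HH; have e1 := smod_module hU hX.
have [l1 _] := smod_lunit_isom hX; have b1 := mod_l_bilin hX.
apply: (@tens_lfun_ext _ (bmod_unit K) (F X)) => c v; apply: of_coinv_inj.
rewrite !comp_lfunE (@tmap_tensor _ (bmod_unit K) (F U) (F X) (F X)) id_lfunE bmod_lunitE.
rewrite of_coinv_map // of_coinv_tens // smod_lunitE // of_coinv_unit (linZ _ _ (@lin_of_coinv _ _ HH X)).
by pull_scale (fun z : H => (mod_l z (of_coinv v) : X)); rewrite mod_l1.
Qed.
Lemma coinv_tens_runit (X : mod_data L) : is_module X ->
  (coinv_map (smod_runit R X) \o (coinv_tens X U \o tmap (\1%VF : 'Hom(F X, F X)) coinv_unit))%VF = bmod_runit (F X).
Proof.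
move=> hX; have hU := unit_module HH; have e1 := smod_module hX hU.
have [l1 _] := smod_runit_isom hX; have b1 := mod_r_bilin hX.
apply: (@tens_lfun_ext _ (F X) (bmod_unit K)) => v c; apply: of_coinv_inj.
rewrite !comp_lfunE (@tmap_tensor _ (F X) (F X) (bmod_unit K) (F U)) id_lfunE bmod_runitE.
rewrite of_coinv_map // of_coinv_tens // smod_runitE // of_coinv_unit (linZ _ _ (@lin_of_coinv _ _ HH X)).
by pull_scale (fun z : H => (mod_r (of_coinv v) z : X)); rewrite mod_r1.
Qed.

Lemma coinv_functor_monoidal : is_monoidal_functor (F := coinv_functor HH) coinv_tens coinv_unit.
Proof.
have hU := unit_module HH.
split.
- exact: coinv_functor_lin.
- by move=> X Y hX hY; exact: coinv_tens_isom.
- exact: coinv_unit_isom.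
- move=> X X' Y Y' f g [hX hX' hf] [hY hY' hg]; exact: coinv_tens_nat.
- by move=> X Y Z hX hY hZ; exact: coinv_tens_assoc.
- by move=> X hX; exact: coinv_tens_lunit.
- by move=> X hX; exact: coinv_tens_runit.
Qed.
End MonF.

(** * The equivalence of categories *)

Section Equiv.
Variables (k : fieldType) (H : falgType k) (HH : hopf_structure H).
Local Notation D := (comul HH).
Local Notation eps := (counit HH).
Local Notation S' := ((antipode HH)^-1)%VF.
Local Notation L := (smash_double HH).
Local Notation R := (double_R HH).
Local Notation C := (smash_modules (@double_act k H HH) R).
Local Notation K := (cop_bialg HH).
Local Notation DC := (bialg_modules K).
Local Notation F := (@coinv k H HH).
Local Notation LT := (tens H (tens 'Hom(H, k^o) H)).

Definition free_mod (V : mod_data K) : mod_data L :=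
  @ModData k L (tens H V)
    (smash_act_of HH (@free_lmul k H V) (@free_rmul k H HH V (@hopf_act k H HH V)) (@free_coact k H HH V)).
Definition free_map (V W : mod_data K) (f : 'Hom(V, W)) : 'Hom(free_mod V, free_mod W) :=
  tmap (\1%VF : 'Hom(H, H)) f.
Definition free_functor : prefunctor DC C := @Prefunctor k DC C free_mod free_map.

Section V.
Variables (V : mod_data K) (HV : is_module V).
Definition free_mod_bimod : hopf_bimod HH (tens H V) := @free_bimod _ _ HH V (@hopf_act k H HH V) (hopf_act_bilin HV) (hopf_act1 HV) (hopf_actM HV).
Lemma free_mod_act (x : LT) (t : free_mod V) : mact (x : L) t = smash_act free_mod_bimod x t. Proof. by []. Qed.
Lemma free_mod_module : is_module (free_mod V).
Proof. exact: (@module_of_bimod _ _ HH (free_mod V) free_mod_bimod free_mod_act). Qed.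
Lemma mod_l_free a (t : free_mod V) : mod_l a t = free_lmul a (t : tens H V).
Proof. exact: (@mod_l_of_bimod _ _ HH (free_mod V) free_mod_bimod free_mod_act). Qed.
Lemma mod_l_freeE a l (v : V) : mod_l (M := free_mod V) a (l *t v) = (a * l) *t v.
Proof. by rewrite (@mod_l_of_bimod _ _ HH (free_mod V) free_mod_bimod free_mod_act); exact: free_lmulE. Qed.
Lemma mod_r_freeE a l (v : V) : mod_r (M := free_mod V) (l *t v) a = \sw_(a1, a2 <- D a) ((l * a1) *t hopf_act (S' a2) v).
Proof. by rewrite (@mod_r_of_bimod _ _ HH (free_mod V) free_mod_bimod free_mod_act); exact: (free_rmulE HH (hopf_act_bilin HV)). Qed.
Lemma mod_co_freeE l (v : V) : mod_co (free_mod V) (l *t v) = \sw_(l1, l2 <- D l) (l1 *t (l2 *t v)).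
Proof. by rewrite (@mod_co_of_bimod _ _ HH (free_mod V) free_mod_bimod free_mod_act); exact: free_coactE. Qed.

Definition coinv_free_fun (t : tens H V) : V := \sw_(l, v <- t) ((eps l : k) *: v).
Lemma coinv_free_funE l v : coinv_free_fun (l *t v) = (eps l : k) *: v.
Proof. by rewrite /coinv_free_fun lift_tensor //; lin. Qed.
Lemma lin_coinv_free_fun : lin coinv_free_fun. Proof. by rewrite /coinv_free_fun; lin. Qed.
(** The coinvariants of H (x) V are 1 (x) V. *)
Lemma coinv_proj_free (t : free_mod V) : coinv_proj (free_mod V) t = (1 : H) *t coinv_free_fun t.
Proof.
have h := lin_coinv_free_fun.
apply: (@tens_ext _ H V _ (coinv_proj (free_mod V)) (fun t => (1 : H) *t coinv_free_fun t)); [by lin|by lin|move=> l v].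
rewrite coinv_projE mod_co_freeE lift_lift coinv_free_funE.
have b1 := mod_l_bilin free_mod_module.
under eq_lift => l1 l2 do ((rewrite lift_tensor; last by lin); rewrite mod_l_freeE).
sw_rewrite (@antipode_l _ _ HH _ l (fun z => z *t v)).
by pull_scale (fun z : V => (1 : H) *t z).
Qed.
Definition coinv_free : 'Hom(F (free_mod V), V) := linfun (fun v : F (free_mod V) => coinv_free_fun (of_coinv v)).
Lemma coinv_freeE v : coinv_free v = coinv_free_fun (of_coinv v).
Proof. by have h := lin_coinv_free_fun; rewrite /coinv_free linfunE //; lin. Qed.
Definition coinv_free_inv : 'Hom(V, F (free_mod V)) := linfun (fun v : V => to_coinv (M := free_mod V) ((1 : H) *t v)).
Lemma coinv_free_invE v : coinv_free_inv v = to_coinv (M := free_mod V) ((1 : H) *t v).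
Proof. by rewrite /coinv_free_inv linfunE //; lin. Qed.
Lemma coinv_freeK : cancel coinv_free coinv_free_inv.
Proof.
move=> v; apply: of_coinv_inj; rewrite coinv_free_invE coinv_freeE to_coinvK -coinv_proj_free.
exact: (etrans (coinv_proj_proj free_mod_module _) (coinv_proj_of_coinv free_mod_module v)).
Qed.
Lemma coinv_free_invK : cancel coinv_free_inv coinv_free.
Proof.
move=> v; rewrite coinv_freeE coinv_free_invE to_coinvK coinv_proj_free !coinv_free_funE counit1 !scale1r.
by [].
Qed.
(** E((1 (x) v) S(h)) = E(S(h_2) (x) S^-1(S(h_1)) v) = 1 (x) h v. *)
Lemma coinv_free_hom : is_modhom coinv_free.
Proof.
move=> x t; rewrite -{1}(coinv_freeK t) -[mact x _]/(hopf_act (x : H) (coinv_free_inv (coinv_free t))).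
rewrite -[RHS]/(hopf_act (x : H) (coinv_free t)); move: (coinv_free t) => v.
rewrite coinv_act coinv_free_invE coinv_freeE !to_coinvK.
have -> : coinv_proj (free_mod V) ((1 : H) *t v) = (1 : H) *t v.
  by rewrite coinv_proj_free coinv_free_funE counit1 scale1r.
rewrite coinv_proj_free coinv_free_funE counit1 scale1r mod_r_freeE.
have h := lin_coinv_free_fun; have b := hopf_act_bilin HV.
rewrite comul_antipode; last by lin.
pull_sw coinv_free_fun; under eq_lift => a b0 do rewrite coinv_free_funE mul1r antipodeK counit_antipode.
by sw_rewrite (@counit_r _ _ HH V (x : H) (fun a : H => hopf_act a v)).
Qed.
Lemma coinv_free_isom : @isom k DC _ _ coinv_free.
Proof.
apply: modcat_isom; [exact: (coinv_module free_mod_module)|exact: HV|exact: coinv_free_hom|exact: coinv_freeK|exact: coinv_free_invK].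
Qed.
End V.

Lemma free_mapE (V W : mod_data K) (f : 'Hom(V, W)) l v : free_map f (l *t v) = l *t f v.
Proof. by rewrite /free_map (@tmap_tensor _ H H V W) id_lfunE. Qed.
Lemma free_map_hom (V W : mod_data K) (f : 'Hom(V, W)) :
  is_module V -> is_module W -> is_modhom f -> is_modhom (free_map f).
Proof.
move=> HV HW hf; have gV := free_mod_module HV; have gW := free_mod_module HW.
have b1 := mod_l_bilin gV; have b2 := mod_l_bilin gW; have b3 := mod_r_bilin gV; have b4 := mod_r_bilin gW.
apply: modhom_of => // [a t|a t|t].
- rewrite (mod_l_free HV) (mod_l_free HW); have h := @free_lmul_bilin k H.
  apply: (@tens_ext _ H V _ (fun t : tens H V => free_map f (free_lmul a t)) (fun t : tens H V => free_lmul a (free_map f t : tens H W))); [by lin|by lin|move=> l v].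
  by rewrite free_lmulE !free_mapE free_lmulE.
- apply: (@tens_ext _ H V _ (fun t => free_map f (mod_r (M := free_mod V) t a)) (fun t => mod_r (M := free_mod W) (free_map f t) a)); [by lin|by lin|move=> l v].
  rewrite mod_r_freeE // free_mapE mod_r_freeE // lfun_lift; apply: eq_lift => a1 a2.
  by rewrite free_mapE; congr (_ *t _); exact: hf.
apply: (@tens_ext _ H V _ (fun t => mod_co (free_mod W) (free_map f t)) (fun t => \sw_(x, n <- mod_co (free_mod V) t) (x *t free_map f n))); [by lin|by lin|move=> l v].
rewrite free_mapE !mod_co_freeE // lift_lift; apply: eq_lift => l1 l2.
by rewrite lift_tensor ?free_mapE //; lin.
Qed.
Lemma free_functor_lin : is_lin_functor free_functor.
Proof.
split.
- by move=> V; exact: free_mod_module.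
- move=> X Y f [hX hY hf]; split; [exact: free_mod_module|exact: free_mod_module|exact: free_map_hom].
- by move=> X _; exact: tmap_id.
- move=> X Y Z g f _ _; rewrite /= /free_map -tmap_comp.
  by congr (tmap _ _); rewrite comp_lfun1l.
- by move=> X Y a f g _ _; exact: tmap_linr.
Qed.

Section M.
Variables (M : mod_data L) (HM : is_module M).
Let HF := coinv_module HM.
Let b1 := mod_l_bilin HM.
Let b2 := mod_r_bilin HM.
Let HG := free_mod_module HF.
(** Its inverse is m |-> m_{-1} (x) E(m_0), by [coinv_decomposition]. *)
Definition free_coinv : 'Hom(free_mod (F M), M) :=
  linfun (fun t : tens H (F M) => \sw_(a, v <- t) mod_l a (of_coinv v)).
Lemma free_coinvE a v : free_coinv (a *t v) = mod_l a (of_coinv v).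
Proof. by rewrite /free_coinv linfunE ?lift_tensor //; lin. Qed.
Definition free_coinv_inv : 'Hom(M, free_mod (F M)) :=
  linfun (fun m : M => \sw_(x, n <- mod_co M m) (x *t to_coinv n) : tens H (F M)).
Lemma free_coinv_invE m : free_coinv_inv m = \sw_(x, n <- mod_co M m) (x *t to_coinv n).
Proof. by rewrite /free_coinv_inv linfunE //; lin. Qed.
Lemma free_coinvK : cancel free_coinv free_coinv_inv.
Proof.
apply: (@tens_ext _ H (F M)); [by lin|by lin|move=> a v].
rewrite free_coinvE free_coinv_invE (mod_co_l HM) lift_lift.
transitivity (\sw_(a1, a2 <- D a) ((eps a2 : k) *: (a1 *t v))).
  apply: eq_lift => a1 a2; rewrite lift_lift mod_co_of_coinv // lift_tensor; last by lin.
  rewrite lift_tensor; last by lin.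
  rewrite mulr1; have -> : to_coinv (mod_l a2 (of_coinv v)) = (eps a2 : k) *: v.
    by apply: of_coinv_inj; rewrite to_coinvK coinv_proj_l // coinv_proj_of_coinv // (linZ _ _ (@lin_of_coinv _ _ HH M)).
  by pull_scale (fun z : F M => a1 *t z).
by sw_rewrite (@counit_r _ _ HH _ a (fun a => a *t v)).
Qed.
Lemma free_coinv_invK : cancel free_coinv_inv free_coinv.
Proof.
move=> m; rewrite free_coinv_invE lfun_lift -[RHS](coinv_decomposition HM).
by apply: eq_lift => x n; rewrite free_coinvE to_coinvK.
Qed.
(** For coinvariant v the vector v a has coaction a_1 (x) v a_2, hence v a = a_1 E(v a_2), and
    E(v a_2) = S^-1(a_2) * v: this is the right multiplication of H (x) V. *)
Lemma free_coinv_hom : is_modhom free_coinv.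
Proof.
have g1 := mod_l_bilin HG; have g2 := mod_r_bilin HG.
apply: modhom_of => // [a t|a t|t].
- rewrite (mod_l_free HF); have h := @free_lmul_bilin k H.
  apply: (@tens_ext _ H (F M) _ (fun t : tens H (F M) => free_coinv (free_lmul a t)) (fun t => mod_l a (free_coinv t))); [by lin|by lin|move=> l v].
  by rewrite free_lmulE !free_coinvE mod_lM.
- apply: (@tens_ext _ H (F M) _ (fun t => free_coinv (mod_r (M := free_mod (F M)) t a)) (fun t => mod_r (free_coinv t) a)); [by lin|by lin|move=> l v].
  rewrite mod_r_freeE // free_coinvE lfun_lift.
  have e : mod_co M (mod_r (of_coinv v) a) = \sw_(a1, a2 <- D a) (a1 *t mod_r (of_coinv v) a2).
    rewrite (mod_co_r HM); apply: eq_lift => a1 a2; rewrite mod_co_of_coinv // lift_tensor ?mul1r //; lin.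
  rewrite -mod_lrA // -(coinv_decomposition HM (mod_r (of_coinv v) a)) e lift_lift; pull_sw (mod_l (M := M) l).
  apply: eq_lift => a1 a2; rewrite lift_tensor; last by lin.
  by rewrite free_coinvE coinv_act to_coinvK antipodeVK mod_lM.
apply: (@tens_ext _ H (F M) _ (fun t => mod_co M (free_coinv t)) (fun t => \sw_(x, n <- mod_co (free_mod (F M)) t) (x *t free_coinv n))); [by lin|by lin|move=> l v].
rewrite free_coinvE (mod_co_l HM) mod_co_freeE // lift_lift; apply: eq_lift => l1 l2.
rewrite mod_co_of_coinv // !lift_tensor ?free_coinvE ?mulr1 //; lin.
Qed.
Lemma free_coinv_isom : @isom k C _ _ free_coinv.
Proof.
apply: modcat_isom; [exact: HG|exact: HM|exact: free_coinv_hom|exact: free_coinvK|exact: free_coinv_invK].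
Qed.
End M.

Lemma free_coinv_nat (M N : mod_data L) (f : 'Hom(M, N)) : is_module M -> is_module N -> is_modhom f ->
  (free_coinv N \o free_map (coinv_map f) = f \o free_coinv M)%VF.
Proof.
move=> HM HN hf; apply: (@tens_lfun_ext _ H (F M)) => a v.
by rewrite !comp_lfunE free_mapE !free_coinvE // of_coinv_map // modhom_l.
Qed.
Lemma coinv_free_nat (V W : mod_data K) (f : 'Hom(V, W)) : is_module V -> is_module W -> is_modhom f ->
  (coinv_free W \o coinv_map (free_map f) = f \o coinv_free V)%VF.
Proof.
move=> HV HW hf; apply/lfunP => t.
have h1 := free_mod_module HV; have h2 := free_mod_module HW; have h3 := free_map_hom HV HW hf.
rewrite !comp_lfunE !coinv_freeE of_coinv_map //; move: (of_coinv t).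
have l1 := @lin_coinv_free_fun V; have l2 := @lin_coinv_free_fun W.
apply: (@tens_ext _ H V _ (fun t => coinv_free_fun (free_map f t)) (fun t => f (coinv_free_fun t))); [by lin|by lin|move=> l v].
by rewrite free_mapE !coinv_free_funE linearZ.
Qed.

Lemma coinv_functor_equivalence : is_equivalence (coinv_functor HH).
Proof.
split; first exact: coinv_functor_lin.
exists free_functor; split; first exact: free_functor_lin.
- exists free_coinv; split; first by move=> X; exact: free_coinv_isom.
  by move=> X Y f [hX hY hf]; exact: free_coinv_nat.
exists coinv_free; split; first by move=> X; exact: coinv_free_isom.
by move=> X Y f [hX hY hf]; exact: coinv_free_nat.
Qed.
End Equiv.

Theorem proposition3p11 (k : fieldType) (char0 : [pchar k] =i pred0)
    (H : falgType k) (HH : hopf_structure H) :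
  [/\ is_algebra (smash_double HH),
      is_algebra (tens_alg (heisenberg (cop_bialg HH)) (falg_data H)) &
      alg_iso (smash_double HH)
              (tens_alg (heisenberg (cop_bialg HH)) (falg_data H))] /\
  [/\ is_monoidal (smash_modules (@double_act k H HH) (double_R HH)),
      is_monoidal (bialg_modules (cop_bialg HH)) &
      monoidally_equivalent (smash_modules (@double_act k H HH) (double_R HH))
                            (bialg_modules (cop_bialg HH))].
Proof.
split.
  by split; [exact: smash_algebra|exact: heisH_algebra|exact: smash_iso].
split; [exact: smash_monoidal|exact: cop_monoidal|].
exists (coinv_functor HH), (@coinv_tens k H HH), (coinv_unit HH); split.
  exact: coinv_functor_monoidal.
exact: coinv_functor_equivalence.
Qed.
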